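(* Let $G$ be a group and $F$ a field of characteristic $0$. Let $\Pi=\Gamma_{FG}[[t]]$. Then ${\bf L}^*\circ{\bf S}^*$ is the identity function on $t\Pi$ and ${\bf S}^*\circ{\bf L}^*$ is the identity function on $1+t\Pi$.
   Context: $R_{FG}$ is the Green ring: the ring spanned over $\mathbb Z$ by the isomorphism classes of finite-dimensional $FG$-modules, with addition and multiplication coming from direct sums and tensor products. $\Gamma_{FG}=\mathbb Q\otimes_{\mathbb Z}R_{FG}\supseteq R_{FG}$. A finite-dimensional module $V$ is also written $V$ for its class, and $V^n$ is the class of its $n$-fold tensor power. $\Pi=\Gamma_{FG}[[t]]$; $t\Pi$ and $1+t\Pi$ are the sets of power series with constant term $0$ and $1$. The functions $\exp:t\Pi\to 1+t\Pi$ and $\log:1+t\Pi\to t\Pi$ are given by the usual power series and are mutually inverse. Symmetric powers: for a finite-dimensional $FG$-module $V$, $S^r(V)$ is the $r$th homogeneous component of the polynomial algebra (free commutative associative algebra) on $V$, with $G$ acting by algebra automorphisms, and $S(V,t)=1+S^1(V)t+S^2(V)t^2+\cdots\in 1+t\Pi$. Since $S(U\oplus V,t)=S(U,t)S(V,t)$, there is a unique $\mathbb Q$-linear function $\psi:\Gamma_{FG}\to t\Pi$ with $\psi(V)=\log(S(V,t))$ for all finite-dimensional $V$. Define ${\bf S}^+:t\Pi\to t\Pi$ by $${\bf S}^+(A_1t+A_2t^2+A_3t^3+\cdots)=\psi(A_1)+\psi(A_2)_{t\mapsto t^2}+\psi(A_3)_{t\mapsto t^3}+\cdots$$ for $A_i\in\Gamma_{FG}$,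 where the subscript $t\mapsto t^r$ denotes replacing $X_1t+X_2t^2+\cdots$ by $X_1t^r+X_2t^{2r}+\cdots$. Define ${\bf S}^*=\exp\circ{\bf S}^+:t\Pi\to 1+t\Pi$. (So ${\bf S}^*(Vt)=S(V,t)$.) Lie powers: $L^r(V)$ is the $r$th homogeneous component of the free Lie algebra $L(V)$ over $F$ on $V$, with $G$ acting by Lie algebra automorphisms extending the action on $V$. For each $r\geq 1$, the Lie resolvent $\Phi^r:\Gamma_{FG}\to\Gamma_{FG}$ is the (well-defined, unique) $\mathbb Q$-linear function such that $\Phi^r(V)=\sum_{d\mid r}\mu(r/d)\,d\,L^d(V^{r/d})$ for all finite-dimensional $V$, where $\mu$ is the Möbius function. Let ${\bf L}^+:t\Pi\to t\Pi$ be given by $${\bf L}^+(A_1t+A_2t^2+\cdots)=\sum_{r\geq1}\Bigl(\sum_{d\mid r}\tfrac1d\,\Phi^d(A_{r/d})\Bigr)t^r\qquad(A_i\in\Gamma_{FG}),$$ and let ${\bf L}^*={\bf L}^+\circ\log:1+t\Pi\to t\Pi$. (So ${\bf L}^*(fg)={\bf L}^*(f)+{\bf L}^*(g)$ and $-{\bf L}^*(1-Vt)=L^1(V)t+L^2(V)t^2+\cdots$ for finite-dimensional $V$.) *)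

(* Defs.v *)
From HB Require Import structures.
From mathcomp Require Import mpoly mxtens.
From mathcomp Require Import all_boot all_order all_algebra ring boolp.

Set Implicit Arguments.
Unset Strict Implicit.
Unset Printing Implicit Defensive.
Import GRing.Theory Num.Theory.
Local Open Scope ring_scope.
Local Open Scope quotient_scope.

Section FreeLie.
Variables (F : fieldType) (V : lmodType F).

Inductive lie_term : Type :=
| LieVar of V
| LieZero
| LieAdd of lie_term & lie_term
| LieScale of F & lie_term
| LieBr of lie_term & lie_term.

(* The smallest congruence making the terms an F-Lie algebra in which LieVar
   is linear. *)
Inductive lie_eq : lie_term -> lie_term -> Prop :=
| lie_refl x : lie_eq x x
| lie_sym x y : lie_eq x y -> lie_eq y x
| lie_trans y x z : lie_eq x y -> lie_eq y z -> lie_eq x z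
| lie_congrD x x' y y' :
    lie_eq x x' -> lie_eq y y' -> lie_eq (LieAdd x y) (LieAdd x' y')
| lie_congrZ a x x' : lie_eq x x' -> lie_eq (LieScale a x) (LieScale a x')
| lie_congrB x x' y y' :
    lie_eq x x' -> lie_eq y y' -> lie_eq (LieBr x y) (LieBr x' y')
| lie_addA x y z : lie_eq (LieAdd x (LieAdd y z)) (LieAdd (LieAdd x y) z)
| lie_addC x y : lie_eq (LieAdd x y) (LieAdd y x)
| lie_add0 x : lie_eq (LieAdd LieZero x) x
| lie_addN x : lie_eq (LieAdd (LieScale (-1) x) x) LieZero
| lie_scaleA a b x : lie_eq (LieScale a (LieScale b x)) (LieScale (a * b) x)
| lie_scale1 x : lie_eq (LieScale 1 x) x
| lie_scaleDr a x y :
    lie_eq (LieScale a (LieAdd x y)) (LieAdd (LieScale a x) (LieScale a y))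
| lie_scaleDl a b x :
    lie_eq (LieScale (a + b) x) (LieAdd (LieScale a x) (LieScale b x))
| lie_brDl x y z : lie_eq (LieBr (LieAdd x y) z) (LieAdd (LieBr x z) (LieBr y z))
| lie_brDr x y z : lie_eq (LieBr x (LieAdd y z)) (LieAdd (LieBr x y) (LieBr x z))
| lie_brZl a x y : lie_eq (LieBr (LieScale a x) y) (LieScale a (LieBr x y))
| lie_brZr a x y : lie_eq (LieBr x (LieScale a y)) (LieScale a (LieBr x y))
| lie_brxx x : lie_eq (LieBr x x) LieZero
| lie_jacobi x y z :
    lie_eq (LieAdd (LieAdd (LieBr x (LieBr y z)) (LieBr y (LieBr z x)))
                   (LieBr z (LieBr x y))) LieZero
| lie_varD u v : lie_eq (LieVar (u + v)) (LieAdd (LieVar u) (LieVar v))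
| lie_varZ a v : lie_eq (LieVar (a *: v)) (LieScale a (LieVar v)).

HB.instance Definition _ := gen_eqMixin lie_term.
HB.instance Definition _ := gen_choiceMixin lie_term.

Definition lie_rel : rel lie_term := fun x y => `[< lie_eq x y >].
Lemma lie_rel_refl : reflexive lie_rel.
Proof. by move=> x; apply/asboolP; apply: lie_refl. Qed.
Lemma lie_rel_sym : symmetric lie_rel.
Proof. by move=> x y; apply/asboolP/asboolP; apply: lie_sym. Qed.
Lemma lie_rel_trans : transitive lie_rel.
Proof.
by move=> y x z /asboolP xy /asboolP yz; apply/asboolP; apply: lie_trans xy yz.
Qed.
Canonical lie_equiv := EquivRel lie_rel lie_rel_refl lie_rel_sym lie_rel_trans.

Definition freeLie := {eq_quot lie_equiv}.
HB.instance Definition _ := Choice.on freeLie.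
HB.instance Definition _ := EqQuotient.on freeLie.

Lemma freeLieP (x y : lie_term) :
  lie_eq x y <-> \pi_freeLie x = \pi_freeLie y.
Proof.
split=> [xy|/eqquotP/asboolP//]; by apply/eqquotP/asboolP.
Qed.

Definition freeLie_gen (v : V) : freeLie := \pi_freeLie (LieVar v).
Definition freeLie_zero : freeLie := \pi_freeLie LieZero.
Definition freeLie_add (x y : freeLie) : freeLie :=
  \pi_freeLie (LieAdd (repr x) (repr y)).
Definition freeLie_scale (a : F) (x : freeLie) : freeLie :=
  \pi_freeLie (LieScale a (repr x)).
Definition freeLie_opp (x : freeLie) : freeLie := freeLie_scale (-1) x.
Definition freeLie_br (x y : freeLie) : freeLie :=
  \pi_freeLie (LieBr (repr x) (repr y)).

Lemma lie_repr x : lie_eq (repr (\pi_freeLie x)) x.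
Proof. by apply/freeLieP; rewrite reprK. Qed.

Lemma freeLie_addE x y :
  freeLie_add (\pi_freeLie x) (\pi_freeLie y) = \pi_freeLie (LieAdd x y).
Proof. by apply/freeLieP; apply: lie_congrD; apply: lie_repr. Qed.
Lemma freeLie_scaleE a x :
  freeLie_scale a (\pi_freeLie x) = \pi_freeLie (LieScale a x).
Proof. by apply/freeLieP; apply: lie_congrZ; apply: lie_repr. Qed.
Lemma freeLie_brE x y :
  freeLie_br (\pi_freeLie x) (\pi_freeLie y) = \pi_freeLie (LieBr x y).
Proof. by apply/freeLieP; apply: lie_congrB; apply: lie_repr. Qed.

Lemma freeLie_addA : associative freeLie_add.
Proof.
elim/quotW=> x; elim/quotW=> y; elim/quotW=> z.
rewrite (freeLie_addE y) (freeLie_addE x y) !freeLie_addE.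
by apply/freeLieP; apply: lie_addA.
Qed.
Lemma freeLie_addC : commutative freeLie_add.
Proof.
elim/quotW=> x; elim/quotW=> y.
by rewrite !freeLie_addE; apply/freeLieP; apply: lie_addC.
Qed.
Lemma freeLie_add0 : left_id freeLie_zero freeLie_add.
Proof.
by elim/quotW=> x; rewrite freeLie_addE; apply/freeLieP; apply: lie_add0.
Qed.
Lemma freeLie_addN : left_inverse freeLie_zero freeLie_opp freeLie_add.
Proof.
elim/quotW=> x; rewrite /freeLie_opp freeLie_scaleE freeLie_addE.
by apply/freeLieP; apply: lie_addN.
Qed.

HB.instance Definition _ := GRing.isZmodule.Build freeLie
  freeLie_addA freeLie_addC freeLie_add0 freeLie_addN.

Lemma freeLie_scaleA a b x :
  freeLie_scale a (freeLie_scale b x) = freeLie_scale (a * b) x.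
Proof.
elim/quotW: x => x; rewrite (freeLie_scaleE b) !freeLie_scaleE.
by apply/freeLieP; apply: lie_scaleA.
Qed.
Lemma freeLie_scale1 : left_id 1 freeLie_scale.
Proof.
by elim/quotW=> x; rewrite freeLie_scaleE; apply/freeLieP; apply: lie_scale1.
Qed.
Lemma freeLie_scaleDr : right_distributive freeLie_scale +%R.
Proof.
move=> a; elim/quotW=> x; elim/quotW=> y; rewrite /GRing.add /=.
rewrite (freeLie_addE x) !freeLie_scaleE freeLie_addE.
by apply/freeLieP; apply: lie_scaleDr.
Qed.
Lemma freeLie_scaleDl x : {morph freeLie_scale^~ x : a b / a + b}.
Proof.
move=> a b; elim/quotW: x => x; rewrite [in RHS]/GRing.add /=.
rewrite !freeLie_scaleE freeLie_addE.
by apply/freeLieP; apply: lie_scaleDl.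
Qed.

HB.instance Definition _ := GRing.Zmodule_isLmodule.Build F freeLie
  freeLie_scaleA freeLie_scale1 freeLie_scaleDr freeLie_scaleDl.

Lemma freeLieDE x y :
  \pi_freeLie x + \pi_freeLie y = \pi_freeLie (LieAdd x y).
Proof. exact: freeLie_addE. Qed.
Lemma freeLieZE a x : a *: \pi_freeLie x = \pi_freeLie (LieScale a x).
Proof. exact: freeLie_scaleE. Qed.

Lemma freeLie_gen_is_linear : linear freeLie_gen.
Proof.
move=> a u v; rewrite /freeLie_gen freeLieZE freeLieDE; apply/freeLieP.
apply: lie_trans (lie_varD _ _) _; apply: lie_congrD; first exact: lie_varZ.
exact: lie_refl.
Qed.
HB.instance Definition _ := GRing.isLinear.Build F V freeLie _ freeLie_gen
  freeLie_gen_is_linear.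

(* The homogeneous components: the least family of subspaces containing the
   generators in degree 1 and such that [L^r, L^s] is contained in L^(r+s). *)
Inductive freeLie_homog : nat -> freeLie -> Prop :=
| homog_gen v : freeLie_homog 1 (freeLie_gen v)
| homog_0 r : freeLie_homog r 0
| homog_lin r a x y :
    freeLie_homog r x -> freeLie_homog r y -> freeLie_homog r (a *: x + y)
| homog_br r s x y : freeLie_homog r x -> freeLie_homog s y ->
    freeLie_homog (r + s) (freeLie_br x y).

End FreeLie.

Lemma linear_fun0 (R : pzRingType) (U V : lmodType R) (f : U -> V) :
  linear f -> f 0 = 0.
Proof.
move=> /(_ (-1) 0 0); rewrite scaler0 addr0 scaleN1r addNr; exact.
Qed.

Lemma linear_fun_sum (R : pzRingType) (U V : lmodType R) (f : U -> V)
    (I : finType) (c : I -> R) (x : I -> U) :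
  linear f -> f (\sum_i c i *: x i) = \sum_i c i *: f (x i).
Proof.
move=> fL; elim: (index_enum I) => [|i s IHs].
  by rewrite !big_nil (linear_fun0 fL).
by rewrite !big_cons fL IHs.
Qed.

Record lie_bracket (F : fieldType) (M : lmodType F) (br : M -> M -> M) : Prop :=
  LieBracket {
    lie_br_linear_l : forall y, linear (br^~ y);
    lie_br_linear_r : forall x, linear (br x);
    lie_br_alt : forall x, br x x = 0;
    lie_br_jacobi : forall x y z,
      br x (br y z) + br y (br z x) + br z (br x y) = 0 }.

Section FreeLieUniversal.
Variables (F : fieldType) (V : lmodType F).

Lemma freeLie_br_lie : lie_bracket (@freeLie_br F V).
Proof.
split.
- elim/quotW=> y a; elim/quotW=> x; elim/quotW=> x'.
  rewrite freeLieZE freeLieDE !freeLie_brE freeLieZE freeLieDE.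
  apply/freeLieP; apply: lie_trans (lie_brDl _ _ _) _.
  by apply: lie_congrD; [apply: lie_brZl | apply: lie_refl].
- elim/quotW=> y a; elim/quotW=> x; elim/quotW=> x'.
  rewrite freeLieZE freeLieDE !freeLie_brE freeLieZE freeLieDE.
  apply/freeLieP; apply: lie_trans (lie_brDr _ _ _) _.
  by apply: lie_congrD; [apply: lie_brZr | apply: lie_refl].
- by elim/quotW=> x; rewrite freeLie_brE; apply/freeLieP/lie_brxx.
elim/quotW=> x; elim/quotW=> y; elim/quotW=> z.
rewrite (freeLie_brE y z) (freeLie_brE z x) (freeLie_brE x y).
rewrite (freeLie_brE x (LieBr y z)) (freeLie_brE y (LieBr z x)).
rewrite (freeLie_brE z (LieBr x y)).
rewrite (freeLieDE (LieBr x (LieBr y z)) (LieBr y (LieBr z x))) freeLieDE.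
by apply/freeLieP/lie_jacobi.
Qed.

Section Lift.
Variables (M : lmodType F) (br : M -> M -> M) (f : V -> M).

Fixpoint lie_eval (t : lie_term V) : M :=
  match t with
  | LieVar v => f v
  | LieZero => 0
  | LieAdd x y => lie_eval x + lie_eval y
  | LieScale a x => a *: lie_eval x
  | LieBr x y => br (lie_eval x) (lie_eval y)
  end.

Definition freeLie_lift (x : freeLie V) : M := lie_eval (repr x).

Hypotheses (brL : lie_bracket br) (fL : linear f).

Lemma lie_eval_eq x y : lie_eq x y -> lie_eval x = lie_eval y.
Proof.
have [Bl Br Bxx BJ] := brL.
have B0l z : br 0 z = 0.
  exact: (linear_fun0 (Bl z)).
have B0r z : br z 0 = 0.
  exact: (linear_fun0 (Br z)).
have f0 : f 0 = 0.
  exact: linear_fun0.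
elim=> //=.
- by move=> {}x {}y z _ -> _ ->.
- by move=> {}x x' {}y y' _ -> _ ->.
- by move=> a {}x x' _ ->.
- by move=> {}x x' {}y y' _ -> _ ->.
- by move=> *; rewrite addrA.
- by move=> *; rewrite addrC.
- by move=> *; rewrite add0r.
- by move=> *; rewrite scaleN1r addNr.
- by move=> *; rewrite scalerA.
- by move=> *; rewrite scale1r.
- by move=> *; rewrite scalerDr.
- by move=> *; rewrite scalerDl.
- by move=> {}x {}y z; have := Bl (lie_eval z) 1 (lie_eval x) (lie_eval y); rewrite !scale1r.
- by move=> {}x {}y z; have := Br (lie_eval x) 1 (lie_eval y) (lie_eval z); rewrite !scale1r.
- by move=> a {}x {}y; have := Bl (lie_eval y) a (lie_eval x) 0; rewrite B0l !addr0.
- by move=> a {}x {}y; have := Br (lie_eval x) a (lie_eval y) 0; rewrite B0r !addr0.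
- by move=> u v; have := fL 1 u v; rewrite !scale1r.
by move=> a v; have := fL a v 0; rewrite f0 !addr0.
Qed.

Lemma freeLie_liftE t : freeLie_lift (\pi_(freeLie V) t) = lie_eval t.
Proof. exact/lie_eval_eq/lie_repr. Qed.

Lemma freeLie_lift_gen v : freeLie_lift (freeLie_gen v) = f v.
Proof. exact: freeLie_liftE. Qed.

Lemma freeLie_lift_linear : linear freeLie_lift.
Proof.
move=> a; elim/quotW=> x; elim/quotW=> y.
by rewrite freeLieZE freeLieDE !freeLie_liftE.
Qed.

Lemma freeLie_lift_br :
  {morph freeLie_lift : x y / freeLie_br x y >-> br x y}.
Proof.
elim/quotW=> x; elim/quotW=> y.
by rewrite freeLie_brE !freeLie_liftE.
Qed.

Lemma freeLie_lift_unique (h : freeLie V -> M) : linear h ->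
  {morph h : x y / freeLie_br x y >-> br x y} ->
  (forall v, h (freeLie_gen v) = f v) -> h =1 freeLie_lift.
Proof.
move=> hL hB hv.
have hZD a x y : h (a *: x + y) = a *: h x + h y by apply: hL.
have h0 : h 0 = 0.
  exact: linear_fun0.
elim/quotW; elim=> [v||x IHx y IHy|a x IHx|x IHx y IHy].
- by rewrite freeLie_liftE; apply: hv.
- by rewrite freeLie_liftE; apply: h0.
- by rewrite -freeLieDE -[X in X + _]scale1r hL freeLie_lift_linear IHx IHy.
- by rewrite -freeLieZE -[X in h X]addr0 hL h0 addr0 IHx freeLieZE !freeLie_liftE.
by rewrite -freeLie_brE hB freeLie_lift_br IHx IHy.
Qed.

End Lift.
End FreeLieUniversal.

Section FreeLieMap.
Variables (F : fieldType) (V W : lmodType F) (f : {linear V -> W}).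

Definition freeLie_map : freeLie V -> freeLie W :=
  freeLie_lift (@freeLie_br F W) (fun v => freeLie_gen (f v)).

Lemma freeLie_map_gen_linear : linear (fun v => freeLie_gen (f v)).
Proof. by move=> a u v; rewrite !linearP. Qed.

Lemma freeLie_map_linear : linear freeLie_map.
Proof.
apply: freeLie_lift_linear; first exact: freeLie_br_lie.
exact: freeLie_map_gen_linear.
Qed.
HB.instance Definition _ := GRing.isLinear.Build F (freeLie V) (freeLie W) _
  freeLie_map freeLie_map_linear.

Lemma freeLie_map_gen v : freeLie_map (freeLie_gen v) = freeLie_gen (f v).
Proof.
apply: freeLie_lift_gen; first exact: freeLie_br_lie.
exact: freeLie_map_gen_linear.
Qed.

Lemma freeLie_map_br x y :
  freeLie_map (freeLie_br x y) = freeLie_br (freeLie_map x) (freeLie_map y).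
Proof.
apply: freeLie_lift_br; first exact: freeLie_br_lie.
exact: freeLie_map_gen_linear.
Qed.

Lemma freeLie_map_homog r x : freeLie_homog r x -> freeLie_homog r (freeLie_map x).
Proof.
elim=> {r x} [v|r|r a x y _ Hx _ Hy|r s x y _ Hx _ Hy].
- by rewrite freeLie_map_gen; apply: homog_gen.
- by rewrite linear0; apply: homog_0.
- by rewrite linearP; apply: homog_lin.
by rewrite freeLie_map_br; apply: homog_br.
Qed.

End FreeLieMap.

Lemma freeLie_map_ext (F : fieldType) (V W : lmodType F)
    (f f' : {linear V -> W}) : f =1 f' -> freeLie_map f =1 freeLie_map f'.
Proof.
move=> ff'; have -> : freeLie_map f' = freeLie_map f :> (_ -> _) by
  rewrite /freeLie_map; congr freeLie_lift; apply: funext => v; rewrite ff'.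
by [].
Qed.

Lemma freeLie_map_id (F : fieldType) (V : lmodType F) (f : {linear V -> V}) :
  f =1 id -> freeLie_map f =1 id.
Proof.
move=> f1; apply: fsym; apply: freeLie_lift_unique => //.
- exact: freeLie_br_lie.
- exact: freeLie_map_gen_linear.
by move=> v; rewrite f1.
Qed.

Lemma freeLie_map_comp (F : fieldType) (U V W : lmodType F)
    (f : {linear U -> V}) (g : {linear V -> W}) (h : {linear U -> W}) :
  h =1 g \o f -> freeLie_map h =1 freeLie_map g \o freeLie_map f.
Proof.
move=> hE; apply: fsym; apply: freeLie_lift_unique => //.
- exact: freeLie_br_lie.
- exact: freeLie_map_gen_linear.
- by move=> a x y /=; rewrite !linearP.
- by move=> x y /=; rewrite !freeLie_map_br.
by move=> v /=; rewrite !freeLie_map_gen hE.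
Qed.

Section FreeLieFinite.
Variables (F : fieldType) (n : nat).
Local Notation V := 'rV[F]_n.

Definition in_span (M : lmodType F) (s : seq M) (x : M) :=
  exists c : nat -> F, x = \sum_(i < size s) c i *: s`_i.

Lemma in_span0 (M : lmodType F) (s : seq M) : in_span s 0.
Proof. by exists (fun=> 0); rewrite big1 // => i _; rewrite scale0r. Qed.

Lemma in_span_lin (M : lmodType F) (s : seq M) a x y :
  in_span s x -> in_span s y -> in_span s (a *: x + y).
Proof.
move=> [c ->] [d ->]; exists (fun i => a * c i + d i).
rewrite scaler_sumr -big_split /=; apply: eq_bigr => i _.
by rewrite scalerDl scalerA.
Qed.

Lemma in_span_sum (M : lmodType F) (s : seq M) (I : finType) (c : I -> F)
    (x : I -> M) :
  (forall i, in_span s (x i)) -> in_span s (\sum_i c i *: x i).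
Proof.
move=> xs; elim/big_ind: _ => [|u v su sv|i _]; first exact: in_span0.
  by rewrite -[u]scale1r; apply: in_span_lin.
by rewrite -[_ *: _]addr0; apply: in_span_lin => //; apply: in_span0.
Qed.

Lemma in_span_mem (M : lmodType F) (s : seq M) x : x \in s -> in_span s x.
Proof.
move=> xs; exists (fun i => (i == index x s)%:R).
have lt_xs : (index x s < size s)%N by rewrite index_mem.
rewrite (bigD1 (Ordinal lt_xs)) //= eqxx scale1r nth_index // big1 ?addr0 //.
by move=> i; rewrite -val_eqE /= => /negPf->; rewrite scale0r.
Qed.

Lemma freeLie_homog_finite r :
  exists s : seq (freeLie V), forall x, freeLie_homog r x -> in_span s x.
Proof.
elim/ltn_ind: r => r IHr.
pose B i := if pselect (exists s : seq (freeLie V),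
    forall x, freeLie_homog i x -> in_span s x) is left h then sval (cid h)
  else [::].
have BP i x : (i < r)%N -> freeLie_homog i x -> in_span (B i) x.
  move=> ir; rewrite /B; case: pselect => [h|[]]; last exact: IHr.
  by case: cid => s /= H; apply: H.
pose gens := [seq freeLie_gen (delta_mx 0 i : V) | i <- enum 'I_n].
pose s := gens ++
  flatten [seq [seq freeLie_br x y | x <- B i, y <- B (r - i)%N] | i <- iota 0 r].
exists s => x; move: {1 3}r (erefl r) => r' + Hx.
have B0 (i : nat) (x0 : freeLie V) : freeLie_homog i x0 -> i = 0%N -> x0 = 0.
  move=> Hy; elim: Hy => {i x0} [v|k|k a y1 y2 _ IH1 _ IH2 k0|k j y1 y2 _ IH1 _ _] //.
    by rewrite IH1 // IH2 // scaler0 addr0.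
  move/eqP; rewrite addn_eq0 => /andP[/eqP k0 _]; rewrite IH1 //.
  have [Bl _ _ _] := @freeLie_br_lie F V.
  exact: (linear_fun0 (Bl y2)).
elim: Hx => [v _|i _|i a y1 y2 _ IH1 _ IH2 E|i j y1 y2 Hy1 IH1 Hy2 IH2 E].
- rewrite (row_sum_delta v) linear_sum /=.
  rewrite (eq_bigr (fun j => v 0 j *: freeLie_gen (delta_mx 0 j : V))).
    apply: in_span_sum => j; apply: in_span_mem; rewrite mem_cat.
    by apply/orP; left; apply/mapP; exists j; rewrite ?mem_enum.
  by move=> j _; rewrite linearZ.
- exact: in_span0.
- by apply: in_span_lin; [apply: IH1 | apply: IH2].
have [Bl Br _ _] := @freeLie_br_lie F V.
have Bl0 z : freeLie_br 0 z = 0 :> freeLie V.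
  exact: (linear_fun0 (Bl z)).
have Br0 z : freeLie_br z 0 = 0 :> freeLie V.
  exact: (linear_fun0 (Br z)).
have [i0|i_gt0] := posnP i.
  by rewrite (B0 _ _ Hy1 i0) Bl0; apply: in_span0.
have [j0|j_gt0] := posnP j.
  by rewrite (B0 _ _ Hy2 j0) Br0; apply: in_span0.
have ltir : (i < r)%N by rewrite -E -[X in (X < _)%N]addn0 ltn_add2l.
have ltjr : (j < r)%N by rewrite -E -[X in (X < _)%N]add0n ltn_add2r.
have [c ->] := BP _ _ ltir Hy1; have [d ->] := BP _ _ ltjr Hy2.
rewrite (linear_fun_sum _ _ (Bl _)); apply: in_span_sum => k.
rewrite (linear_fun_sum _ _ (Br _)).
apply: in_span_sum => l; apply: in_span_mem; rewrite mem_cat; apply/orP; right.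
apply/flattenP; exists [seq freeLie_br x y | x <- B i, y <- B (r - i)%N].
  by apply/mapP; exists i; rewrite // mem_iota.
apply/allpairsP; exists ((B i)`_k, (B j)`_l); split=> //=; first exact: mem_nth.
by rewrite -E addKn mem_nth.
Qed.

End FreeLieFinite.

(* A finite-dimensional right FG-module, given by its matrices in a basis: the
   underlying space is the space of row vectors and v.g = v *m V g. *)
Record fgmod (G : groupType) (F : fieldType) := FGMod {
  fgdim : nat;
  fgrho :> G -> 'M[F]_fgdim;
  fgrho1 : fgrho 1%g = 1%:M;
  fgrhoM : forall g h, fgrho (g * h)%g = fgrho g *m fgrho h }.

Section FGModules.
Variables (G : groupType) (F : fieldType).
Local Notation fgmod := (fgmod G F).
Implicit Types U V W : fgmod.

Definition fgiso U V : Prop :=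
  exists (P : 'M[F]_(fgdim U, fgdim V)) (Q : 'M[F]_(fgdim V, fgdim U)),
    [/\ P *m Q = 1%:M, Q *m P = 1%:M & forall g, U g *m P = P *m V g].

Lemma fgiso_refl V : fgiso V V.
Proof. by exists 1%:M, 1%:M; split=> [||g]; rewrite ?mulmx1 ?mul1mx. Qed.

Lemma fgiso_sym U V : fgiso U V -> fgiso V U.
Proof.
move=> [P [Q [PQ QP UV]]]; exists Q, P; split=> // g.
by rewrite -[LHS]mul1mx -QP -mulmxA (mulmxA P) -UV -!mulmxA PQ mulmx1.
Qed.

Lemma fgiso_trans V U W : fgiso U V -> fgiso V W -> fgiso U W.
Proof.
move=> [P [Q [PQ QP UV]]] [P' [Q' [PQ' QP' VW]]].
exists (P *m P'), (Q' *m Q); split=> [||g].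
- by rewrite mulmxA -(mulmxA P) PQ' mulmx1.
- by rewrite mulmxA -(mulmxA Q') QP mulmx1.
by rewrite mulmxA UV -mulmxA VW mulmxA.
Qed.

Lemma fgiso_dim U V : fgiso U V -> fgdim U = fgdim V.
Proof.
move=> [P [Q [PQ QP _]]]; apply/eqP; rewrite eqn_leq.
have le_mul m n (A : 'M[F]_(m, n)) (B : 'M[F]_(n, m)) : A *m B = 1%:M -> (m <= n)%N.
  move=> AB; rewrite -(mxrank1 F m) -AB.
  by apply: leq_trans (mxrankM_maxl _ _) _; rewrite rank_leq_col.
by rewrite (le_mul _ _ _ _ PQ) (le_mul _ _ _ _ QP).
Qed.

Lemma fgiso_reindex U V (f : 'I_(fgdim U) -> 'I_(fgdim V)) :
  bijective f -> (forall g i j, U g i j = V g (f i) (f j)) -> fgiso U V.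
Proof.
move=> [f' fK f'K] UV.
have ftr (A : 'M[F]_(fgdim V, fgdim U)) i j : 
    (\matrix_(i, j) (f i == j)%:R *m A) i j = A (f i) j.
  rewrite mxE (bigD1 (f i)) //= mxE eqxx mul1r big1 ?addr0 // => k kfi.
  by rewrite mxE eq_sym (negPf kfi) mul0r.
exists (\matrix_(i, j) (f i == j)%:R), (\matrix_(i, j) (i == f j)%:R).
split.
- by apply/matrixP=> i j; rewrite ftr !mxE (can_eq fK).
- apply/matrixP=> i j; rewrite mxE (bigD1 (f' i)) //= !mxE f'K eqxx mul1r.
  rewrite big1 ?addr0 // => k; rewrite !mxE => kfi.
  case: eqP => [E|_]; last by rewrite mul0r.
  by rewrite E fK eqxx in kfi.
move=> g; apply/matrixP=> i j.
rewrite mxE (bigD1 (f' j)) //= !mxE f'K eqxx mulr1 big1 ?addr0; last first.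
  move=> k; rewrite !mxE => kfj; case: eqP => [E|_]; last by rewrite mulr0.
  by rewrite -E fK eqxx in kfj.
rewrite (bigD1 (f i)) //= !mxE eqxx mul1r UV f'K big1 ?addr0 // => k kfi.
by rewrite mxE eq_sym (negPf kfi) mul0r.
Qed.

Definition fg0 : fgmod.
Proof. by exists 0%N (fun=> 0) => *; apply/matrixP; case. Defined.

Definition fg1 : fgmod.
Proof. by exists 1%N (fun=> 1%:M) => // *; rewrite mulmx1. Defined.

Section Operations.
Variables U V : fgmod.

Definition fgsum_rho g := block_mx (U g) 0 0 (V g).
Lemma fgsum_rho1 : fgsum_rho 1%g = 1%:M.
Proof. by rewrite /fgsum_rho !fgrho1 -scalar_mx_block. Qed.
Lemma fgsum_rhoM g h : fgsum_rho (g * h)%g = fgsum_rho g *m fgsum_rho h.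
Proof.
by rewrite /fgsum_rho mulmx_block !fgrhoM !(mulmx0, mul0mx) !(addr0, add0r).
Qed.
Definition fgsum : fgmod := FGMod fgsum_rho1 fgsum_rhoM.

Definition fgtens_rho g := U g *t V g.
Lemma fgtens_rho1 : fgtens_rho 1%g = 1%:M.
Proof.
rewrite /fgtens_rho !fgrho1; apply/matrixP=> i j.
case: (mxtens_indexP i) => i1 i2; case: (mxtens_indexP j) => j1 j2.
by rewrite tensmxE !mxE (can_eq (@mxtens_indexK _ _)) xpair_eqE -natrM mulnb.
Qed.
Lemma fgtens_rhoM g h : fgtens_rho (g * h)%g = fgtens_rho g *m fgtens_rho h.
Proof. by rewrite /fgtens_rho tensmx_mul !fgrhoM. Qed.
Definition fgtens : fgmod := FGMod fgtens_rho1 fgtens_rhoM.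

End Operations.

Fixpoint fgpow V n : fgmod := if n is n'.+1 then fgtens V (fgpow V n') else fg1.

Lemma fgsum_iso U U' V V' :
  fgiso U U' -> fgiso V V' -> fgiso (fgsum U V) (fgsum U' V').
Proof.
move=> [P [Q [PQ QP UU']]] [P' [Q' [PQ' QP' VV']]].
exists (block_mx P 0 0 P'), (block_mx Q 0 0 Q').
split=> [||g]; rewrite ?[fgsum _ _ _]/(fgsum_rho _ _ _) /fgsum_rho !mulmx_block;
  rewrite ?(mulmx0, mul0mx) ?(addr0, add0r).
- by rewrite PQ PQ' -scalar_mx_block.
- by rewrite QP QP' -scalar_mx_block.
by rewrite UU' VV'.
Qed.

Lemma fgtens_iso U U' V V' :
  fgiso U U' -> fgiso V V' -> fgiso (fgtens U V) (fgtens U' V').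
Proof.
move=> [P [Q [PQ QP UU']]] [P' [Q' [PQ' QP' VV']]].
exists (P *t P'), (Q *t Q'); split=> [||g].
- by rewrite tensmx_mul PQ PQ' -(fgtens_rho1 U V) /fgtens_rho !fgrho1.
- by rewrite tensmx_mul QP QP' -(fgtens_rho1 U' V') /fgtens_rho !fgrho1.
by rewrite !tensmx_mul UU' VV'.
Qed.

Lemma fgsumA U V W : fgiso (fgsum U (fgsum V W)) (fgsum (fgsum U V) W).
Proof.
pose f m n p : 'I_(m + (n + p)) -> 'I_(m + n + p) := cast_ord (addnA m n p).
have f1 m n p i : f m n p (lshift _ i) = lshift _ (lshift _ i) by apply: val_inj.
have f2 m n p i : f m n p (rshift _ (lshift _ i)) = lshift _ (rshift _ i).
  exact: val_inj.
have f3 m n p i : f m n p (rshift _ (rshift _ i)) = rshift _ i.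
  by apply: val_inj; rewrite /= addnA.
apply: (@fgiso_reindex (fgsum U (fgsum V W)) (fgsum (fgsum U V) W) (f _ _ _)).
  by exists (cast_ord (esym (addnA _ _ _))) => i; apply: val_inj.
move=> g i j; rewrite /= /fgsum_rho /=.
case: (split_ordP i) => {}i ->; last case: (split_ordP i) => {}i ->;
  (case: (split_ordP j) => {}j ->; last case: (split_ordP j) => {}j ->);
  rewrite ?f1 ?f2 ?f3 /fgsum_rho;
  by rewrite ?(block_mxEul, block_mxEur, block_mxEdl, block_mxEdr, mxE).
Qed.

Lemma fgsumC U V : fgiso (fgsum U V) (fgsum V U).
Proof.
pose f m n (i : 'I_(m + n)) : 'I_(n + m) :=
  match split i with inl i => rshift n i | inr i => lshift m i end.
have fl m n (i : 'I_m) : f m n (lshift n i) = rshift n i.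
  by rewrite /f -[lshift n i]/(unsplit (inl i)) unsplitK.
have fr m n (i : 'I_n) : f m n (rshift m i) = lshift m i.
  by rewrite /f -[rshift m i]/(unsplit (inr i)) unsplitK.
have fK m n : cancel (f m n) (f n m).
  by move=> i; case: (split_ordP i) => k ->; rewrite ?fl ?fr ?fl ?fr.
apply: (@fgiso_reindex (fgsum U V) (fgsum V U) (f _ _)).
  by exists (f _ _); apply: fK.
move=> g i j; rewrite /= /fgsum_rho.
case: (split_ordP i) => i' ->; case: (split_ordP j) => j' ->;
  rewrite ?fl ?fr.
- by rewrite block_mxEul block_mxEdr.
- by rewrite block_mxEur block_mxEdl !mxE.
- by rewrite block_mxEdl block_mxEur !mxE.
by rewrite block_mxEdr block_mxEul.
Qed.

Lemma fgsum0 V : fgiso (fgsum fg0 V) V.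
Proof.
apply: fgiso_sym; apply: (@fgiso_reindex V (fgsum fg0 V) (@rshift 0 _)).
  by exists (cast_ord (add0n _)) => i; apply: val_inj.
by move=> g i j; rewrite /= /fgsum_rho block_mxEdr.
Qed.

Lemma fgtensA U V W : fgiso (fgtens U (fgtens V W)) (fgtens (fgtens U V) W).
Proof.
pose un := @mxtens_unindex; pose ix := @mxtens_index.
have unK m n := @mxtens_indexK m n; have ixK m n := @mxtens_unindexK m n.
pose f m n p (i : 'I_(m * (n * p))) : 'I_(m * n * p) :=
  let: (a, j) := un _ _ i in let: (b, c) := un _ _ j in ix _ _ (ix _ _ (a, b), c).
pose f' m n p (i : 'I_(m * n * p)) : 'I_(m * (n * p)) :=
  let: (j, c) := un _ _ i in let: (a, b) := un _ _ j in ix _ _ (a, ix _ _ (b, c)).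
have fE m n p a b c : f m n p (ix _ _ (a, ix _ _ (b, c))) = ix _ _ (ix _ _ (a, b), c).
  by rewrite /f /un !unK.
have f'E m n p a b c : f' m n p (ix _ _ (ix _ _ (a, b), c)) = ix _ _ (a, ix _ _ (b, c)).
  by rewrite /f' /un !unK.
apply: (@fgiso_reindex (fgtens U (fgtens V W)) (fgtens (fgtens U V) W)
  (f _ _ _)).
  exists (f' _ _ _) => i; case: (mxtens_indexP i) => a b.
    by case: (mxtens_indexP b) => {}b c; rewrite fE f'E.
  by case: (mxtens_indexP a) => {}a c; rewrite f'E fE.
move=> g i j; case: (mxtens_indexP i) => a b; case: (mxtens_indexP b) => {}b c.
case: (mxtens_indexP j) => a' b'; case: (mxtens_indexP b') => {}b' c'.
by rewrite !fE /= /fgtens_rho !tensmxE mulrA.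
Qed.

Lemma fgtensC U V : fgiso (fgtens U V) (fgtens V U).
Proof.
pose f m n (i : 'I_(m * n)) : 'I_(n * m) :=
  let: (a, b) := mxtens_unindex i in mxtens_index (b, a).
have fE m n a b : f m n (mxtens_index (a, b)) = mxtens_index (b, a).
  by rewrite /f !mxtens_indexK.
apply: (@fgiso_reindex (fgtens U V) (fgtens V U) (f _ _)).
  by exists (f _ _) => i; case: (mxtens_indexP i) => a b; rewrite !fE.
move=> g i j; case: (mxtens_indexP i) => a b; case: (mxtens_indexP j) => a' b'.
by rewrite !fE /= /fgtens_rho !tensmxE mulrC.
Qed.

Lemma fgtens1 V : fgiso (fgtens fg1 V) V.
Proof.
apply: (@fgiso_reindex (fgtens fg1 V) V (fun i => (mxtens_unindex i).2)).
  exists (fun i => mxtens_index (ord0, i)) => i; rewrite ?mxtens_indexK //.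
  by case: (mxtens_indexP i) => a b; rewrite mxtens_indexK (ord1 a).
move=> g i j; case: (mxtens_indexP i) => a b; case: (mxtens_indexP j) => a' b'.
by rewrite !mxtens_indexK /= /fgtens_rho !tensmxE /= mxE (ord1 a) (ord1 a') mul1r.
Qed.

Lemma fgtensDl U V W :
  fgiso (fgtens (fgsum U V) W) (fgsum (fgtens U W) (fgtens V W)).
Proof.
pose f m n p (i : 'I_((m + n) * p)) : 'I_(m * p + n * p) :=
  let: (a, b) := mxtens_unindex i in
  match split a with
  | inl a => lshift (n * p) (mxtens_index (a, b))
  | inr a => rshift (m * p) (mxtens_index (a, b))
  end.
pose f' m n p (i : 'I_(m * p + n * p)) : 'I_((m + n) * p) :=
  match split i with
  | inl a => mxtens_index (lshift n (mxtens_unindex a).1, (mxtens_unindex a).2)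
  | inr a => mxtens_index (rshift m (mxtens_unindex a).1, (mxtens_unindex a).2)
  end.
have spl m n (i : 'I_m) : split (lshift n i) = inl i.
  by rewrite -[lshift n i]/(unsplit (inl i)) unsplitK.
have spr m n (i : 'I_n) : split (rshift m i) = inr i.
  by rewrite -[rshift m i]/(unsplit (inr i)) unsplitK.
have fl m n p a b : f m n p (mxtens_index (lshift n a, b)) =
    lshift (n * p) (mxtens_index (a, b)).
  by rewrite /f mxtens_indexK spl.
have fr m n p a b : f m n p (mxtens_index (rshift m a, b)) =
    rshift (m * p) (mxtens_index (a, b)).
  by rewrite /f mxtens_indexK spr.
apply: (@fgiso_reindex (fgtens (fgsum U V) W) (fgsum (fgtens U W) (fgtens V W))
  (f _ _ _)).
  exists (f' _ _ _) => i.
    case: (mxtens_indexP i) => a b; case: (split_ordP a) => {}a ->.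
      by rewrite fl /f' spl mxtens_indexK.
    by rewrite fr /f' spr mxtens_indexK.
  case: (split_ordP i) => {}i ->.
    by rewrite /f' spl fl -surjective_pairing mxtens_unindexK.
  by rewrite /f' spr fr -surjective_pairing mxtens_unindexK.
move=> g i j; case: (mxtens_indexP i) => a b; case: (mxtens_indexP j) => a' b'.
case: (split_ordP a) => {}a ->; case: (split_ordP a') => {}a' ->;
  rewrite ?fl ?fr /= /fgsum_rho /= /fgtens_rho tensmxE /= /fgsum_rho.
- by rewrite !block_mxEul tensmxE.
- by rewrite !block_mxEur !mxE mul0r.
- by rewrite !block_mxEdl !mxE mul0r.
by rewrite !block_mxEdr tensmxE.
Qed.

Lemma fgtens0 V : fgiso (fgtens fg0 V) fg0.
Proof.
apply: fgiso_sym.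
have f (i : 'I_(fgdim fg0)) : 'I_(fgdim (fgtens fg0 V)) by case: i.
apply: (@fgiso_reindex fg0 (fgtens fg0 V) f); last by move=> g [].
have f' (i : 'I_(fgdim (fgtens fg0 V))) : 'I_(fgdim fg0) by case: i.
by exists f' => -[].
Qed.

(* V is the module with matrices, in some basis, of the right action act of G
   on the subspace P of M. *)
Definition affords (V : fgmod) (M : lmodType F) (act : G -> M -> M)
    (P : M -> Prop) : Prop :=
  exists u : 'I_(fgdim V) -> M,
    [/\ forall c : 'rV[F]_(fgdim V), \sum_i c 0 i *: u i = 0 -> c = 0,
        forall x, P x <-> exists c : 'rV[F]_(fgdim V), x = \sum_i c 0 i *: u i
      & forall g i, act g (u i) = \sum_j V g i j *: u j].

Lemma affords_exists (M : lmodType F) (act : G -> M -> M) (P : M -> Prop)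
    (s : seq M) :
  P 0 -> (forall a x y, P x -> P y -> P (a *: x + y)) ->
  (forall g, linear (act g)) -> (forall x, act 1%g x = x) ->
  (forall g h x, act (g * h)%g x = act h (act g x)) ->
  (forall g x, P x -> P (act g x)) -> (forall x, P x -> in_span s x) ->
  exists V, affords V act P.
Proof.
move=> P0 PL actL act1 actM actP Ps.
pose free n (u : 'I_n -> M) :=
  forall c : 'rV[F]_n, \sum_i c 0 i *: u i = 0 -> c = 0.
pose Q n := exists u : 'I_n -> M, (forall i, P (u i)) /\ free n u.
have Psum n (u : 'I_n -> M) (c : 'I_n -> F) :
    (forall i, P (u i)) -> P (\sum_i c i *: u i).
  move=> Pu; elim: (index_enum _) => [|i t IHt]; rewrite ?big_nil //.
  by rewrite big_cons; apply: PL.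
have exQ : exists n, `[< Q n >].
  exists 0%N; apply/asboolP; exists (fun=> 0); split=> // c _.
  by apply/matrixP => i [].
have Qle n : `[< Q n >] -> (n <= size s)%N.
  move=> /asboolP[u [Pu fu]]; rewrite leqNgt; apply/negP => lt_sn.
  pose c i := sval (cid (Ps _ (Pu i))).
  have cE i : u i = \sum_(j < size s) c i j *: s`_j by rewrite /c; case: cid.
  pose C := \matrix_(i < n, j < size s) c i j.
  have : kermx C != 0.
    rewrite -mxrank_eq0 mxrank_ker subn_eq0 -ltnNge.
    exact: leq_ltn_trans (rank_leq_col _) lt_sn.
  case/rowV0Pn => v /sub_kermxP vC /eqP[]; apply: fu.
  under eq_bigr => i _ do rewrite cE scaler_sumr.
  rewrite exchange_big /= big1 // => j _.
  under eq_bigr => i _ do rewrite scalerA.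
  have vCj : \sum_i v 0 i * c i j = 0.
    have /matrixP/(_ 0 j) := vC; rewrite !mxE => vC0; rewrite -[RHS]vC0.
    by apply: eq_bigr => i _; rewrite mxE.
  by rewrite -scaler_suml vCj scale0r.
case: (ex_maxnP exQ Qle) => n /asboolP[u [Pu fu]] maxn.
have span x : P x -> exists c : 'rV[F]_n, x = \sum_i c 0 i *: u i.
  move=> Px; apply: contrapT => xNu.
  suff: (n.+1 <= n)%N by rewrite ltnn.
  apply/maxn/asboolP.
  pose u' (i : 'I_n.+1) := if unlift ord0 i is Some j then u j else x.
  have u'0 : u' ord0 = x by rewrite /u' unlift_none.
  have u'S i : u' (lift ord0 i) = u i by rewrite /u' liftK.
  exists u'; split=> [i|c]; first by rewrite /u'; case: unlift.
  rewrite big_ord_recl u'0; under eq_bigr do rewrite u'S.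
  move=> cu; pose d : 'rV[F]_n := \row_i c 0 (lift ord0 i).
  have {}cu : c 0 ord0 *: x + \sum_i d 0 i *: u i = 0.
    by rewrite -[RHS]cu; congr (_ + _); apply: eq_bigr => i _; rewrite mxE.
  have c0 : c 0 ord0 = 0.
    apply/eqP/negPn/negP => c0; apply: xNu.
    exists (\row_i (- (c 0 ord0)^-1 * d 0 i)).
    move/eqP: cu; rewrite addr_eq0 => /eqP/(congr1 ( *:%R (c 0 ord0)^-1)).
    rewrite scalerA mulVf // scale1r => ->; rewrite scalerN -scaleNr scaler_sumr.
    by apply: eq_bigr => i _; rewrite scalerA [in RHS]mxE.
  have d0 : d = 0 by apply: fu; rewrite -[RHS]cu c0 scale0r add0r.
  apply/rowP => i; rewrite mxE; case: (unliftP ord0 i) => [j|] ->; last by [].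
  by have /rowP/(_ j) := d0; rewrite !mxE.
pose c g i := sval (cid (span _ (actP g _ (Pu i)))).
have cE g i : act g (u i) = \sum_j c g i 0 j *: u j by rewrite /c; case: cid.
have inj (a b : 'rV[F]_n) : \sum_i a 0 i *: u i = \sum_i b 0 i *: u i -> a = b.
  move=> ab; apply/eqP; rewrite -subr_eq0; apply/eqP/fu.
  under eq_bigr do rewrite !mxE scalerBl.
  by rewrite sumrB ab subrr.
pose rho g := \matrix_(i, j) c g i 0 j.
have rhoE g i : act g (u i) = \sum_j rho g i j *: u j.
  by rewrite cE; apply: eq_bigr => j _; rewrite mxE.
have row_eq (A B : 'M[F]_n) :
    (forall i, \sum_j A i j *: u j = \sum_j B i j *: u j) -> A = B.
  move=> AB; apply/row_matrixP => i; apply: inj.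
  under eq_bigr do rewrite mxE; rewrite AB.
  by apply: eq_bigr => j _; rewrite mxE.
have rho1 : rho 1%g = 1%:M.
  apply: row_eq => i; rewrite -rhoE act1 (bigD1 i) //= mxE eqxx scale1r.
  by rewrite big1 ?addr0 // => j ji; rewrite mxE eq_sym (negPf ji) scale0r.
have rhoM g h : rho (g * h)%g = rho g *m rho h.
  apply: row_eq => i; rewrite -rhoE actM rhoE (linear_fun_sum _ _ (actL h)).
  under eq_bigr do rewrite rhoE scaler_sumr.
  rewrite exchange_big /=; apply: eq_bigr => j _.
  by rewrite mxE scaler_suml; apply: eq_bigr => k _; rewrite scalerA.
exists (FGMod rho1 rhoM), u; split=> // x; split=> [/span//|[a ->]].
exact: Psum.
Qed.

Section Powers.
Variables (r : nat) (V : fgmod).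
Local Notation n := (fgdim V).

(* G acts on the polynomial algebra on the basis 'X_i of V by substitution. *)
Definition poly_act (g : G) (p : {mpoly F[n]}) : {mpoly F[n]} :=
  p \mPo [tuple \sum_j V g i j *: 'X_j | i < n].

Lemma poly_actX g i : poly_act g 'X_i = \sum_j V g i j *: 'X_j.
Proof. by rewrite /poly_act comp_mpolyXU -tnth_nth tnth_mktuple. Qed.

Lemma mpoly_morph_ext (f h : {mpoly F[n]} -> {mpoly F[n]}) :
  linear f -> linear h -> f 1 = h 1 ->
  {morph f : p q / p * q} -> {morph h : p q / p * q} ->
  (forall i, f 'X_i = h 'X_i) -> f =1 h.
Proof.
move=> fL hL f1 fM hM fhX p.
rewrite [p]mpolyE; elim: (msupp p) => [|m s IHs].
  by rewrite !big_nil (linear_fun0 fL) (linear_fun0 hL).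
rewrite !big_cons fL hL IHs; congr (_ *: _ + _).
rewrite mpolyXE_id; elim: (index_enum _) => [|i t IHt]; rewrite ?big_nil //.
rewrite !big_cons fM hM IHt; congr (_ * _).
by elim: (m i) => [|k IHk]; rewrite ?expr0 // !exprS fM hM IHk fhX.
Qed.

Lemma poly_act_linear g : linear (poly_act g).
Proof. by move=> a p q; rewrite /poly_act linearP. Qed.

Lemma poly_act1 p : poly_act 1%g p = p.
Proof.
move: p; apply: mpoly_morph_ext => //; first exact: poly_act_linear.
- by rewrite /poly_act comp_mpoly1.
- by move=> p q; rewrite /poly_act rmorphM.
move=> i; rewrite poly_actX fgrho1 (bigD1 i) //= mxE eqxx scale1r.
by rewrite big1 ?addr0 // => j ji; rewrite mxE eq_sym (negPf ji) scale0r.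
Qed.

Lemma poly_actM g h p : poly_act (g * h)%g p = poly_act h (poly_act g p).
Proof.
move: p; apply: mpoly_morph_ext => //; first exact: poly_act_linear.
- by move=> a p q; rewrite !poly_act_linear.
- by rewrite /poly_act !comp_mpoly1.
- by move=> p q; rewrite /poly_act rmorphM.
- by move=> p q; rewrite /poly_act !rmorphM.
move=> i; rewrite !poly_actX fgrhoM (linear_fun_sum _ _ (poly_act_linear h)).
under [RHS]eq_bigr do rewrite poly_actX scaler_sumr.
rewrite exchange_big /=; apply: eq_bigr => j _.
by rewrite mxE scaler_suml; apply: eq_bigr => k _; rewrite scalerA.
Qed.

Lemma poly_act_homog g p : p \is r.-homog -> poly_act g p \is r.-homog.
Proof.
move=> /dhomogP hp; rewrite /poly_act.
set lq := [tuple _ | i < n]; have : forall i, tnth lq i \is 1.-homog.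
  move=> i; rewrite tnth_mktuple; apply: rpred_sum => j _.
  by apply: dhomogZ; rewrite dhomogX; apply/eqP/mdeg1.
move: (lq) => {}lq lq1; rewrite comp_mpolyE big_seq.
apply: rpred_sum => m mp; apply: dhomogZ.
have <- : mdeg m = r by exact: hp.
rewrite mdegE; elim: (index_enum _) => [|i t IHt].
  by rewrite !big_nil dhomog1.
rewrite !big_cons; apply: dhomogM => //.
by rewrite -[X in X.-homog]mul1n; apply: dhomogMn.
Qed.

Lemma symm_pow_exists :
  exists W : fgmod, affords W poly_act (fun p : {mpoly F[n]} => p \is r.-homog).
Proof.
pose s : seq {mpoly F[n]} := [seq 'X_[bmnm m] | m <- enum {: 'X_{1..n < r.+1}}].
apply: (affords_exists (s := s)).
- exact: dhomog0.
- by move=> a x y hx hy; rewrite dhomogD // dhomogZ.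
- exact: poly_act_linear.
- exact: poly_act1.
- exact: poly_actM.
- exact: poly_act_homog.
move=> p /dhomogP hp; rewrite [p]mpolyE big_seq.
elim/big_ind: _ => [|x y sx sy|m mp]; first exact: in_span0.
  by rewrite -[x]scale1r; apply: in_span_lin.
rewrite -[_ *: _]addr0; apply: in_span_lin; last exact: in_span0.
apply: in_span_mem; have mr : (mdeg m < r.+1)%N by rewrite (hp _ mp).
by apply/mapP; exists (BMultinom mr); rewrite ?mem_enum.
Qed.

Definition symm_pow : fgmod := sval (cid symm_pow_exists).

Definition lie_act (g : G) : freeLie 'rV[F]_n -> freeLie 'rV[F]_n :=
  freeLie_map (mulmxr (V g)).

Lemma lie_pow_exists : exists W : fgmod, affords W lie_act (freeLie_homog r).
Proof.
have [s sP] := freeLie_homog_finite F n r.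
apply: (affords_exists (s := s)) => //.
- exact: homog_0.
- by move=> a x y; apply: homog_lin.
- by move=> g a x y; rewrite /lie_act linearP.
- by apply: freeLie_map_id => v; rewrite /= fgrho1 mulmx1.
- move=> g h; apply: freeLie_map_comp => v.
  by rewrite /= fgrhoM mulmxA.
by move=> g x; apply: freeLie_map_homog.
Qed.

Definition lie_pow : fgmod := sval (cid lie_pow_exists).

End Powers.
End FGModules.

Section IsoClasses.
Variables (G : groupType) (F : fieldType).

HB.instance Definition _ := gen_eqMixin (fgmod G F).
HB.instance Definition _ := gen_choiceMixin (fgmod G F).

Definition fgiso_rel : rel (fgmod G F) := fun U V => `[< fgiso U V >].
Lemma fgiso_rel_refl : reflexive fgiso_rel.
Proof. by move=> U; apply/asboolP/fgiso_refl. Qed.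
Lemma fgiso_rel_sym : symmetric fgiso_rel.
Proof. by move=> U V; apply/asboolP/asboolP; apply: fgiso_sym. Qed.
Lemma fgiso_rel_trans : transitive fgiso_rel.
Proof.
by move=> V U W /asboolP UV /asboolP VW; apply/asboolP/(fgiso_trans UV VW).
Qed.
Canonical fgiso_equiv :=
  EquivRel fgiso_rel fgiso_rel_refl fgiso_rel_sym fgiso_rel_trans.

(* The semiring of isomorphism classes of finite-dimensional FG-modules. *)
Definition isocl := {eq_quot fgiso_equiv}.
HB.instance Definition _ := Choice.on isocl.
HB.instance Definition _ := EqQuotient.on isocl.

Local Notation "[ V ]c" := (\pi_isocl V) (at level 0, format "[ V ]c").

Lemma isoclP U V : fgiso U V <-> [U]c = [V]c.
Proof. by split=> [UV|/eqquotP/asboolP//]; apply/eqquotP/asboolP. Qed.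

Definition isocl_zero : isocl := [fg0 G F]c.
Definition isocl_one : isocl := [fg1 G F]c.
Definition isocl_add (x y : isocl) : isocl := [fgsum (repr x) (repr y)]c.
Definition isocl_mul (x y : isocl) : isocl := [fgtens (repr x) (repr y)]c.

Lemma fgiso_repr V : fgiso (repr [V]c) V.
Proof. by apply/isoclP; rewrite reprK. Qed.

Lemma isocl_addE U V : isocl_add [U]c [V]c = [fgsum U V]c.
Proof. by apply/isoclP/fgsum_iso; apply: fgiso_repr. Qed.
Lemma isocl_mulE U V : isocl_mul [U]c [V]c = [fgtens U V]c.
Proof. by apply/isoclP/fgtens_iso; apply: fgiso_repr. Qed.

Lemma isocl_addA : associative isocl_add.
Proof.
elim/quotW=> U; elim/quotW=> V; elim/quotW=> W.
rewrite (isocl_addE V W) (isocl_addE U V) (isocl_addE U (fgsum V W)).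
by rewrite (isocl_addE (fgsum U V) W); apply/isoclP/fgsumA.
Qed.
Lemma isocl_addC : commutative isocl_add.
Proof.
elim/quotW=> U; elim/quotW=> V.
by rewrite (isocl_addE U V) (isocl_addE V U); apply/isoclP/fgsumC.
Qed.
Lemma isocl_add0 : left_id isocl_zero isocl_add.
Proof. by elim/quotW=> V; rewrite isocl_addE; apply/isoclP/fgsum0. Qed.

HB.instance Definition _ :=
  GRing.isNmodule.Build isocl isocl_addA isocl_addC isocl_add0.

Lemma isoclDE U V : [U]c + [V]c = [fgsum U V]c.
Proof. exact: isocl_addE. Qed.

Lemma isocl_mulA : associative isocl_mul.
Proof.
elim/quotW=> U; elim/quotW=> V; elim/quotW=> W.
rewrite (isocl_mulE V W) (isocl_mulE U V) (isocl_mulE U (fgtens V W)).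
by rewrite (isocl_mulE (fgtens U V) W); apply/isoclP/fgtensA.
Qed.
Lemma isocl_mulC : commutative isocl_mul.
Proof.
elim/quotW=> U; elim/quotW=> V.
by rewrite (isocl_mulE U V) (isocl_mulE V U); apply/isoclP/fgtensC.
Qed.
Lemma isocl_mul1 : left_id isocl_one isocl_mul.
Proof. by elim/quotW=> V; rewrite isocl_mulE; apply/isoclP/fgtens1. Qed.
Lemma isocl_mulDl : left_distributive isocl_mul +%R.
Proof.
elim/quotW=> U; elim/quotW=> V; elim/quotW=> W.
rewrite (isoclDE U V) (isocl_mulE U W) (isocl_mulE V W).
rewrite (isocl_mulE (fgsum U V) W) (isoclDE (fgtens U W) (fgtens V W)).
by apply/isoclP/fgtensDl.
Qed.
Lemma isocl_mul0 : left_zero 0 isocl_mul.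
Proof.
by elim/quotW=> V; rewrite [LHS]isocl_mulE; apply/isoclP/fgtens0.
Qed.
Lemma isocl_1neq0 : isocl_one != 0.
Proof. by apply/eqP => /isoclP/fgiso_dim. Qed.

HB.instance Definition _ := GRing.Nmodule_isComNzSemiRing.Build isocl
  isocl_mulA isocl_mulC isocl_mul1 isocl_mulDl isocl_mul0 isocl_1neq0.

Lemma isoclME U V : [U]c * [V]c = [fgtens U V]c.
Proof. exact: isocl_mulE. Qed.

Definition isocl_dim (x : isocl) : nat := fgdim (repr x).

Lemma isocl_dimE V : isocl_dim [V]c = fgdim V.
Proof. exact/fgiso_dim/fgiso_repr. Qed.

Lemma isocl_dimD x y : isocl_dim (x + y) = (isocl_dim x + isocl_dim y)%N.
Proof.
elim/quotW: x => U; elim/quotW: y => V.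
by rewrite isoclDE !isocl_dimE.
Qed.

End IsoClasses.

Section Green.
Variables (G : groupType) (F : fieldType).
Local Notation isocl := (isocl G F).

Definition green_rel : rel (isocl * isocl) := fun x y =>
  `[< exists z, x.1 + y.2 + z = y.1 + x.2 + z >].
Lemma green_relP x y :
  reflect (exists z, x.1 + y.2 + z = y.1 + x.2 + z) (green_rel x y).
Proof. exact: asboolP. Qed.
Lemma green_rel_refl : reflexive green_rel.
Proof. by move=> x; apply/green_relP; exists 0. Qed.
Lemma green_rel_sym : symmetric green_rel.
Proof. by move=> x y; apply/green_relP/green_relP => -[z zE]; exists z. Qed.
Lemma green_rel_trans : transitive green_rel.
Proof.
move=> y x z /green_relP[a aE] /green_relP[b bE]; apply/green_relP.
exists (y.1 + y.2 + a + b).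
transitivity ((x.1 + y.2 + a) + (y.1 + z.2 + b)); first ring.
rewrite aE bE; ring.
Qed.
Canonical green_equiv :=
  EquivRel green_rel green_rel_refl green_rel_sym green_rel_trans.

(* The Green ring R_FG: formal differences of isomorphism classes. *)
Definition green := {eq_quot green_equiv}.
HB.instance Definition _ := Choice.on green.
HB.instance Definition _ := EqQuotient.on green.

Local Notation "a -c b" := (\pi_green (a, b)) (at level 50).

Lemma greenP a b a' b' :
  (exists c, a + b' + c = a' + b + c) <-> a -c b = a' -c b'.
Proof.
split=> [ab|/eqquotP/green_relP//]; exact/eqquotP/green_relP.
Qed.

Lemma greenW (P : green -> Prop) : (forall a b, P (a -c b)) -> forall x, P x.
Proof. by move=> Pab; elim/quotW=> -[]. Qed.

Definition green_zero : green := 0 -c 0.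
Definition green_one : green := 1 -c 0.
Definition green_add (x y : green) : green :=
  ((repr x).1 + (repr y).1) -c ((repr x).2 + (repr y).2).
Definition green_opp (x : green) : green := (repr x).2 -c (repr x).1.
Definition green_mul (x y : green) : green :=
  ((repr x).1 * (repr y).1 + (repr x).2 * (repr y).2) -c
  ((repr x).1 * (repr y).2 + (repr x).2 * (repr y).1).

Lemma green_repr a b : exists c,
  (repr (a -c b)).1 + b + c = a + (repr (a -c b)).2 + c.
Proof. by apply/greenP; rewrite -surjective_pairing reprK. Qed.

Lemma green_addE a b a' b' :
  green_add (a -c b) (a' -c b') = (a + a') -c (b + b').
Proof.
rewrite /green_add; have [c cE] := green_repr a b.
have [c' cE'] := green_repr a' b'; apply/greenP; exists (c + c').
move: (repr (a -c b)) (repr (a' -c b')) cE cE' => x y cE cE'.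
transitivity ((x.1 + b + c) + (y.1 + b' + c')); first ring.
rewrite cE cE'; ring.
Qed.

Lemma green_oppE a b : green_opp (a -c b) = b -c a.
Proof.
rewrite /green_opp; have [c cE] := green_repr a b; apply/greenP; exists c.
move: (repr _) cE => x cE.
by rewrite [x.2 + a]addrC -cE; ring.
Qed.

Lemma green_mulE a b a' b' :
  green_mul (a -c b) (a' -c b') = (a * a' + b * b') -c (a * b' + b * a').
Proof.
rewrite /green_mul; have [c cE] := green_repr a b.
have [c' cE'] := green_repr a' b'.
move: (repr (a -c b)) (repr (a' -c b')) cE cE' => x y cE cE'.
transitivity ((x.1 * a' + x.2 * b') -c (x.1 * b' + x.2 * a')).
  apply/greenP; exists ((x.1 + x.2) * c').
  transitivity (x.1 * (y.1 + b' + c') + x.2 * (a' + y.2 + c')); first ring.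
  transitivity (x.1 * (a' + y.2 + c') + x.2 * (y.1 + b' + c')); last ring.
  by rewrite cE'.
apply/greenP; exists ((a' + b') * c).
transitivity (a' * (x.1 + b + c) + b' * (a + x.2 + c)); first ring.
transitivity (a' * (a + x.2 + c) + b' * (x.1 + b + c)); last ring.
by rewrite cE.
Qed.

Lemma green_addA : associative green_add.
Proof.
elim/greenW=> a b; elim/greenW=> c d; elim/greenW=> e f.
rewrite (green_addE a b) (green_addE c d) (green_addE a b) (green_addE (a + c)).
by rewrite !addrA.
Qed.
Lemma green_addC : commutative green_add.
Proof.
elim/greenW=> a b; elim/greenW=> c d.
by rewrite (green_addE a b) (green_addE c d) [a + c]addrC [b + d]addrC.
Qed.
Lemma green_add0 : left_id green_zero green_add.
Proof. by elim/greenW=> a b; rewrite (green_addE 0 0) !add0r. Qed.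
Lemma green_addN : left_inverse green_zero green_opp green_add.
Proof.
elim/greenW=> a b; rewrite green_oppE (green_addE b a).
by apply/greenP; exists 0; ring.
Qed.
HB.instance Definition _ :=
  GRing.isZmodule.Build green green_addA green_addC green_add0 green_addN.

Lemma greenDE a b a' b' : (a -c b) + (a' -c b') = (a + a') -c (b + b').
Proof. exact: green_addE. Qed.

Lemma green_mulA : associative green_mul.
Proof.
elim/greenW=> a b; elim/greenW=> c d; elim/greenW=> e f.
rewrite (green_mulE a b c d) (green_mulE c d e f) green_mulE green_mulE.
by congr (\pi_green (_, _)); ring.
Qed.
Lemma green_mulC : commutative green_mul.
Proof.
elim/greenW=> a b; elim/greenW=> c d; rewrite !green_mulE.
by congr (\pi_green (_, _)); ring.
Qed.
Lemma green_mul1 : left_id green_one green_mul.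
Proof.
elim/greenW=> a b; rewrite (green_mulE 1 0).
by rewrite !mul1r !mul0r !addr0.
Qed.
Lemma green_mulDl : left_distributive green_mul +%R.
Proof.
elim/greenW=> a b; elim/greenW=> c d; elim/greenW=> e f.
rewrite (greenDE a b) (green_mulE a b) (green_mulE c d) (green_mulE (a + c)).
by rewrite greenDE; congr (\pi_green (_, _)); ring.
Qed.
Lemma green_dim_eq a b a' b' : a -c b = a' -c b' ->
  (isocl_dim a + isocl_dim b' = isocl_dim a' + isocl_dim b)%N.
Proof.
move/greenP => [c /(congr1 (@isocl_dim G F))].
by rewrite !isocl_dimD => /addIn.
Qed.
Lemma green_natE n : (1 -c 0) *+ n = n%:R -c 0.
Proof.
elim: n => [|n IHn]; first by rewrite mulr0n.
by rewrite mulrS IHn greenDE addr0 -mulrS.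
Qed.
Lemma isocl_dim0 : isocl_dim (0 : isocl) = 0%N.
Proof. exact: isocl_dimE. Qed.
Lemma isocl_dim_nat n : isocl_dim (n%:R : isocl) = n.
Proof.
elim: n => [|n IHn]; first exact: isocl_dim0.
by rewrite mulrS isocl_dimD IHn isocl_dimE.
Qed.
Lemma green_nat_neq0 n : green_one *+ n.+1 != 0.
Proof.
apply/eqP; rewrite green_natE => /green_dim_eq.
by rewrite isocl_dim_nat !isocl_dim0.
Qed.
Lemma green_1neq0 : green_one != 0.
Proof. exact: green_nat_neq0 0. Qed.

HB.instance Definition _ := GRing.Zmodule_isComNzRing.Build green
  green_mulA green_mulC green_mul1 green_mulDl green_1neq0.

Lemma greenME a b a' b' :
  (a -c b) * (a' -c b') = (a * a' + b * b') -c (a * b' + b * a').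
Proof. exact: green_mulE. Qed.

Definition green_class (V : fgmod G F) : green := \pi_isocl V -c 0.

End Green.

Section Gamma.
Variables (G : groupType) (F : fieldType).
Local Notation R := (green G F).

(* The pair (x, n) stands for x / (n + 1). *)
Definition gamma_rel : rel (R * nat) := fun x y =>
  `[< exists k, x.1 * (y.2.+1)%:R * k.+1%:R = y.1 * (x.2.+1)%:R * k.+1%:R >].
Lemma gamma_relP x y : reflect
  (exists k, x.1 * (y.2.+1)%:R * k.+1%:R = y.1 * (x.2.+1)%:R * k.+1%:R)
  (gamma_rel x y).
Proof. exact: asboolP. Qed.

Lemma mulSS (m n : nat) : (m.+1 * n.+1 = (m * n + m + n).+1)%N.
Proof. by rewrite mulSn mulnS addSn addnC [(m + m * n)%N]addnC. Qed.
Lemma mulSS_nat (m n : nat) : (m * n + m + n).+1%:R = m.+1%:R * n.+1%:R :> R.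
Proof. by rewrite -natrM mulSS. Qed.

Lemma gamma_rel_refl : reflexive gamma_rel.
Proof. by move=> x; apply/gamma_relP; exists 0%N. Qed.
Lemma gamma_rel_sym : symmetric gamma_rel.
Proof. by move=> x y; apply/gamma_relP/gamma_relP => -[z zE]; exists z. Qed.
Lemma gamma_rel_trans : transitive gamma_rel.
Proof.
move=> [y n] [x m] [z p] /gamma_relP[k /= kE] /gamma_relP[l /= lE].
pose q := (k * l + k + l)%N; apply/gamma_relP; exists (n * q + n + q)%N => /=.
rewrite !mulSS_nat.
transitivity (x * n.+1%:R * k.+1%:R * p.+1%:R * l.+1%:R); first ring.
rewrite kE.
transitivity (y * p.+1%:R * l.+1%:R * m.+1%:R * k.+1%:R); first ring.
by rewrite lE; ring.
Qed.
Canonical gamma_equiv :=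
  EquivRel gamma_rel gamma_rel_refl gamma_rel_sym gamma_rel_trans.

(* Gamma_FG, the tensor product of Q and R_FG over Z, as the localization of
   R_FG at the positive integers. *)
Definition Gamma := {eq_quot gamma_equiv}.
HB.instance Definition _ := Choice.on Gamma.
HB.instance Definition _ := EqQuotient.on Gamma.

Local Notation "x %/S n" := (\pi_Gamma (x, n%N)) (at level 40).

Lemma gammaP (x y : R) (m n : nat) :
  (exists k, x * (n.+1)%:R * k.+1%:R = y * (m.+1)%:R * k.+1%:R) <->
  x %/S m = y %/S n.
Proof.
split=> [xy|/eqquotP/gamma_relP//]; exact/eqquotP/gamma_relP.
Qed.

Lemma gammaW (P : Gamma -> Prop) : (forall x n, P (x %/S n)) -> forall x, P x.
Proof. by move=> Pab; elim/quotW=> -[]. Qed.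

Definition gamma_zero : Gamma := 0 %/S 0.
Definition gamma_one : Gamma := 1 %/S 0.
Definition gamma_add (x y : Gamma) : Gamma :=
  let: (a, m) := repr x in let: (b, n) := repr y in
  (a * n.+1%:R + b * m.+1%:R) %/S (m * n + m + n).
Definition gamma_opp (x : Gamma) : Gamma :=
  let: (a, m) := repr x in (- a) %/S m.
Definition gamma_mul (x y : Gamma) : Gamma :=
  let: (a, m) := repr x in let: (b, n) := repr y in
  (a * b) %/S (m * n + m + n).

Variant gamma_repr_spec (x : R) m : R * nat -> Prop :=
  GammaRepr y n k of
    y * m.+1%:R * k.+1%:R = x * n.+1%:R * k.+1%:R : gamma_repr_spec x m (y, n).
Lemma gamma_reprP x m : gamma_repr_spec x m (repr (x %/S m)).
Proof.
case E: (repr (x %/S m)) => [y n].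
have /gammaP[k kE] : y %/S n = x %/S m by rewrite -E reprK.
exact: GammaRepr kE.
Qed.

Lemma gamma_addE x m y n :
  gamma_add (x %/S m) (y %/S n) =
  (x * n.+1%:R + y * m.+1%:R) %/S (m * n + m + n).
Proof.
rewrite /gamma_add; case: gamma_reprP => x' m' k kE.
case: gamma_reprP => y' n' l lE.
apply/gammaP; exists (k * l + k + l)%N; rewrite !mulSS_nat.
transitivity ((x' * m.+1%:R * k.+1%:R) * n'.+1%:R * n.+1%:R * l.+1%:R +
  (y' * n.+1%:R * l.+1%:R) * m'.+1%:R * m.+1%:R * k.+1%:R); first ring.
by rewrite kE lE; ring.
Qed.

Lemma gamma_oppE x m : gamma_opp (x %/S m) = (- x) %/S m.
Proof.
rewrite /gamma_opp; case: gamma_reprP => x' m' k kE.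
by apply/gammaP; exists k; rewrite !mulNr kE.
Qed.

Lemma gamma_mulE x m y n :
  gamma_mul (x %/S m) (y %/S n) = (x * y) %/S (m * n + m + n).
Proof.
rewrite /gamma_mul; case: gamma_reprP => x' m' k kE.
case: gamma_reprP => y' n' l lE.
apply/gammaP; exists (k * l + k + l)%N; rewrite !mulSS_nat.
transitivity ((x' * m.+1%:R * k.+1%:R) * (y' * n.+1%:R * l.+1%:R)); first ring.
by rewrite kE lE; ring.
Qed.

Lemma gamma_eq x y (m n : nat) :
  x * (n.+1)%:R = y * (m.+1)%:R -> x %/S m = y %/S n.
Proof. by move=> xy; apply/gammaP; exists 0%N; rewrite xy. Qed.

Lemma gamma_addA : associative gamma_add.
Proof.
elim/gammaW=> x m; elim/gammaW=> y n; elim/gammaW=> z p.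
rewrite (gamma_addE y n z p) (gamma_addE x m y n) (gamma_addE x m).
rewrite gamma_addE; apply: gamma_eq; rewrite !mulSS_nat; ring.
Qed.
Lemma gamma_addC : commutative gamma_add.
Proof.
elim/gammaW=> x m; elim/gammaW=> y n.
rewrite (gamma_addE x m y n) (gamma_addE y n x m).
by apply: gamma_eq; rewrite !mulSS_nat; ring.
Qed.
Lemma gamma_add0 : left_id gamma_zero gamma_add.
Proof.
elim/gammaW=> x m; rewrite (gamma_addE 0 0 x m).
by apply: gamma_eq; rewrite !mulSS_nat; ring.
Qed.
Lemma gamma_addN : left_inverse gamma_zero gamma_opp gamma_add.
Proof.
elim/gammaW=> x m; rewrite gamma_oppE (gamma_addE (- x) m x m).
by apply: gamma_eq; rewrite !mulSS_nat; ring.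
Qed.
HB.instance Definition _ :=
  GRing.isZmodule.Build Gamma gamma_addA gamma_addC gamma_add0 gamma_addN.

Lemma gammaDE x m y n :
  x %/S m + y %/S n = (x * n.+1%:R + y * m.+1%:R) %/S (m * n + m + n).
Proof. exact: gamma_addE. Qed.

Lemma gamma_mulA : associative gamma_mul.
Proof.
elim/gammaW=> x m; elim/gammaW=> y n; elim/gammaW=> z p.
rewrite (gamma_mulE y n z p) (gamma_mulE x m y n) (gamma_mulE x m).
rewrite gamma_mulE; apply: gamma_eq; rewrite !mulSS_nat; ring.
Qed.
Lemma gamma_mulC : commutative gamma_mul.
Proof.
elim/gammaW=> x m; elim/gammaW=> y n.
rewrite (gamma_mulE x m y n) (gamma_mulE y n x m).
by apply: gamma_eq; rewrite !mulSS_nat; ring.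
Qed.
Lemma gamma_mul1 : left_id gamma_one gamma_mul.
Proof.
elim/gammaW=> x m; rewrite (gamma_mulE 1 0 x m).
by apply: gamma_eq; rewrite !mulSS_nat; ring.
Qed.
Lemma gamma_mulDl : left_distributive gamma_mul +%R.
Proof.
elim/gammaW=> x m; elim/gammaW=> y n; elim/gammaW=> z p.
rewrite (gammaDE x m y n) (gamma_mulE x m z p) (gamma_mulE y n z p) gamma_mulE.
by rewrite gammaDE; apply: gamma_eq; rewrite !mulSS_nat; ring.
Qed.
Lemma gamma_1neq0 : gamma_one != 0.
Proof.
apply/eqP => /gammaP[k]; rewrite !mul0r !mul1r => /eqP.
by rewrite (negPf (green_nat_neq0 G F k)).
Qed.

HB.instance Definition _ := GRing.Zmodule_isComNzRing.Build Gamma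
  gamma_mulA gamma_mulC gamma_mul1 gamma_mulDl gamma_1neq0.

Lemma gammaME x m y n : (x %/S m) * (y %/S n) = (x * y) %/S (m * n + m + n).
Proof. exact: gamma_mulE. Qed.

Definition gamma_rat (q : rat) : Gamma := (numq q)%:~R %/S (`|denq q|%N.-1).

Lemma gamma_ratE (a : int) (n : nat) : gamma_rat (a%:~R / n.+1%:R) = a%:~R %/S n.
Proof.
set q := _ / _; apply: gamma_eq; rewrite prednK ?absz_gt0 ?denq_neq0 //.
have : numq q * n.+1%:Z = a * denq q.
  apply/eqP; rewrite -(eqr_int rat) !intrM.
  have qE : q * n.+1%:~R = a%:~R.
    have n0 : n.+1%:R != 0 :> rat by rewrite pnatr_eq0.
    exact: divfK n0 a%:~R.
  have dE : q * (denq q)%:~R = (numq q)%:~R.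
    have d0 : (denq q)%:~R != 0 :> rat by rewrite intr_eq0 denq_neq0.
    by rewrite -[X in X * _](divq_num_den q) divfK.
  by rewrite -dE -qE mulrAC.
rewrite -[in a * _](@absz_denq q) => /(congr1 (fun z : int => z%:~R : R)).
by rewrite !intrM.
Qed.

Lemma rat_frac (q : rat) : exists (a : int) (n : nat), q = a%:~R / n.+1%:R.
Proof.
exists (numq q), (`|denq q|%N.-1); rewrite prednK ?absz_gt0 ?denq_neq0 //.
by rewrite -[LHS]divq_num_den; congr (_ / _); rewrite -{1}(absz_denq q).
Qed.

Lemma gamma_ratD p q : gamma_rat (p + q) = gamma_rat p + gamma_rat q.
Proof.
have [a [m ->]] := rat_frac p; have [b [n ->]] := rat_frac q.
rewrite addf_div ?pnatr_eq0 // !gamma_ratE gammaDE.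
have -> : a%:~R * n.+1%:R + b%:~R * m.+1%:R =
    (a * n.+1%:Z + b * m.+1%:Z)%:~R :> rat by rewrite intrD !intrM.
rewrite -natrM.
by rewrite mulSS gamma_ratE intrD !intrM.
Qed.
Lemma gamma_ratM p q : gamma_rat (p * q) = gamma_rat p * gamma_rat q.
Proof.
have [a [m ->]] := rat_frac p; have [b [n ->]] := rat_frac q.
rewrite mulf_div !gamma_ratE gammaME -natrM -intrM.
by rewrite mulSS gamma_ratE intrM.
Qed.
Lemma gamma_rat1 : gamma_rat 1 = 1.
Proof. by []. Qed.

Definition gamma_scale (q : rat) (x : Gamma) : Gamma := gamma_rat q * x.
Lemma gamma_scaleA p q x : gamma_scale p (gamma_scale q x) = gamma_scale (p * q) x.
Proof. by rewrite /gamma_scale gamma_ratM mulrA. Qed.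
Lemma gamma_scale1 : left_id 1 gamma_scale.
Proof. by move=> x; rewrite /gamma_scale gamma_rat1 mul1r. Qed.
Lemma gamma_scaleDr : right_distributive gamma_scale +%R.
Proof. by move=> q x y; rewrite /gamma_scale mulrDr. Qed.
Lemma gamma_scaleDl x : {morph gamma_scale^~ x : p q / p + q}.
Proof. by move=> p q; rewrite /gamma_scale gamma_ratD mulrDl. Qed.
HB.instance Definition _ := GRing.Zmodule_isLmodule.Build rat Gamma
  gamma_scaleA gamma_scale1 gamma_scaleDr gamma_scaleDl.

Lemma gamma_scaleAl q (x y : Gamma) : q *: (x * y) = q *: x * y.
Proof. exact: mulrA. Qed.
HB.instance Definition _ := GRing.Lmodule_isLalgebra.Build rat Gamma gamma_scaleAl.
HB.instance Definition _ := GRing.Lalgebra_isComAlgebra.Build rat Gamma.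

Definition gcl (V : fgmod G F) : Gamma := green_class V %/S 0.

Lemma gcl_iso U V : fgiso U V -> gcl U = gcl V.
Proof. by move=> /isoclP UV; rewrite /gcl /green_class UV. Qed.
Lemma gclD U V : gcl (fgsum U V) = gcl U + gcl V.
Proof.
by rewrite /gcl /green_class gammaDE !mulr1 greenDE addr0 isoclDE.
Qed.
Lemma gclM U V : gcl (fgtens U V) = gcl U * gcl V.
Proof.
by rewrite /gcl /green_class gammaME greenME isoclME !(mul0r, mulr0) !addr0.
Qed.

End Gamma.
Arguments gcl {G F} V.

(* Formal power series A[[t]]: f n is the coefficient of t^n. *)
Record fps (A : Type) := FPS { fps_coef :> nat -> A }.

Lemma fpsP (A : Type) (f g : fps A) : f =1 g <-> f = g.
Proof. by split=> [|->//]; case: f g => [f] [g] /= /funext->. Qed.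

HB.instance Definition _ (A : Type) := gen_eqMixin (fps A).
HB.instance Definition _ (A : Type) := gen_choiceMixin (fps A).

Section FpsRing.
Variable A : comNzRingType.
Implicit Types f g h : fps A.

Definition fps_add f g := FPS (fun n => f n + g n).
Definition fps_opp f := FPS (fun n => - f n).
Definition fps_zero : fps A := FPS (fun=> 0).
Definition fps_one : fps A := FPS (fun n => (n == 0%N)%:R).
Definition fps_mul f g := FPS (fun n => \sum_(i < n.+1) f i * g (n - i)%N).

Lemma fps_addA : associative fps_add.
Proof. by move=> f g h; apply/fpsP => n /=; rewrite addrA. Qed.
Lemma fps_addC : commutative fps_add.
Proof. by move=> f g; apply/fpsP => n /=; rewrite addrC. Qed.
Lemma fps_add0 : left_id fps_zero fps_add.
Proof. by move=> f; apply/fpsP => n /=; rewrite add0r. Qed.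
Lemma fps_addN : left_inverse fps_zero fps_opp fps_add.
Proof. by move=> f; apply/fpsP => n /=; rewrite addNr. Qed.
HB.instance Definition _ :=
  GRing.isZmodule.Build (fps A) fps_addA fps_addC fps_add0 fps_addN.

Let trunc N f : {poly A} := \poly_(i < N.+1) f i.
Let truncE N f i : (i <= N)%N -> (trunc N f)`_i = f i.
Proof. by move=> iN; rewrite coef_poly ltnS iN. Qed.
Let fps_mulE N f g n : (n <= N)%N ->
  fps_mul f g n = (trunc N f * trunc N g)`_n.
Proof.
move=> nN; rewrite coefM; apply: eq_bigr => i _.
rewrite !truncE //; first exact: leq_trans (leq_subr _ _) nN.
by apply: leq_trans nN; rewrite -ltnS.
Qed.

Lemma fps_mulC : commutative fps_mul.
Proof.
by move=> f g; apply/fpsP => n; rewrite !(fps_mulE _ _ (leqnn n)) mulrC.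
Qed.
Lemma fps_mulA : associative fps_mul.
Proof.
move=> f g h; apply/fpsP => n.
transitivity ((trunc n f * (trunc n g * trunc n h))`_n).
  rewrite coefM; apply: eq_bigr => i _.
  congr (_ * _); first by rewrite truncE // -ltnS.
  by apply: fps_mulE; apply: leq_subr.
rewrite mulrA coefM; apply: eq_bigr => i _.
congr (_ * _); last by rewrite truncE // leq_subr.
by apply/esym/fps_mulE; rewrite -ltnS.
Qed.
Lemma fps_mul1 : left_id fps_one fps_mul.
Proof.
move=> f; apply/fpsP => n /=; rewrite big_ord_recl /= mul1r subn0.
by rewrite big1 ?addr0 // => i _; rewrite mul0r.
Qed.
Lemma fps_mulDl : left_distributive fps_mul +%R.
Proof.
move=> f g h; apply/fpsP => n /=; rewrite -big_split /=.
by apply: eq_bigr => i _; rewrite mulrDl.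
Qed.
Lemma fps_1neq0 : fps_one != 0.
Proof. by apply/eqP => /fpsP/(_ 0%N)/eqP; rewrite /= oner_eq0. Qed.
HB.instance Definition _ := GRing.Zmodule_isComNzRing.Build (fps A)
  fps_mulA fps_mulC fps_mul1 fps_mulDl fps_1neq0.
End FpsRing.

Section FpsAlg.
Variable A : comAlgType rat.
Implicit Types f g : fps A.

Definition fps_scale (a : rat) f : fps A := FPS (fun n => a *: f n).
Lemma fps_scaleA a b f : fps_scale a (fps_scale b f) = fps_scale (a * b) f.
Proof. by apply/fpsP => n /=; rewrite scalerA. Qed.
Lemma fps_scale1 : left_id 1 fps_scale.
Proof. by move=> f; apply/fpsP => n /=; rewrite scale1r. Qed.
Lemma fps_scaleDr : right_distributive fps_scale +%R.
Proof. by move=> a f g; apply/fpsP => n /=; rewrite scalerDr. Qed.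
Lemma fps_scaleDl f : {morph fps_scale^~ f : a b / a + b}.
Proof. by move=> a b; apply/fpsP => n /=; rewrite scalerDl. Qed.
HB.instance Definition _ := GRing.Zmodule_isLmodule.Build rat (fps A)
  fps_scaleA fps_scale1 fps_scaleDr fps_scaleDl.
Lemma fps_scaleAl a f g : a *: (f * g) = a *: f * g.
Proof.
apply/fpsP => n /=; rewrite scaler_sumr; apply: eq_bigr => i _.
by rewrite scalerAl.
Qed.
HB.instance Definition _ := GRing.Lmodule_isLalgebra.Build rat (fps A) fps_scaleAl.
HB.instance Definition _ := GRing.Lalgebra_isComAlgebra.Build rat (fps A).

(* The sums are finite because f ^+ k (resp. (f - 1) ^+ k) only involves powers
   t^n with k <= n when f 0 = 0 (resp. f 0 = 1). *)
Definition fps_exp f : fps A :=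
  FPS (fun n => \sum_(0 <= k < n.+1) (k`!%:R^-1 : rat) *: (f ^+ k) n).
Definition fps_log f : fps A :=
  FPS (fun n => \sum_(1 <= k < n.+1)
                  ((-1) ^+ k.-1 / k%:R : rat) *: ((f - 1) ^+ k) n).

(* The substitution of t^r for t; only meaningful for r > 0. *)
Definition fps_subst (r : nat) f : fps A :=
  FPS (fun n => if (r %| n)%N then f (n %/ r)%N else 0).

End FpsAlg.

Definition moebius (n : nat) : int :=
  if all (fun p => logn p n == 1%N) (primes n) then (-1) ^+ size (primes n)
  else 0.

Section Resolvents.
Variables (G : groupType) (F : fieldType).
Local Notation Gamma := (Gamma G F).
Local Notation fgmod := (fgmod G F).

Lemma Gamma_span (x : Gamma) :
  exists (q : rat) (U V : fgmod), x = q *: (gcl U - gcl V).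
Proof.
elim/gammaW: x => x n; elim/greenW: x => a b.
elim/quotW: a => U; elim/quotW: b => V; exists n.+1%:R^-1, U, V.
rewrite /gcl [- _](gamma_oppE _ _) gammaDE mulr1 mulr1.
rewrite [- _](green_oppE _ _) greenDE addr0 add0r.
rewrite -[n.+1%:R^-1]mul1r -[1]/((1 : int)%:~R).
rewrite -[RHS]/(gamma_rat G F _ * _) gamma_ratE gammaME mul1r.
by apply: gamma_eq; rewrite mulSS_nat mulr1.
Qed.

Lemma Gamma_linear_unique (M : lmodType rat) (f g : {linear Gamma -> M}) :
  (forall V, f (gcl V) = g (gcl V)) -> f =1 g.
Proof.
by move=> fg x; have [q [U [V ->]]] := Gamma_span x; rewrite !linearZ !linearB /= !fg.
Qed.

(* S(V,t) = 1 + S^1(V) t + S^2(V) t^2 + ... *)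
Definition symm_series (V : fgmod) : fps Gamma :=
  FPS (fun r => if r is 0 then 1 else gcl (symm_pow r V)).

(* psi and lie_resolvent r (written Phi^r) are the linear functions with the
   prescribed values on the classes of modules. By Gamma_linear_unique there is
   at most one such function; \0 is only a dummy for the impossible case where
   there is none. *)
Definition is_psi (f : {linear Gamma -> fps Gamma}) : Prop :=
  forall V, f (gcl V) = fps_log (symm_series V).

Definition psi : {linear Gamma -> fps Gamma} :=
  if pselect (exists f, is_psi f) is left h then sval (cid h) else \0.

Lemma psi_unique f : is_psi f -> psi =1 f.
Proof.
move=> fP; apply: Gamma_linear_unique => V; rewrite fP /psi.
by case: pselect => [h|[]]; [case: cid => g gP; apply: gP | exists f].
Qed.

Definition is_lie_resolvent (r : nat) (f : {linear Gamma -> Gamma}) : Prop :=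
  forall V, f (gcl V) = \sum_(d <- divisors r)
    ((moebius (r %/ d))%:~R * d%:R : rat) *: gcl (lie_pow d (fgpow V (r %/ d))).

Definition lie_resolvent (r : nat) : {linear Gamma -> Gamma} :=
  if pselect (exists f, is_lie_resolvent r f) is left h then sval (cid h) else \0.

Lemma lie_resolvent_unique r f : is_lie_resolvent r f -> lie_resolvent r =1 f.
Proof.
move=> fP; apply: Gamma_linear_unique => V; rewrite fP /lie_resolvent.
by case: pselect => [h|[]]; [case: cid => g gP; apply: gP | exists f].
Qed.

(* The i-th term psi(A_i)_{t -> t^i} has no coefficient below t^i. *)
Definition S_plus (f : fps Gamma) : fps Gamma :=
  FPS (fun n => \sum_(1 <= i < n.+1) fps_subst i (psi (f i)) n).
Definition S_star (f : fps Gamma) : fps Gamma := fps_exp (S_plus f).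

Definition L_plus (f : fps Gamma) : fps Gamma :=
  FPS (fun r => \sum_(d <- divisors r)
                  (d%:R^-1 : rat) *: lie_resolvent d (f (r %/ d)%N)).
Definition L_star (f : fps Gamma) : fps Gamma := L_plus (fps_log f).

End Resolvents.

(* Main.v *)
(* Write psi_n(A) for the coefficient of t^n in psi(A). Both S+ and L+ are Dirichlet
   convolutions with sequences of operators, (psi_n) and (Phi^n / n), so it suffices
   to see that these sequences are inverse to each other.

   Everything rests on the Poincare-Birkhoff-Witt theorem in characteristic 0, as a
   graded isomorphism of FG-modules between the symmetric algebra of the free Lie
   algebra L(V) and the tensor algebra T(V): in the Green ring,
     prod_d S(L^d(V), t^d) = sum_n V^n t^n.
   Taking logarithms gives sum_(d | n) psi_(n/d)(L^d(V)) = V^n / n. Let (phi_n) be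
   the Dirichlet inverse of (psi_n), which exists because psi_1 is the identity. Then
   L^n(V) = sum_(d | n) (d / n) phi_d(V^(n/d)), and Moebius inversion shows that
   n phi_n has the values prescribed for the Lie resolvent Phi^n.

   The isomorphism is symmetrization. L(V) embeds into T(V) by Dynkin's argument; by
   means of this embedding L(V) acts by derivations on the shuffle algebra of
   functions on words, and evaluating products of these derivations on products of
   functions dual to a basis of L(V) shows that symmetrization is injective.
   Surjectivity follows by reordering factors modulo products with fewer factors. *)
From HB Require Import structures.
Require Import Defs.
From mathcomp Require Import mpoly mxtens.
From mathcomp Require Import all_boot all_order all_algebra ring boolp.

Set Implicit Arguments.
Unset Strict Implicit.
Unset Printing Implicit Defensive.
Import GRing.Theory Num.Theory.
Local Open Scope ring_scope.
Local Open Scope quotient_scope.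

(** * Formal power series *)
Section FpsTheory.
Variable A : comAlgType rat.
Implicit Types f g h : fps A.

(** The values prescribed for Phi^r are isomorphism invariants of V, but nothing shows at the outset
    that they are additive: tensor and Lie powers of a direct sum have mixed terms. So the existence
    of the resolvents is itself a result of the inversion, because the Dirichlet inverse of psi is
    linear by construction. For psi existence is direct, S(U + V, t) being a product. The inversion
    yields only a left inverse of S+; the other side follows from injectivity of L+. The free Lie
    algebra is a quotient of terms, without a basis at hand, and T(V), realized as functions on
    words, takes the place of its enveloping algebra. Polynomials in finitely many variables suffice
    because degree k only involves L^d(V) with d at most k, so everything is done up to a bound N.
    Symmetrized products are used rather than ordered monomials because a linear change of basis
    carries them to symmetrized products, which keeps track of G. Characteristic 0 serves to divide
    by d in Dynkin's argument and by k and by the factorials of exponents in symmetrization. *)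

Lemma rat_mulrSn_eq0 (M : lmodType rat) (x : M) n : x *+ n.+1 = 0 -> x = 0.
Proof.
move=> xn; have n0 : (n.+1%:R : rat) != 0 by rewrite pnatr_eq0.
by rewrite -[x]scale1r -(mulVf n0) -scalerA scaler_nat xn scaler0.
Qed.

Lemma fps_coefD f g n : (f + g) n = f n + g n. Proof. by []. Qed.
Lemma fps_coefB f g n : (f - g) n = f n - g n. Proof. by []. Qed.
Lemma fps_coefM f g n : (f * g) n = \sum_(i < n.+1) f i * g (n - i)%N.
Proof. by []. Qed.
Lemma fps_coefM0 f g : (f * g) 0%N = f 0%N * g 0%N.
Proof. by rewrite fps_coefM big_ord1. Qed.

Lemma fps_coef_sum I (r : seq I) (P : pred I) (F : I -> fps A) n :
  (\sum_(i <- r | P i) F i) n = \sum_(i <- r | P i) F i n.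
Proof. by elim/big_rec2: _ => // i x y _ <-. Qed.

Lemma fps_coefX_lt f k n : f 0%N = 0 -> (n < k)%N -> (f ^+ k) n = 0.
Proof.
move=> f0; elim: k n => // k IHk n nk; rewrite exprS fps_coefM big1 // => i _.
have [->|i0] := posnP i; first by rewrite f0 mul0r.
rewrite IHk ?mulr0 // ltn_subLR; last by rewrite -ltnS.
by apply: leq_trans nk _; rewrite -add1n leq_add2r.
Qed.

Definition fps_der f : fps A := FPS (fun n => f n.+1 *+ n.+1).

Lemma fps_derD f g : fps_der (f + g) = fps_der f + fps_der g.
Proof. by apply/fpsP => n /=; rewrite mulrnDl. Qed.
Lemma fps_derZ a f : fps_der (a *: f) = a *: fps_der f.
Proof. by apply/fpsP => n /=; rewrite scalerMnr. Qed.
Lemma fps_der_sum I (r : seq I) (P : pred I) (F : I -> fps A) :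
  fps_der (\sum_(i <- r | P i) F i) = \sum_(i <- r | P i) fps_der (F i).
Proof.
elim/big_rec2: _ => [|i x y _ <-]; last by rewrite fps_derD.
by apply/fpsP => n /=; rewrite mul0rn.
Qed.

Lemma fps_derM f g : fps_der (f * g) = fps_der f * g + f * fps_der g.
Proof.
apply/fpsP => n /=; transitivity
  (\sum_(i < n.+2) (f i *+ i * g (n.+1 - i)%N + f i * (g (n.+1 - i)%N *+ (n.+1 - i)))).
  rewrite -sumrMnl; apply: eq_bigr => i _.
  by rewrite mulrnAl mulrnAr -mulrnDr subnKC // -ltnS.
rewrite big_split /= big_ord_recl mulr0n mul0r add0r; congr (_ + _).
rewrite big_ord_recr /= subnn mulr0n mulr0 addr0; apply: eq_bigr => i _.
by rewrite subSn // -ltnS.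
Qed.

Lemma fps_der1 : fps_der 1 = 0.
Proof. by apply/fpsP => n /=; rewrite mul0rn. Qed.

Lemma fps_derX f k : fps_der (f ^+ k.+1) = (fps_der f * f ^+ k) *+ k.+1.
Proof.
elim: k => [|k IHk]; first by rewrite mulr1.
by rewrite [in LHS]exprS fps_derM IHk mulrnAr mulrCA -exprS -mulrS.
Qed.

(** Coefficient n of f * h involves h only up to degree n, so h n.+1 is determined after division by
    n.+1. The identities between exp and log rest on such uniqueness. *)
Lemma fps_ode f h : h 0%N = 0 -> fps_der h = f * h -> h = 0.
Proof.
move=> h0 hE; apply/fpsP; elim/ltn_ind => -[|n] IHn //.
have /(congr1 (fun k : fps A => k n)) := hE; rewrite /= big1 => [|i _].
  exact: rat_mulrSn_eq0.
by rewrite IHn ?mulr0 // ltnS leq_subr.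
Qed.

Lemma fps_mulI f h : f 0%N = 1 -> f * h = 0 -> h = 0.
Proof.
move=> f0 fh; apply/fpsP; elim/ltn_ind => n IHn.
have /(congr1 (fun k : fps A => k n)) := fh; rewrite fps_coefM big_ord_recl f0 mul1r subn0.
rewrite big1 ?addr0 // => i _; rewrite IHn ?mulr0 // lift0.
by case: n i {IHn} => [|n] i; [case: i | rewrite subSS ltnS leq_subr].
Qed.

Lemma fps_der_inj f g : f 0%N = g 0%N -> fps_der f = fps_der g -> f = g.
Proof.
move=> fg0 fg; apply/eqP; rewrite -subr_eq0; apply/eqP/(@fps_ode 0).
  by rewrite fps_coefB fg0 subrr.
by rewrite mul0r -scaleN1r fps_derD fps_derZ fg scaleN1r subrr.
Qed.

(** [fps_exp] cuts its sum at the index of the coefficient, so it is no single sum of series. A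
    fixed cut-off gives polynomials in f, which can be differentiated and which agree with the
    series below degree N. Likewise for [logN]. *)
Definition expN f N : fps A := \sum_(0 <= k < N) (k`!%:R^-1 : rat) *: f ^+ k.
Definition logN f N : fps A :=
  \sum_(1 <= k < N) ((-1) ^+ k.-1 / k%:R : rat) *: (f - 1) ^+ k.

Lemma fps_expE f n N : f 0%N = 0 -> (n < N)%N -> fps_exp f n = expN f N n.
Proof.
move=> f0 nN; rewrite /expN fps_coef_sum (big_cat_nat (n := n.+1)) //=.
  rewrite [X in _ + X]big_nat_cond [X in _ + X]big1 ?addr0 // => k.
  by case/andP => /andP[nk _] _; rewrite fps_coefX_lt ?scaler0.
Qed.

Lemma fps_logE f n N : f 0%N = 1 -> (n < N)%N -> fps_log f n = logN f N n.
Proof.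
move=> f0 nN; rewrite /logN fps_coef_sum (big_cat_nat (n := n.+1)) //=.
rewrite [X in _ = _ + X]big_nat_cond [X in _ = _ + X]big1 ?addr0 // => k.
by case/andP => /andP[nk _] _; rewrite fps_coefX_lt ?scaler0 // fps_coefB f0 subrr.
Qed.

Lemma fps_exp0 f : fps_exp f 0%N = 1.
Proof. by rewrite /= big_nat1 expr0 invr1 scale1r. Qed.
Lemma fps_log0 f : fps_log f 0%N = 0.
Proof. by rewrite /= big_geq. Qed.

Lemma der_expN f N : fps_der (expN f N.+1) = fps_der f * expN f N.
Proof.
rewrite /expN fps_der_sum big_nat_recl // expr0 fps_derZ fps_der1 scaler0 add0r.
rewrite mulr_sumr; apply: eq_bigr => k _; rewrite fps_derZ fps_derX -scaler_nat.
rewrite scalerA factS natrM invfM mulrAC mulVf ?mul1r ?scalerAr //.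
by rewrite pnatr_eq0.
Qed.

Lemma der_fps_exp f : f 0%N = 0 -> fps_der (fps_exp f) = fps_der f * fps_exp f.
Proof.
move=> f0; apply/fpsP => n.
have /(congr1 (fun k : fps A => k n)) := der_expN f n.+1.
have -> : fps_der (expN f n.+2) n = fps_der (fps_exp f) n.
  by congr (_ *+ _); apply/esym/fps_expE.
by move=> ->; rewrite !fps_coefM; apply: eq_bigr => i _; rewrite -fps_expE // ltnS leq_subr.
Qed.

(** The derivative is a geometric sum in 1 - f, and the factor f = 1 - (1 - f) telescopes it. When f
    has constant term 1, the remainder (1 - f) ^+ N starts in degree N. *)
Lemma der_logN f N :
  fps_der (logN f N.+1) * f = fps_der f * (1 - (1 - f) ^+ N).
Proof.
have -> : fps_der (logN f N.+1) = fps_der f * \sum_(k < N) (1 - f) ^+ k.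
  rewrite /logN fps_der_sum big_add1 /= big_mkord mulr_sumr; apply: eq_bigr => k _.
  rewrite fps_derZ fps_derX -scaler_nat scalerA mulfVK ?pnatr_eq0 //.
  rewrite -[X in f + X]scaleN1r fps_derD fps_derZ fps_der1 scaler0 addr0.
  rewrite -[1 - f]opprB -[- (f - 1)]scaleN1r exprZn scaleN1r.
  by rewrite -scalerAr.
rewrite -mulrA; congr (_ * _); rewrite -[RHS]opprB subrX1 -mulNr mulrC opprB.
by rewrite subKr.
Qed.

Lemma der_fps_log f : f 0%N = 1 -> fps_der (fps_log f) * f = fps_der f.
Proof.
move=> f0; apply/fpsP => n; transitivity ((fps_der (logN f n.+2) * f) n).
  rewrite !fps_coefM; apply: eq_bigr => i _; congr (_ *+ _ * _).
  by apply: fps_logE => //; rewrite ltnS.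
rewrite der_logN mulrBr mulr1 fps_coefB fps_coefM big1 ?subr0 // => i _.
rewrite fps_coefX_lt ?mulr0 ?fps_coefB ?f0 ?subrr //.
by rewrite ltnS leq_subr.
Qed.

Lemma fps_log_unique f h :
  f 0%N = 1 -> h 0%N = 0 -> fps_der h * f = fps_der f -> h = fps_log f.
Proof.
move=> f0 h0 hf; apply: fps_der_inj; first by rewrite h0 fps_log0.
apply/eqP; rewrite -subr_eq0; apply/eqP/(fps_mulI f0).
by rewrite mulrBr ![f * _]mulrC hf der_fps_log // subrr.
Qed.

Lemma fps_expK f : f 0%N = 0 -> fps_log (fps_exp f) = f.
Proof.
move=> f0; apply/esym/fps_log_unique => //; first exact: fps_exp0.
by rewrite der_fps_exp.
Qed.

Lemma fps_logK f : f 0%N = 1 -> fps_exp (fps_log f) = f.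
Proof.
move=> f0; apply/eqP; rewrite -subr_eq0; apply/eqP.
apply: (@fps_ode (fps_der (fps_log f))).
  by rewrite fps_coefB fps_exp0 f0 subrr.
rewrite -scaleN1r fps_derD fps_derZ der_fps_exp ?fps_log0 //.
by rewrite -[in X in _ + _ *: X](der_fps_log f0) mulrDr scalerAr.
Qed.

Lemma fps_logM f g : f 0%N = 1 -> g 0%N = 1 ->
  fps_log (f * g) = fps_log f + fps_log g.
Proof.
move=> f0 g0; apply/esym/fps_log_unique.
- by rewrite fps_coefM0 f0 g0 mulr1.
- by rewrite fps_coefD !fps_log0 addr0.
rewrite fps_derD fps_derM mulrDl; congr (_ + _); first by rewrite mulrA der_fps_log.
by rewrite mulrCA der_fps_log.
Qed.

Lemma fps_log1 : fps_log (1 : fps A) = 0.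
Proof.
by apply/esym/fps_log_unique => //; rewrite mulr1 fps_der1; apply/fpsP=> n; rewrite /= mul0rn.
Qed.

Lemma fps_log_prod I (r : seq I) (F : I -> fps A) : (forall i, F i 0%N = 1) ->
  (\prod_(i <- r) F i) 0%N = 1 /\
  fps_log (\prod_(i <- r) F i) = \sum_(i <- r) fps_log (F i).
Proof.
move=> F0; elim: r => [|i r [IH0 IH]]; first by rewrite !big_nil fps_log1.
by rewrite !big_cons fps_coefM0 F0 IH0 mulr1 fps_logM ?IH.
Qed.

(** This is -log(1 - x t): in degree n the derivative of the right-hand side times the geometric
    series has n.+1 equal terms x ^+ n.+1, which add up to the derivative of that series. *)
Lemma fps_log_geom (x : A) :
  fps_log (FPS (fun n => x ^+ n)) = FPS (fun n => (n%:R^-1 : rat) *: x ^+ n *+ (0 < n)%N).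
Proof.
apply/esym/fps_log_unique => //; apply/fpsP => n.
rewrite fps_coefM /=.
rewrite (eq_bigr (fun=> x ^+ n.+1)) ?sumr_const ?card_ord // => i _.
rewrite mulr1n -scaler_nat scalerA divff ?pnatr_eq0 // scale1r.
by rewrite -exprD addSn subnKC // -ltnS.
Qed.

Lemma fps_substM r f g : (0 < r)%N ->
  fps_subst r (f * g) = fps_subst r f * fps_subst r g.
Proof.
move=> r0; apply/fpsP => n; rewrite [LHS]/= fps_coefM.
have -> : \sum_(i < n.+1) fps_subst r f i * fps_subst r g (n - i)%N =
  \sum_(i <- index_iota 0 n.+1 | (r %| i)%N) f (i %/ r)%N * fps_subst r g (n - i)%N.
  rewrite -(big_mkord xpredT (fun i => fps_subst r f i * fps_subst r g (n - i)%N)).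
  rewrite [RHS]big_mkcond; apply: eq_bigr => i _ /=.
  by case: ifP => //; rewrite mul0r.
case: ifP => [rn|/negP rn]; last first.
  rewrite big_nat_cond big1 // => i /andP[/andP[_ ilt] ri] /=; case: ifP => [rni|]; rewrite ?mulr0 //.
  by case: rn; rewrite -[n](subnK (n := n) (m := i)) // dvdn_add.
have -> : [seq i <- index_iota 0 n.+1 | (r %| i)%N] = [seq (j * r)%N | j <- index_iota 0 (n %/ r).+1]
  -> \sum_(i <- index_iota 0 n.+1 | (r %| i)%N) f (i %/ r)%N * fps_subst r g (n - i)%N =
     \sum_(j <- index_iota 0 (n %/ r).+1) f j * g (n %/ r - j)%N.
  move=> E; rewrite -big_filter E big_map big_seq [RHS]big_seq; apply: eq_bigr => j.
  rewrite mem_index_iota ltnS /= => jn; rewrite mulnK //= -{1 2}(divnK rn) -mulnBl.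
  by rewrite dvdn_mull // mulnK.
  by rewrite big_mkord.
(* What remains is the list identity used as a premise above: both lists are strictly increasing, so
   equal membership is enough. *)
apply: (irr_sorted_eq ltn_trans ltnn).
- by apply: sorted_filter; [exact: ltn_trans | exact: iota_ltn_sorted].
- rewrite sorted_map; apply: (@sub_sorted _ ltn); last exact: iota_ltn_sorted.
  by move=> i j ij /=; rewrite ltn_pmul2r.
move=> i; rewrite mem_filter mem_index_iota ltnS leq0n andTb; apply/idP/idP => [/andP[ri ile]|].
  apply/mapP; exists (i %/ r)%N; last by rewrite divnK.
  by rewrite mem_index_iota ltnS leq_div2r.
case/mapP=> j; rewrite mem_index_iota ltnS /= => jn ->; rewrite dvdn_mull //=.
by rewrite -leq_divRL.
Qed.

Lemma fps_subst1 r : fps_subst r (1 : fps A) = 1.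
Proof.
apply/fpsP => n /=; case: ifP => [/dvdnP[k ->]|].
  case: r => [|r]; first by rewrite muln0 div0n.
  by rewrite mulnK // muln_eq0 orbF.
by case: n => //; rewrite dvdn0.
Qed.

Lemma fps_substD r f g : fps_subst r (f + g) = fps_subst r f + fps_subst r g.
Proof. by apply/fpsP => n /=; case: ifP; rewrite ?addr0. Qed.
Lemma fps_substN r f : fps_subst r (- f) = - fps_subst r f.
Proof. by apply/fpsP => n /=; case: ifP; rewrite ?oppr0. Qed.

Lemma fps_substX r f k : (0 < r)%N -> fps_subst r (f ^+ k) = fps_subst r f ^+ k.
Proof.
by move=> r0; elim: k => [|k IHk]; rewrite ?fps_subst1 // !exprS fps_substM ?IHk.
Qed.

Lemma fps_subst0 r f : fps_subst r f 0%N = f 0%N.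
Proof. by rewrite /= dvdn0 div0n. Qed.

Lemma fps_subst_log r f : (0 < r)%N -> f 0%N = 1 ->
  fps_log (fps_subst r f) = fps_subst r (fps_log f).
Proof.
move=> r0 f0; apply/fpsP => n; rewrite [LHS]/= -{1}(fps_subst1 r) -fps_substN -fps_substD.
under eq_bigr => k _ do rewrite -fps_substX //=.
rewrite /=; case: ifP => rn; last by rewrite big1 // => k _; rewrite scaler0.
(* The sum is cut according to n, later than the coefficient n %/ r demands; the surplus powers of f
   - 1 vanish there. *)
transitivity (logN f n.+1 (n %/ r)%N); first by rewrite fps_coef_sum.
by rewrite -fps_logE // ltnS leq_div.
Qed.

End FpsTheory.

(** * Functions on words *)
Section WordFunctions.
Variables (F : fieldType) (X : finType).

(* The linear dual of the tensor algebra on X; functions supported on words of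
   a fixed length are also used as tensors of that degree. *)
Definition wordfun := seq X -> F.
Implicit Types f g h : wordfun.

HB.instance Definition _ := gen_eqMixin wordfun.
HB.instance Definition _ := gen_choiceMixin wordfun.

Lemma wordfun_addA : associative (fun f g : wordfun => (fun w => f w + g w) : wordfun).
Proof. by move=> f g h; apply: funext => w; rewrite addrA. Qed.
Lemma wordfun_addC : commutative (fun f g : wordfun => (fun w => f w + g w) : wordfun).
Proof. by move=> f g; apply: funext => w; rewrite addrC. Qed.
Lemma wordfun_add0 :
  left_id ((fun=> 0) : wordfun) (fun f g : wordfun => (fun w => f w + g w) : wordfun).
Proof. by move=> f; apply: funext => w; rewrite add0r. Qed.
Lemma wordfun_addN :
  left_inverse ((fun=> 0) : wordfun) (fun f => (fun w => - f w) : wordfun)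
    (fun f g : wordfun => (fun w => f w + g w) : wordfun).
Proof. by move=> f; apply: funext => w; rewrite addNr. Qed.
HB.instance Definition _ := GRing.isZmodule.Build wordfun
  wordfun_addA wordfun_addC wordfun_add0 wordfun_addN.

Lemma wordfun_scaleA a b f :
  (fun w => a * (b * f w)) = (fun w => a * b * f w) :> wordfun.
Proof. by apply: funext => w; rewrite mulrA. Qed.
Lemma wordfun_scale1 :
  left_id 1 (fun (a : F) (f : wordfun) => (fun w => a * f w) : wordfun).
Proof. by move=> f; apply: funext => w; rewrite mul1r. Qed.
Lemma wordfun_scaleDr :
  right_distributive (fun (a : F) (f : wordfun) => (fun w => a * f w) : wordfun) +%R.
Proof. by move=> a f g; apply: funext => w; exact: mulrDr. Qed.
Lemma wordfun_scaleDl f :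
  {morph (fun (a : F) => (fun w => a * f w) : wordfun) : a b / a + b}.
Proof. by move=> a b; apply: funext => w; rewrite mulrDl. Qed.
HB.instance Definition _ := GRing.Zmodule_isLmodule.Build F wordfun
  wordfun_scaleA wordfun_scale1 wordfun_scaleDr wordfun_scaleDl.

Lemma wordfunD f g w : (f + g) w = f w + g w. Proof. by []. Qed.
Lemma wordfunN f w : (- f) w = - f w. Proof. by []. Qed.
Lemma wordfunZ a f w : (a *: f) w = a * f w. Proof. by []. Qed.
Lemma wordfun_sum I (r : seq I) (P : pred I) (E : I -> wordfun) w :
  (\sum_(i <- r | P i) E i) w = \sum_(i <- r | P i) E i w.
Proof. by elim/big_rec2: _ => // i x y _ <-. Qed.

Definition wtl (x : X) f : wordfun := fun w => f (x :: w).
Lemma wtl_linear x : linear (wtl x).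
Proof. by []. Qed.
HB.instance Definition _ x :=
  GRing.isLinear.Build F wordfun wordfun _ (wtl x) (wtl_linear x).

Definition wone : wordfun := fun w => (nilp w)%:R.

(* Both products are defined by the value of the left derivative wtl x on a
   product: wtl x (f * g) = wtl x f * g + f [::] *: wtl x g for concatenation,
   while wtl x is a derivation for the shuffle product. *)
Fixpoint conc_mul f g (w : seq X) : F :=
  if w is x :: w' then conc_mul (wtl x f) g w' + f [::] * g (x :: w')
  else f [::] * g [::].

Fixpoint shuf_mul f g (w : seq X) : F :=
  if w is x :: w' then shuf_mul (wtl x f) g w' + shuf_mul f (wtl x g) w'
  else f [::] * g [::].

Lemma conc_mulPl a f g h :
  conc_mul (a *: f + g) h = a *: (conc_mul f h : wordfun) + (conc_mul g h : wordfun).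
Proof.
apply: funext => w; elim: w f g h => [|x w IHw] f g h /=.
  by rewrite !(wordfunD, wordfunZ) /= mulrDl mulrA.
by rewrite linearP IHw !(wordfunD, wordfunZ) /=; ring.
Qed.
Lemma conc_mulPr a f g h :
  conc_mul h (a *: f + g) = a *: (conc_mul h f : wordfun) + (conc_mul h g : wordfun).
Proof.
apply: funext => w; elim: w f g h => [|x w IHw] f g h /=.
  by rewrite !(wordfunD, wordfunZ) /=; ring.
by rewrite IHw !(wordfunD, wordfunZ) /=; ring.
Qed.

Lemma conc_mul0l g w : conc_mul 0 g w = 0.
Proof. by elim: w => [|x w IHw] /=; rewrite ?linear0 ?IHw mul0r ?addr0. Qed.

Lemma conc_mulA f g h : conc_mul f (conc_mul g h) = conc_mul (conc_mul f g) h.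
Proof.
apply: funext => w; elim: w f g h => [|x w IHw] f g h /=; first exact: mulrA.
have -> : wtl x (conc_mul f g) = f [::] *: wtl x g + (conc_mul (wtl x f) g : wordfun).
  by apply: funext => u; rewrite /wtl /= addrC.
by rewrite conc_mulPl IHw !(wordfunD, wordfunZ) /=; ring.
Qed.
Lemma conc_mul1l f : conc_mul wone f = f.
Proof.
apply: funext => -[|x w] /=; first by rewrite mul1r.
by rewrite [wtl x _](_ : _ = 0) // conc_mul0l mul1r add0r.
Qed.
Lemma conc_mul1r f : conc_mul f wone = f.
Proof.
apply: funext => w; elim: w f => [|x w IHw] f /=; first by rewrite mulr1.
by rewrite IHw mulr0 addr0.
Qed.

Lemma shuf_mulC f g : shuf_mul f g = shuf_mul g f.
Proof.
apply: funext => w; elim: w f g => [|x w IHw] f g /=; first exact: mulrC.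
by rewrite addrC IHw [X in _ + X]IHw.
Qed.
Lemma shuf_mulPl a f g h :
  shuf_mul (a *: f + g) h = a *: (shuf_mul f h : wordfun) + (shuf_mul g h : wordfun).
Proof.
apply: funext => w; elim: w f g h => [|x w IHw] f g h /=.
  by rewrite !(wordfunD, wordfunZ) /= mulrDl mulrA.
by rewrite linearP !IHw !(wordfunD, wordfunZ) /=; ring.
Qed.
Lemma shuf_mulDl f g h :
  shuf_mul (f + g) h = (shuf_mul f h : wordfun) + (shuf_mul g h : wordfun).
Proof. by rewrite -[f]scale1r shuf_mulPl !scale1r. Qed.
Lemma shuf_mulDr f g h :
  shuf_mul h (f + g) = (shuf_mul h f : wordfun) + (shuf_mul h g : wordfun).
Proof. by rewrite shuf_mulC shuf_mulDl ![shuf_mul _ h]shuf_mulC. Qed.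
Lemma shuf_mul0l g w : shuf_mul 0 g w = 0.
Proof. by elim: w g => [|x w IHw] g /=; rewrite ?linear0 ?IHw ?mul0r ?addr0. Qed.
Lemma wtl_shuf x f g : wtl x (shuf_mul f g) =
  (shuf_mul (wtl x f) g : wordfun) + (shuf_mul f (wtl x g) : wordfun).
Proof. by []. Qed.
Lemma shuf_mulA f g h : shuf_mul f (shuf_mul g h) = shuf_mul (shuf_mul f g) h.
Proof.
apply: funext => w; elim: w f g h => [|x w IHw] f g h /=; first exact: mulrA.
by rewrite !wtl_shuf shuf_mulDl shuf_mulDr !wordfunD !IHw addrA.
Qed.
Lemma shuf_mul1l f : shuf_mul wone f = f.
Proof.
apply: funext => w; elim: w f => [|x w IHw] f /=; first by rewrite mul1r.
by rewrite [wtl x wone](_ : _ = 0) // shuf_mul0l IHw add0r.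
Qed.

Lemma wone_neq0 : wone != 0.
Proof. by apply/eqP => /(congr1 (fun f => f [::]))/eqP; rewrite oner_eq0. Qed.

(** One module, two ring structures: [conc] carries concatenation and its twin [shuf] the shuffle
    product. *)
Definition conc := wordfun.
HB.instance Definition _ := GRing.Lmodule.copy conc wordfun.
Lemma conc_mulDl : left_distributive (conc_mul : conc -> conc -> conc) +%R.
Proof. by move=> f g h; have := conc_mulPl 1 f g h; rewrite !scale1r. Qed.
Lemma conc_mulDr : right_distributive (conc_mul : conc -> conc -> conc) +%R.
Proof. by move=> f g h; have := conc_mulPr 1 g h f; rewrite !scale1r. Qed.
HB.instance Definition _ := GRing.Zmodule_isNzRing.Build conc
  conc_mulA conc_mul1l conc_mul1r conc_mulDl conc_mulDr wone_neq0.
Lemma conc_scaleAl a (f g : conc) : a *: (f * g) = a *: f * g.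
Proof.
have := conc_mulPl a f 0 g; rewrite addr0 => E.
by rewrite [RHS]E [X in _ + X](_ : _ = 0 :> wordfun) ?addr0 //; apply: funext => w; rewrite conc_mul0l.
Qed.
HB.instance Definition _ := GRing.Lmodule_isLalgebra.Build F conc conc_scaleAl.
Lemma conc_scaleAr a (f g : conc) : a *: (f * g) = f * (a *: g).
Proof.
have := conc_mulPr a g 0 f; rewrite addr0 => E; rewrite [RHS]E.
by rewrite [X in _ + X](_ : _ = 0 :> wordfun) ?addr0 //; apply: (mulr0 (f : conc)).
Qed.
HB.instance Definition _ := GRing.Lalgebra_isAlgebra.Build F conc conc_scaleAr.

Definition shuf := wordfun.
HB.instance Definition _ := GRing.Lmodule.copy shuf wordfun.
HB.instance Definition _ := GRing.Zmodule_isComNzRing.Build shuf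
  shuf_mulA shuf_mulC shuf_mul1l shuf_mulDl wone_neq0.
Lemma shuf_scaleAl a (f g : shuf) : a *: (f * g) = a *: f * g.
Proof.
have := shuf_mulPl a f 0 g; rewrite addr0 => E.
by rewrite [RHS]E [X in _ + X](_ : _ = 0 :> wordfun) ?addr0 //; apply: funext => w; rewrite shuf_mul0l.
Qed.
HB.instance Definition _ := GRing.Lmodule_isLalgebra.Build F shuf shuf_scaleAl.
HB.instance Definition _ := GRing.Lalgebra_isComAlgebra.Build F shuf.

Lemma concD (f g : conc) w : (f + g) w = f w + g w. Proof. by []. Qed.
Lemma concN (f : conc) w : (- f) w = - f w. Proof. by []. Qed.

Lemma wtl_concM x (f g : conc) :
  wtl x (f * g) = (wtl x f : conc) * g + f [::] *: (wtl x g : conc).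
Proof. by []. Qed.
Definition whomog n f := forall w, size w <> n -> f w = 0.

Lemma whomogP n a f g : whomog n f -> whomog n g -> whomog n (a *: f + g).
Proof. by move=> hf hg w wn; rewrite wordfunD wordfunZ hf // hg // mulr0 addr0. Qed.
Lemma whomogZ n a f : whomog n f -> whomog n (a *: f).
Proof. by move=> hf; rewrite -[_ *: _]addr0; apply: whomogP. Qed.
Lemma whomogD n f g : whomog n f -> whomog n g -> whomog n (f + g).
Proof. by move=> hf hg; rewrite -[f]scale1r; apply: whomogP. Qed.
Lemma whomog_sum n I (r : seq I) (P : pred I) (E : I -> wordfun) :
  (forall i, P i -> whomog n (E i)) -> whomog n (\sum_(i <- r | P i) E i).
Proof. by move=> hE; elim/big_ind: _ => //; apply: whomogD. Qed.
Lemma whomog_nil n f : whomog n.+1 f -> f [::] = 0.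
Proof. exact. Qed.
Lemma whomog_tl n x f : whomog n.+1 f -> whomog n (wtl x f).
Proof. by move=> hf w wn; apply: hf => -[]. Qed.
Lemma whomog_one : whomog 0 wone.
Proof. by move=> []. Qed.

Lemma conc_mul_deg0 (f g : conc) : whomog 0 f -> f * g = f [::] *: g.
Proof.
move=> hf; suff {1}-> : f = f [::] *: 1 by rewrite -scalerAl mul1r.
apply: funext => -[|x w]; rewrite wordfunZ ?mulr1 // mulr0; exact: hf.
Qed.

Lemma whomogM m n (f g : conc) : whomog m f -> whomog n g -> whomog (m + n) (f * g : conc).
Proof.
elim: m f => [|m IHm] f hf hg; first by rewrite conc_mul_deg0 //; apply: whomogZ.
move=> [|x w] wmn.
  by rewrite -[LHS]/(f [::] * g [::]) (whomog_nil hf) mul0r.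
rewrite -[LHS]/(wtl x (f * g) w) wtl_concM (whomog_nil hf) scale0r addr0.
by apply: IHm => // [|E]; [exact: whomog_tl | apply: wmn; rewrite /= E].
Qed.

Section Substitution.
Variable A : X -> X -> F.

(** With f read as the tensor with coefficient f w at the word w, this is the algebra endomorphism
    sending the letter j to the sum of the A j x times x. For A = V g it is the action of g on
    tensor powers. *)
Fixpoint wsub f (w : seq X) : F :=
  if w is x :: w' then \sum_j A j x * wsub (wtl j f) w' else f [::].

Lemma wtl_wsub x f : wtl x (wsub f) = \sum_j A j x *: (wsub (wtl j f) : wordfun).
Proof. by apply: funext => w; rewrite wordfun_sum. Qed.

Lemma wsub_linear : linear (wsub : wordfun -> wordfun).
Proof.
move=> a f g; apply: funext => w; elim: w f g => [|x w IHw] f g //=.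
rewrite !(wordfunD, wordfunZ) /= mulr_sumr -big_split /=; apply: eq_bigr => j _.
by rewrite linearP IHw !(wordfunD, wordfunZ); ring.
Qed.
HB.instance Definition _ :=
  GRing.isLinear.Build F wordfun wordfun _ (wsub : wordfun -> wordfun) wsub_linear.

Lemma wsubZ a f : wsub (a *: f) = a *: (wsub f : wordfun).
Proof.
by have := wsub_linear a f 0; rewrite addr0 (linear_fun0 wsub_linear) addr0.
Qed.

Lemma wsub_sum I (r : seq I) (P : pred I) (E : I -> wordfun) :
  wsub (\sum_(i <- r | P i) E i) = \sum_(i <- r | P i) (wsub (E i) : wordfun).
Proof. exact: (linear_sum wsub). Qed.

Lemma wsub1 : wsub (1 : conc) = (1 : conc).
Proof.
apply: funext => -[|x w] //=; apply: big1 => j _.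
have -> : wsub (wtl j (1 : conc)) = (0 : wordfun) by exact: linear_fun0 wsub_linear.
by rewrite mulr0.
Qed.

Lemma wsubM (f g : conc) : wsub (f * g) = (wsub f : conc) * (wsub g : conc).
Proof.
apply: funext => w; elim: w f g => [|x w IHw] f g //.
rewrite -[RHS]/(wtl x ((wsub f : conc) * (wsub g : conc)) w).
rewrite wtl_concM !wtl_wsub /= mulr_suml wordfunD wordfunZ !wordfun_sum mulr_sumr.
rewrite -big_split; apply: eq_bigr => j _ /=.
have -> : wsub (wtl j (f * g)) =
    f [::] *: (wsub (wtl j g) : wordfun) + (wsub ((wtl j f : conc) * g) : wordfun).
  by rewrite -wsub_linear wtl_concM addrC.
by rewrite !(wordfunD, wordfunZ) IHw -scalerAl wordfunZ; ring.
Qed.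
End Substitution.

(* A family of operators rho on M makes M a right module over the tensor algebra;
   wact n f is the action of the degree n component of f. *)
Section RightAction.
Variables (M : lmodType F) (rho : X -> {linear M -> M}).

Fixpoint wact n f (q : M) : M :=
  if n is n'.+1 then \sum_x wact n' (wtl x f) (rho x q) else f [::] *: q.

Lemma wact_linear n f : linear (wact n f).
Proof.
elim: n f => [|n IHn] f a p q /=.
  by rewrite scalerDr !scalerA mulrC.
by rewrite scaler_sumr -big_split; apply: eq_bigr => x _; rewrite linearP IHn.
Qed.
HB.instance Definition _ n f := GRing.isLinear.Build F M M _ (wact n f) (wact_linear n f).

Lemma wactDr n f p q : wact n f (p + q) = wact n f p + wact n f q.
Proof. exact: linearD. Qed.
Lemma wactZr n f a q : wact n f (a *: q) = a *: wact n f q.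
Proof. exact: linearZ. Qed.

Lemma wactPl n a f g q : wact n (a *: f + g) q = a *: wact n f q + wact n g q.
Proof.
elim: n f g q => [|n IHn] f g q /=; first by rewrite scalerDl scalerA.
by rewrite scaler_sumr -big_split; apply: eq_bigr => x _; rewrite linearP IHn.
Qed.
Lemma wact0l n q : wact n 0 q = 0.
Proof. by have := wactPl n (-1) 0 0 q; rewrite scaler0 addr0 scaleN1r addNr. Qed.
Lemma wactZl n a f q : wact n (a *: f) q = a *: wact n f q.
Proof. by rewrite -[a *: f]addr0 wactPl wact0l addr0. Qed.
Lemma wactDl n f g q : wact n (f + g) q = wact n f q + wact n g q.
Proof. by rewrite -[f]scale1r wactPl !scale1r. Qed.
Lemma wactNl n f q : wact n (- f) q = - wact n f q.
Proof. by rewrite -[- f]scaleN1r wactZl scaleN1r. Qed.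
Lemma wact_suml n I (r : seq I) (P : pred I) (E : I -> wordfun) q :
  wact n (\sum_(i <- r | P i) E i) q = \sum_(i <- r | P i) wact n (E i) q.
Proof.
by elim/big_rec2: _ => [|i x y _ <-]; [rewrite wact0l | rewrite wactDl].
Qed.

(** [wact (m + n)] consumes m + n letters; as f is supported in length m, the first m belong to f
    and the rest to g. The left factor acts first, as in a right module. *)
Lemma wactM m n (f g : conc) q : whomog m f ->
  wact (m + n) (f * g : conc) q = wact n g (wact m f q).
Proof.
elim: m f q => [|m IHm] f q hf /=.
  by rewrite conc_mul_deg0 // wactZl linearZ.
rewrite linear_sum; apply: eq_bigr => x _.
rewrite wtl_concM (whomog_nil hf) scale0r addr0 IHm //; exact: whomog_tl.
Qed.
End RightAction.

End WordFunctions.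

(** * The embedding of the free Lie algebra *)
Lemma pchar0_natr_neq0 (F : fieldType) n : [pchar F] =i pred0 -> n.+1%:R != 0 :> F.
Proof. by move=> /pcharf0P->. Qed.

Section FreeLieEmbedding.
Variables (F : fieldType) (n : nat).
Local Notation V := 'rV[F]_n.
Local Notation L := (freeLie V).
Local Notation T := (conc F 'I_n).

Lemma freeLie_brPl a (x x' y : L) :
  freeLie_br (a *: x + x') y = a *: freeLie_br x y + freeLie_br x' y.
Proof. by have [H _ _ _] := @freeLie_br_lie F V; apply: H. Qed.
Lemma freeLie_brPr a (x x' y : L) :
  freeLie_br y (a *: x + x') = a *: freeLie_br y x + freeLie_br y x'.
Proof. by have [_ H _ _] := @freeLie_br_lie F V; apply: H. Qed.
Lemma freeLie_br0l (y : L) : freeLie_br 0 y = 0.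
Proof. by have [H _ _ _] := @freeLie_br_lie F V; apply: linear_fun0 (H y). Qed.
Lemma freeLie_br0r (y : L) : freeLie_br y 0 = 0.
Proof. by have [_ H _ _] := @freeLie_br_lie F V; apply: linear_fun0 (H y). Qed.
Lemma freeLie_brDl (x x' y : L) :
  freeLie_br (x + x') y = freeLie_br x y + freeLie_br x' y.
Proof. by rewrite -[x]scale1r freeLie_brPl !scale1r. Qed.
Lemma freeLie_brZl a (x y : L) : freeLie_br (a *: x) y = a *: freeLie_br x y.
Proof. by rewrite -[a *: x]addr0 freeLie_brPl freeLie_br0l addr0. Qed.
Lemma freeLie_brC (x y : L) : freeLie_br y x = - freeLie_br x y.
Proof.
have [Bl Br Bxx _] := @freeLie_br_lie F V.
have := Bxx (x + y); rewrite freeLie_brDl -[X in freeLie_br x (X + _)]scale1r.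
rewrite -[X in freeLie_br y (X + _)]scale1r !freeLie_brPr !scale1r !Bxx add0r addr0.
by move/eqP; rewrite addr_eq0 => /eqP ->; rewrite opprK.
Qed.
(** The Jacobi identity in the form suited to right actions: bracketing with [x, y] is the
    commutator of bracketing with x and with y. *)
Lemma freeLie_leibniz (z x y : L) :
  freeLie_br z (freeLie_br x y) =
  freeLie_br (freeLie_br z x) y - freeLie_br (freeLie_br z y) x.
Proof.
have [_ _ _ J] := @freeLie_br_lie F V; have /eqP := J z x y.
rewrite -addrA addr_eq0 => /eqP->.
rewrite (freeLie_brC (freeLie_br y z)) (freeLie_brC (freeLie_br z x)) (freeLie_brC z y).
by rewrite -scaleN1r freeLie_brZl scaleN1r opprD !opprK addrC.
Qed.

Lemma freeLie_homog0_eq0 (x : L) d : freeLie_homog d x -> d = 0%N -> x = 0.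
Proof.
elim=> {d x} [v|d|d a x y _ IHx _ IHy d0|r s x y _ IHx _ _] //.
  by rewrite IHx // IHy // scaler0 addr0.
by move/eqP; rewrite addn_eq0 => /andP[/eqP r0 _]; rewrite IHx // freeLie_br0l.
Qed.

Definition wgen (v : V) : T := fun w => if w is [:: x] then v 0 x else 0.

Lemma wgen_linear : linear wgen.
Proof.
move=> a u v; apply: funext => -[|x [|y w]]; rewrite wordfunD wordfunZ /=;
  by rewrite ?mulr0 ?addr0 // !mxE.
Qed.

Definition wcomm (f g : T) : T := f * g - g * f.

Lemma wcomm_lie : lie_bracket wcomm.
Proof.
rewrite /wcomm; split.
- by move=> g a f f'; rewrite mulrDl mulrDr -scalerAl -scalerAr scalerBr opprD addrACA.
- by move=> g a f f'; rewrite mulrDl mulrDr -scalerAl -scalerAr scalerBr opprD addrACA.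
- by move=> f; rewrite subrr.
move=> f g h; rewrite !mulrBl !mulrBr !mulrA; apply: funext => w.
by rewrite !(concD, concN); transitivity (0 : F); [ring | by []].
Qed.

Definition lie_embed : L -> T := freeLie_lift wcomm wgen.

Lemma lie_embed_linear : linear lie_embed.
Proof. apply: freeLie_lift_linear; [exact: wcomm_lie | exact: wgen_linear]. Qed.
HB.instance Definition _ := GRing.isLinear.Build F L T _ lie_embed lie_embed_linear.

Lemma lie_embed_gen v : lie_embed (freeLie_gen v) = wgen v.
Proof. apply: freeLie_lift_gen; [exact: wcomm_lie | exact: wgen_linear]. Qed.

Lemma lie_embed_br x y : lie_embed (freeLie_br x y) = lie_embed x * lie_embed y - lie_embed y * lie_embed x.
Proof. apply: freeLie_lift_br; [exact: wcomm_lie | exact: wgen_linear]. Qed.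

Lemma lie_embed_homog d x : freeLie_homog d x -> whomog d (lie_embed x).
Proof.
elim=> {d x} [v|d|d a x y _ IHx _ IHy|r s x y _ IHx _ IHy].
- by rewrite lie_embed_gen => -[|i [|j w]].
- by rewrite linear0.
- by rewrite linearP; apply: whomogP.
rewrite lie_embed_br; apply: whomogD; first exact: whomogM.
by rewrite -scaleN1r; apply: whomogZ; rewrite addnC; apply: whomogM.
Qed.

Lemma wsub_wgen (A : 'M[F]_n) v : wsub A (wgen v) = wgen (v *m A).
Proof.
apply: funext => -[|x [|y w]] //=.
  by rewrite mxE; apply: eq_bigr => j _; rewrite mulrC.
rewrite big1 // => j _; rewrite big1 ?mulr0 // => k _.
have -> : (wsub A (wtl k (wtl j (wgen v))) : wordfun F 'I_n) = 0 by exact: linear_fun0 (wsub_linear A).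
by rewrite mulr0.
Qed.

(** Both sides are Lie homomorphisms that extend v |-> wgen (v *m A), hence equal. For A = V g this
    is the equivariance of the embedding. *)
Lemma wsub_lie_embed (A : 'M[F]_n) x : wsub A (lie_embed x) = lie_embed (freeLie_map (mulmxr A) x).
Proof.
have E : lie_embed \o freeLie_map (mulmxr A) =1 freeLie_lift wcomm (fun v => wgen (v *m A)).
  apply: freeLie_lift_unique.
  - exact: wcomm_lie.
  - by move=> a u v; rewrite mulmxDl -scalemxAl wgen_linear.
  - by move=> a u v /=; rewrite !linearP.
  - by move=> u v /=; rewrite freeLie_map_br lie_embed_br.
  - by move=> v /=; rewrite freeLie_map_gen lie_embed_gen.
rewrite -[RHS]/((lie_embed \o freeLie_map (mulmxr A)) x) E.
move: x {E}; apply: (_ : (fun z : L => wsub A (lie_embed z) : T) =1 _).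
apply: freeLie_lift_unique.
- exact: wcomm_lie.
- by move=> a u v; rewrite mulmxDl -scalemxAl wgen_linear.
- by move=> a u v /=; rewrite !linearP.
- by move=> u v /=; rewrite lie_embed_br linearB /= !wsubM.
- by move=> v /=; rewrite lie_embed_gen wsub_wgen.
Qed.

Lemma wact1_wgen (M : lmodType F) (rho : 'I_n -> {linear M -> M}) v q :
  wact rho 1 (wgen v) q = \sum_x v 0 x *: rho x q.
Proof. by []. Qed.

(* L + F is a right module over the tensor algebra, a letter x acting by
   (z, c) |-> ([z, x] + c x, 0). An element x of L^d then sends (0, 1) to (d x, 0),
   which makes the map from L to the tensor algebra injective in characteristic 0. *)
Section Dynkin.

Definition dynkin_op (x : 'I_n) (q : L * F^o) : L * F^o :=
  let e : L := freeLie_gen (delta_mx 0 x) in (freeLie_br q.1 e + (q.2 : F) *: e, 0).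
Lemma dynkin_op_linear x : linear (dynkin_op x).
Proof.
move=> a [z c] [z' c']; apply/pair_equal_spec; split; last by rewrite /= scaler0 addr0.
rewrite /= freeLie_brPl scalerDl !scalerDr !scalerA -!addrA; congr (_ + _).
by rewrite addrCA.
Qed.
HB.instance Definition _ x :=
  GRing.isLinear.Build F (L * F^o)%type (L * F^o)%type _ (dynkin_op x) (dynkin_op_linear x).

(** All pairs (z, c) are needed, since in a product the second factor acts on the image under the
    first. The part in z is [freeLie_leibniz]; the part in c is r [x, y] - s [y, x] = (r + s)
    [x, y]. *)
Lemma dynkin_lie_embed d x : freeLie_homog d x -> forall z (c : F),
  wact dynkin_op d (lie_embed x) (z, c : F^o) = (freeLie_br z x + (c * d%:R) *: x, 0).
Proof.
elim=> {d x} [v|d|d a x y _ IHx _ IHy|r s x y hx IHx hy IHy] z c.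
- rewrite lie_embed_gen wact1_wgen.
  have -> : freeLie_gen v = \sum_x v 0 x *: freeLie_gen (delta_mx 0 x) :> L.
    by rewrite {1}(row_sum_delta v) linear_sum; apply: eq_bigr => x _; rewrite linearZ.
  rewrite /= mulr1.
  rewrite (eq_bigr (fun x => (v 0 x *: (freeLie_br z (freeLie_gen (delta_mx 0 x)) +
     c *: freeLie_gen (delta_mx 0 x)), 0))); last first.
    by move=> x _; apply/pair_equal_spec; rewrite /= scaler0.
  have sum_pair I (r : seq I) (E : I -> L) :
      \sum_(i <- r) (E i, 0) = (\sum_(i <- r) E i, 0) :> L * F^o.
    elim/big_rec2: _ => // i p q _ ->; apply/pair_equal_spec; by rewrite /= addr0.
  rewrite sum_pair; congr (_, _).
  have [_ Br _ _] := @freeLie_br_lie F V.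
  rewrite (linear_fun_sum _ _ (Br z)) scaler_sumr -big_split; apply: eq_bigr => i _.
  by rewrite scalerDr /= scalerA mulrC -scalerA.
- by rewrite linear0 wact0l freeLie_br0r scaler0 addr0.
- rewrite linearP wactPl IHx IHy freeLie_brPr; apply/pair_equal_spec.
  split; last by rewrite /= scaler0 addr0.
  by rewrite /= !scalerDr !scalerA [a * _]mulrC -!addrA; congr (_ + _); rewrite addrCA.
rewrite lie_embed_br -[_ - _]addrC wactDl wactNl {1}addnC !wactM; try exact: lie_embed_homog.
rewrite !(IHx, IHy) /= !mul0r !scale0r !addr0; apply/pair_equal_spec.
split; last by rewrite /= oppr0 addr0.
rewrite /= !freeLie_brDl !freeLie_brZl freeLie_leibniz (freeLie_brC x y) natrD mulrDr.
by rewrite scalerDl scalerN opprD opprK addrACA [- _ + _]addrC [(c * s%:R) *: _ + _]addrC.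
Qed.

Lemma lie_embed_inj d x : [pchar F] =i pred0 -> freeLie_homog d x -> lie_embed x = 0 -> x = 0.
Proof.
move=> charF0 hx x0; have := dynkin_lie_embed hx 0 1.
rewrite x0 wact0l freeLie_br0l add0r mul1r => /(congr1 fst)/= /esym/eqP.
case: d hx => [|d] hx; first by move=> _; apply: freeLie_homog0_eq0 hx _.
by rewrite scaler_eq0 (negPf (pchar0_natr_neq0 _ charF0)) => /eqP.
Qed.
End Dynkin.

Definition wtl_shuf_op (x : 'I_n) : shuf F 'I_n -> shuf F 'I_n := wtl x.
HB.instance Definition _ x :=
  GRing.isLinear.Build F (shuf F 'I_n) (shuf F 'I_n) _ (wtl_shuf_op x) (wtl_linear x).

(** Letters act as derivations by the very definition of the shuffle product, and commutators of
    derivations are derivations. *)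
Lemma lie_embed_derivation d x : freeLie_homog d x -> forall g h : shuf F 'I_n,
  wact wtl_shuf_op d (lie_embed x) (g * h) =
  wact wtl_shuf_op d (lie_embed x) g * h + g * wact wtl_shuf_op d (lie_embed x) h.
Proof.
elim=> {d x} [v|d|d a x y _ IHx _ IHy|r s x y hx IHx hy IHy] g h.
- rewrite lie_embed_gen !wact1_wgen mulr_suml mulr_sumr -big_split; apply: eq_bigr => i _.
  by rewrite -scalerAl -scalerAr -[RHS]scalerDr.
- by rewrite linear0 !wact0l mul0r mulr0 addr0.
- by rewrite linearP !wactPl IHx IHy mulrDl mulrDr -scalerAl -scalerAr scalerDr; ring.
have Exy q : wact wtl_shuf_op (r + s) (lie_embed x * lie_embed y) q =
    wact wtl_shuf_op s (lie_embed y) (wact wtl_shuf_op r (lie_embed x) q).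
  by rewrite wactM //; apply: lie_embed_homog.
have Eyx q : wact wtl_shuf_op (r + s) (lie_embed y * lie_embed x) q =
    wact wtl_shuf_op r (lie_embed x) (wact wtl_shuf_op s (lie_embed y) q).
  by rewrite addnC wactM //; apply: lie_embed_homog.
by rewrite lie_embed_br !wactDl !wactNl !Exy !Eyx IHx IHy !linearD /= !IHx !IHy; ring.
Qed.

End FreeLieEmbedding.

(** * Symmetrization *)
Section MpolyInduction.
Variables (F : fieldType) (m : nat).
Implicit Types (p q : {mpoly F[m]}) (a b : 'X_{1..m}).

Lemma mnm_gen_ind (P : 'X_{1..m} -> Prop) :
  P 0%MM -> (forall i a, P a -> P (U_(i) + a)%MM) -> forall a, P a.
Proof.
move=> P0 PS a; move: {2}(mdeg a) (leqnn (mdeg a)) => d.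
elim: d a => [|d IHd] a; first by rewrite leqn0 mdeg_eq0 => /eqP->.
have [->|a0] := eqVneq a 0%MM; first by [].
move=> ad; have [i ai] : exists i, a i != 0%N.
  apply/existsP; apply: contra_neqT a0 => /existsPn a0; apply/mnmP => i.
  by rewrite mnm0E; apply/eqP; have := a0 i; rewrite negbK.
have aE : (U_(i) + (a - U_(i)))%MM = a.
  by rewrite addmC submK //; apply/mnm_lepP => j; rewrite mnm1E; case: eqP => // <-; rewrite lt0n.
rewrite -aE; apply/PS/IHd; move: ad; rewrite -{1}aE mdegD mdeg1.
by rewrite add1n ltnS.
Qed.

Lemma mpoly_gen_ind (P : {mpoly F[m]} -> Prop) :
  (forall c p q, P p -> P q -> P (c *: p + q)) -> P 1 ->
  (forall i p, P p -> P ('X_i * p)) -> forall p, P p.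
Proof.
move=> PL P1 PX p.
have P0 : P 0 by have := PL (-1) 1 1 P1 P1; rewrite scaleN1r addNr.
rewrite [p]mpolyE; elim: (msupp p) => [|a s IHs]; rewrite ?big_nil // big_cons.
apply: PL => //; elim/mnm_gen_ind: a => [|i a IHa]; first by rewrite mpolyX0.
by rewrite mpolyXD; apply: PX.
Qed.

Lemma mderivXi i j : mderiv i 'X_j = if j == i then 1 else 0 :> {mpoly F[m]}.
Proof.
rewrite mderivX mnm1E; case: eqP => [->|]; last by rewrite scale0r.
by rewrite scale1r -{1}[U_(i)%MM]add0m addmK mpolyX0.
Qed.

Lemma mderiv_lsubst (A : 'M[F]_m) (lq := [tuple \sum_j A i j *: 'X_j | i < m]) j p :
  mderiv j (p \mPo lq) = \sum_i A i j *: (mderiv i p \mPo lq).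
Proof.
elim/mpoly_gen_ind: p => [c p q IHp IHq||i p IHp].
- rewrite comp_mpolyD comp_mpolyZ mderivD mderivZ IHp IHq scaler_sumr -big_split.
  apply: eq_bigr => i _; rewrite /= mderivD mderivZ comp_mpolyD comp_mpolyZ.
  by rewrite scalerDr !scalerA mulrC.
- rewrite comp_mpoly1 -[1]/(1%:MP) mderivC big1 // => i _.
  by rewrite mderivC comp_mpoly0 scaler0.
rewrite rmorphM /= mderivM IHp comp_mpolyXU -tnth_nth tnth_mktuple.
rewrite [RHS](eq_bigr (fun k => A k j *: ((mderiv k 'X_i \mPo lq) * (p \mPo lq)) +
    (\sum_l A i l *: 'X_l) * (A k j *: (mderiv k p \mPo lq)))); last first.
  move=> k _; rewrite mderivM linearD !rmorphM /= comp_mpolyXU -tnth_nth tnth_mktuple.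
  by rewrite scalerDr -scalerAr.
rewrite big_split /= -mulr_sumr; congr (_ + _).
rewrite linear_sum (bigD1 j) //= linearZ /= mderivXi eqxx big1 => [|k kj]; last first.
  by rewrite linearZ /= mderivXi (negPf kj) scaler0.
rewrite (bigD1 i) //= mderivXi eqxx comp_mpoly1 mul1r big1 => [|k ki]; last first.
  by rewrite mderivXi eq_sym (negPf ki) comp_mpoly0 mul0r scaler0.
by rewrite !addr0 -scalerAl mul1r.
Qed.

Variable wt : 'I_m -> nat.

Definition wdeg (a : 'X_{1..m}) : nat := \sum_i a i * wt i.
Lemma wdegD a b : wdeg (a + b) = (wdeg a + wdeg b)%N.
Proof. by rewrite -big_split; apply: eq_bigr => i _; rewrite mnmDE mulnDl. Qed.
Lemma wdeg0 : wdeg 0 = 0%N.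
Proof. by apply: big1 => i _; rewrite mnm0E. Qed.
Lemma wdeg1 i : wdeg U_(i) = wt i.
Proof.
rewrite /wdeg (bigD1 i) //= mnm1E eqxx mul1n big1 ?addn0 // => j ji.
by rewrite mnm1E eq_sym (negPf ji).
Qed.

Definition wpoly n p := forall a, p@_a != 0 -> wdeg a = n.

Lemma wpolyPl n c p q : wpoly n p -> wpoly n q -> wpoly n (c *: p + q).
Proof.
move=> hp hq a; rewrite mcoeffD mcoeffZ; have [->|/hp //] := eqVneq p@_a 0.
by rewrite mulr0 add0r => /hq.
Qed.
Lemma wpoly0 n : wpoly n 0. Proof. by move=> a; rewrite mcoeff0 eqxx. Qed.
Lemma wpolyX a : wpoly (wdeg a) 'X_[a].
Proof. by move=> b; rewrite mcoeffX; have [->|] := eqVneq a b; rewrite ?eqxx. Qed.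
Lemma wpolyC c : wpoly 0 c%:MP.
Proof.
move=> b; rewrite mcoeffC; have [->|] := eqVneq b 0%MM; first by rewrite wdeg0.
by rewrite mulr0 eqxx.
Qed.
Lemma wpoly_sum n I (r : seq I) (P : pred I) (E : I -> {mpoly F[m]}) :
  (forall i, P i -> wpoly n (E i)) -> wpoly n (\sum_(i <- r | P i) E i).
Proof.
move=> hE; elim/big_ind: _ => [|p q hp hq|//]; first exact: wpoly0.
by rewrite -[p]scale1r; apply: wpolyPl.
Qed.
Lemma wpolyM n1 n2 p q : wpoly n1 p -> wpoly n2 q -> wpoly (n1 + n2) (p * q).
Proof.
move=> hp hq; rewrite [p]mpolyE mulr_suml big_seq; apply: wpoly_sum => a pa.
rewrite [q]mpolyE mulr_sumr big_seq; apply: wpoly_sum => b qb.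
rewrite -scalerAl -scalerAr -mpolyXD -[_ *: _]addr0.
apply: wpolyPl; last exact: wpoly0.
rewrite -[_ *: _]addr0; apply: wpolyPl; last exact: wpoly0.
by rewrite -(hp a) -?(hq b) -?mcoeff_msupp // -wdegD; apply: wpolyX.
Qed.
Lemma wpoly_deriv n p j : wpoly n p -> wpoly (n - wt j) (mderiv j p).
Proof.
move=> hp a; rewrite mcoeff_deriv => paj.
rewrite -(hp (a + U_(j))%MM); first by rewrite wdegD wdeg1 addnK.
by apply: contraNneq paj => ->; rewrite mul0rn.
Qed.
Lemma wpoly_deriv_eq0 n p j : wpoly n p -> (n < wt j)%N -> mderiv j p = 0.
Proof.
move=> hp nj; apply/mpolyP => a; rewrite mcoeff0 mcoeff_deriv.
have [->|/hp] := eqVneq p@_(a + U_(j)) 0; first by rewrite mul0rn.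
by rewrite wdegD wdeg1 => E; rewrite -E ltnNge leq_addl in nj.
Qed.



End MpolyInduction.

Section Symmetrization.
Variables (F : fieldType) (charF0 : [pchar F] =i pred0) (X : finType) (m : nat).
Local Notation T := (conc F X).
Variables (y : 'I_m -> T) (wt : 'I_m -> nat).
Hypothesis hy : forall j, whomog (wt j) (y j).
Implicit Types (p q : {mpoly F[m]}) (a b : 'X_{1..m}).

(* The average of the products of k of the y_j over all orders, applied to the
   component of degree k of p; the recursion is Euler's identity
   k p = \sum_j 'X_j * mderiv j p. *)
Fixpoint sym k p : T :=
  if k is k'.+1 then (k%:R^-1 : F) *: \sum_j y j * sym k' (mderiv j p)
  else p@_0 *: 1.

Lemma symP k c p q : sym k (c *: p + q) = c *: sym k p + sym k q.
Proof.
elim: k p q => [|k IHk] p q /=.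
  by rewrite mcoeffD mcoeffZ scalerDl scalerA.
rewrite scalerA [c * _]mulrC -scalerA -scalerDr; congr (_ *: _).
rewrite scaler_sumr -big_split; apply: eq_bigr => j _ /=.
by rewrite mderivD mderivZ IHk mulrDr scalerAr.
Qed.
HB.instance Definition _ k :=
  GRing.isLinear.Build F {mpoly F[m]} T _ (sym k) (symP k).

Lemma sym_whomog k n p : wpoly wt n p -> whomog n (sym k p).
Proof.
elim: k n p => [|k IHk] n p hp /=.
  have [->|p0] := eqVneq p@_0 0; first by rewrite scale0r.
  by rewrite -(hp _ p0) wdeg0; apply: whomogZ; apply: whomog_one.
apply: whomogZ; apply: whomog_sum => j _.
case: (leqP (wt j) n) => jn.
  by rewrite -(subnKC jn); apply: whomogM => //; apply/IHk/wpoly_deriv.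
by rewrite (wpoly_deriv_eq0 hp jn) linear0 mulr0.
Qed.

Lemma sym_high k p : (forall a, mdeg a = k -> p@_a = 0) -> sym k p = 0.
Proof.
elim: k p => [|k IHk] p hp /=; first by rewrite hp ?scale0r ?mdeg0.
rewrite big1 ?scaler0 // => j _; rewrite IHk ?mulr0 // => a ak.
by rewrite mcoeff_deriv hp ?mul0rn // mdegD mdeg1 ak addn1.
Qed.

(** In the recursion, the chain rule [mderiv_lsubst] moves the coefficients of W from the factors y
    j to the derivatives. With W the matrix of a group element this is the equivariance of
    symmetrization. *)
Lemma sym_subst (A : X -> X -> F) (W : 'M[F]_m) k p :
  (forall i, wsub A (y i) = \sum_j W i j *: y j) ->
  wsub A (sym k p) = sym k (p \mPo [tuple \sum_j W i j *: 'X_j | i < m]).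
Proof.
move=> hA; elim: k p => [|k IHk] p.
  rewrite /= wsubZ wsub1.
  suff -> : (p \mPo [tuple \sum_j W i j *: 'X_j | i < m])@_0 = p@_0 by [].
  elim/mpoly_gen_ind: p => [c p q IHp IHq||i p _].
  - by rewrite comp_mpolyD comp_mpolyZ !(mcoeffD, mcoeffZ) IHp IHq.
  - by rewrite comp_mpoly1.
  rewrite !rmorphM /= comp_mpolyXU -tnth_nth tnth_mktuple linear_sum /=.
  rewrite mcoeffX mnm1_eq0 mul0r big1 ?mul0r // => j _.
  by rewrite mcoeffZ mcoeffX mnm1_eq0 mulr0.
set lq := [tuple _ | i < m] in IHk *.
suff E : wsub A (\sum_j y j * sym k (mderiv j p)) =
    (\sum_j y j * sym k (mderiv j (p \mPo lq)) : T) by rewrite /= wsubZ E.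
rewrite wsub_sum.
under eq_bigr => j _ do rewrite wsubM hA IHk mulr_suml.
rewrite exchange_big; apply: eq_bigr => j _ /=.
rewrite mderiv_lsubst linear_sum mulr_sumr; apply: eq_bigr => i _ /=.
by rewrite linearZ /= -scalerAl scalerAr.
Qed.

(** * Surjectivity of symmetrization *)

Section Surjectivity.
Variable N : nat.

(** In the application y is a basis of the Lie components of degree at most N only, so commutators
    stay in the span as long as the total degree does not exceed N. *)
Definition lspan d (z : T) := exists c : 'I_m -> F,
  (forall j, c j != 0 -> wt j = d) /\ z = \sum_j c j *: y j.

Hypothesis lspan_comm : forall d e z w, (d + e <= N)%N ->
  lspan d z -> lspan e w -> lspan (d + e) (z * w - w * z).

Lemma lspan_gen j : lspan (wt j) (y j).
Proof.
exists (fun i => (i == j)%:R); split=> [i|].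
  by have [->|] := eqVneq i j; rewrite ?eqxx.
rewrite (bigD1 j) //= eqxx scale1r big1 ?addr0 // => i /negPf->.
by rewrite scale0r.
Qed.

Definition hpoly k p := forall a, p@_a != 0 -> mdeg a = k.

(** The filtration by number of factors: at most k of them, in tensor degree n. Closure under linear
    combinations lets error terms be collected without naming the polynomials behind them. *)
Inductive symspan k n : T -> Prop :=
| symspan0 : symspan k n 0
| symspan_sym l p : (l <= k)%N -> hpoly l p -> wpoly wt n p -> symspan k n (sym l p)
| symspan_lin c f g : symspan k n f -> symspan k n g -> symspan k n (c *: f + g).

Lemma symspanZ k n c f : symspan k n f -> symspan k n (c *: f).
Proof. by move=> hf; rewrite -[_ *: _]addr0; apply: symspan_lin => //; apply: symspan0. Qed.
Lemma symspanD k n f g : symspan k n f -> symspan k n g -> symspan k n (f + g).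
Proof. by move=> hf hg; rewrite -[f]scale1r; apply: symspan_lin. Qed.
Lemma symspan_sum k n I (r : seq I) (E : I -> T) :
  (forall i, symspan k n (E i)) -> symspan k n (\sum_(i <- r) E i).
Proof.
by move=> hE; elim/big_ind: _ => [|f g|//]; [apply: symspan0 | apply: symspanD].
Qed.
Lemma symspan_mono k l n f : (k <= l)%N -> symspan k n f -> symspan l n f.
Proof.
move=> kl; elim=> [|i p ik|c f' g _ hf _ hg]; first exact: symspan0.
  by apply: symspan_sym; apply: leq_trans kl.
exact: symspan_lin.
Qed.

Lemma hpolyM k l p q : hpoly k p -> hpoly l q -> hpoly (k + l) (p * q).
Proof.
have wd a : wdeg (fun=> 1%N) a = mdeg a.
  by rewrite mdegE; apply: eq_bigr => i _; rewrite muln1.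
move=> hp hq a; rewrite -wd; apply: (@wpolyM _ _ (fun=> 1%N)) => b.
  by rewrite wd; apply: hp.
by rewrite wd; apply: hq.
Qed.
Lemma hpoly_deriv k p j : hpoly k.+1 p -> hpoly k (mderiv j p).
Proof.
move=> hp a; rewrite mcoeff_deriv => paj; apply: succn_inj.
rewrite -(hp (a + U_(j))%MM); first by rewrite mdegD mdeg1 addn1.
by apply: contraNneq paj => ->; rewrite mul0rn.
Qed.

(* Multiplying by z commutes with symmetrization up to fewer factors, since
   moving z past a y_j costs a commutator, which is again in the span of the y_i. *)
Let shifts k := forall n d p z (c : 'I_m -> F), (d + n <= N)%N ->
  (forall j, c j != 0 -> wt j = d) -> z = \sum_j c j *: y j ->
  hpoly k p -> wpoly wt n p ->
  symspan k (d + n) (sym k.+1 ((\sum_j c j *: 'X_j) * p) - z * sym k p).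

Lemma lform_wpoly d (c : 'I_m -> F) :
  (forall j, c j != 0 -> wt j = d) -> wpoly wt d (\sum_j c j *: 'X_j).
Proof.
move=> hc; apply: wpoly_sum => j _; have [->|cj] := eqVneq (c j) 0.
  by rewrite scale0r; apply: wpoly0.
rewrite -[_ *: _]addr0; apply: wpolyPl; last exact: wpoly0.
by rewrite -(hc _ cj) -wdeg1; apply: wpolyX.
Qed.
Lemma lform_hpoly (c : 'I_m -> F) : hpoly 1 (\sum_j c j *: 'X_j).
Proof.
move=> a; rewrite linear_sum /=; apply: contra_neq_eq => a1; apply: big1 => j _.
rewrite mcoeffZ mcoeffX; case: eqP => [E|]; last by rewrite mulr0.
by rewrite -E mdeg1 eqxx in a1.
Qed.

(** Up to at most l factors, z * sym l p is [sym l.+1] of a polynomial. [shifts] is a premise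
    because the lemma is used inside the induction that establishes it. *)
Lemma symspan_mul k n d f z : (forall l, (l <= k)%N -> shifts l) -> (d + n <= N)%N ->
  symspan k n f -> lspan d z -> symspan k.+1 (d + n) (z * f).
Proof.
move=> hk dn hf [c [hc zE]]; elim: hf => [|l p lk hl hw|b g h _ IHg _ IHh].
- by rewrite mulr0; apply: symspan0.
- rewrite -[z * _](subKr (sym l.+1 ((\sum_j c j *: 'X_j) * p))) addrC -scaleN1r.
  apply: symspan_lin.
    by apply: (symspan_mono (leqW lk)); apply: hk.
  apply: symspan_sym => //; first by rewrite -add1n; apply: hpolyM => //; apply: lform_hpoly.
  by apply: wpolyM => //; apply: lform_wpoly.
by rewrite mulrDr -scalerAr; apply: symspan_lin.
Qed.

(** With l the linear form of z, Euler's recursion makes [sym k.+1 (l * p)] the average of z * sym k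
    p and the sum of the y j * sym k (l * mderiv j p), with denominator k.+1. By induction z can be
    pulled out of the latter, and exchanging it with y j costs a commutator. The sum then equals k
    copies of z * sym k p up to fewer factors, so k.+1 copies appear in all. *)
Lemma sym_shift k : shifts k.
Proof.
elim/ltn_ind: k => k IHk n d p z c dn hc zE hp hw.
set l := \sum_j c j *: 'X_j.
have dl j : mderiv j l = (c j)%:MP.
  rewrite /l linear_sum (bigD1 j) //= linearZ /= mderivXi eqxx big1 => [|i ij].
    by rewrite addr0 -mul_mpolyC mulr1.
  by rewrite linearZ /= mderivXi (negPf ij) scaler0.
have symS : sym k.+1 (l * p) =
    (k.+1%:R^-1 : F) *: (z * sym k p + \sum_j y j * sym k (l * mderiv j p)).
  rewrite [LHS]/=; congr (_ *: _).
  transitivity (\sum_j ((c j *: y j) * sym k p + y j * sym k (l * mderiv j p))).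
    2: by rewrite big_split zE mulr_suml.
  apply: eq_bigr => j _ /=; rewrite mderivM dl mul_mpolyC symP mulrDr.
  by rewrite -scalerAl scalerAr.
suff [R [hR RE]] : exists R, symspan k (d + n) R /\
    \sum_j y j * sym k (l * mderiv j p) = z * (k%:R *: sym k p) + R.
  have kn0 := pchar0_natr_neq0 k charF0.
  rewrite symS RE addrA -scalerAr -{1}[z * _]scale1r -scalerDl scalerDr.
  rewrite scalerA -[1]/(1%:R) -natrD add1n mulVf // scale1r [X in X - _]addrC addrK.
  exact: symspanZ.
case: k IHk hp {symS} => [|k] IHk hp.
  exists 0; split; first exact: symspan0.
  rewrite scale0r mulr0 addr0 big1 // => j _.
  suff -> : mderiv j p = 0 by rewrite mulr0 linear0 mulr0.
  apply/mpolyP => a; rewrite mcoeff0 mcoeff_deriv.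
  have [->|/hp] := eqVneq p@_(a + U_(j)) 0; first by rewrite mul0rn.
  by rewrite mdegD mdeg1 addn1.
(* The error of the inductive hypothesis at [mderiv j p]. The commutator in the witness below is the
   cost of moving z to the front. *)
pose r j := sym k.+1 (l * mderiv j p) - z * sym k (mderiv j p).
exists (\sum_j (y j * r j + (y j * z - z * y j) * sym k (mderiv j p))).
split; last first.
  have -> : k.+1%:R *: sym k.+1 p = \sum_j y j * sym k (mderiv j p).
    by rewrite /= scalerA divff ?pchar0_natr_neq0 // scale1r.
  rewrite mulr_sumr -big_split.
  have E (a u v : T) : a = u + a - v + v - u by rewrite subrK addrC addKr.
  apply: eq_bigr => j _; transitivity (z * (y j * sym k (mderiv j p)) +
    (y j * r j + (y j * z - z * y j) * sym k (mderiv j p))); last by [].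
  rewrite /r mulrBr mulrBl !mulrA !addrA.
  apply: E.
apply: symspan_sum => j; case: (leqP (wt j) n) => jn; last first.
  by rewrite /r (wpoly_deriv_eq0 hw jn) !(mulr0, linear0, addr0); apply: symspan0.
(* The weight of y j is taken out of n, so every product keeps total degree d + n and stays within
   N. *)
have E : (d + n = wt j + (d + (n - wt j)))%N by rewrite addnCA subnKC.
have hpj := hpoly_deriv (j := j) hp; have hwj := wpoly_deriv (j := j) hw.
apply: symspanD.
  rewrite E; apply: symspan_mul; first by move=> i ik; apply: IHk.
  - by rewrite -E.
  - apply: IHk => //; apply: leq_trans dn; by rewrite leq_add2l leq_subr.
  exact: lspan_gen.
rewrite E addnA; apply: symspan_mul; first by move=> i ik; apply: IHk.
- by rewrite -addnA -E.
- exact: symspan_sym.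
apply: lspan_comm; last by exists c.
  by apply: leq_trans dn; rewrite addnC leq_add2l.
exact: lspan_gen.
Qed.

End Surjectivity.
End Symmetrization.

Lemma whomogS_decomp (F : fieldType) n (f : conc F 'I_n) k : whomog k.+1 f ->
  f = \sum_x wgen (delta_mx 0 x) * (wtl x f : conc F 'I_n).
Proof.
move=> hf; apply: funext => -[|x w]; rewrite wordfun_sum.
  by rewrite big1 ?(whomog_nil hf) // => x _; exact: mul0r.
have wtl_gen j : wtl x (wgen (delta_mx 0 j)) = (x == j)%:R *: (1 : conc F 'I_n).
  apply: funext => -[|i u]; rewrite wordfunZ.
      by rewrite -[X in _ * X]/(1 : F) mulr1 /wtl /= mxE eqxx.
    by rewrite -[X in _ * X]/(0 : F) mulr0.
under eq_bigr => j _.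
  rewrite -[(_ * _ : conc _ _) _]/(wtl x (wgen (delta_mx 0 j) * (wtl j f : conc F 'I_n)) w).
  rewrite wtl_concM wtl_gen /= scale0r addr0 -scalerAl mul1r.
  over.
rewrite (bigD1 x) //= eqxx scale1r big1 ?addr0 // => j /negPf jx.
by rewrite eq_sym jx scale0r.
Qed.

Section SymTotal.
Variables (F : fieldType) (charF0 : [pchar F] =i pred0) (n m : nat).
Local Notation T := (conc F 'I_n).
Variables (y : 'I_m -> T) (wt : 'I_m -> nat).
Hypothesis hy : forall j, whomog (wt j) (y j).
Hypothesis wt_gt0 : forall j, (0 < wt j)%N.

Lemma mdeg_le_wdeg a : (mdeg a <= wdeg wt a)%N.
Proof.
by rewrite mdegE; apply: leq_sum => i _; rewrite -{1}[a i]muln1 leq_mul2l wt_gt0 orbT.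
Qed.

(** Polynomials of a given weight mix different numbers of factors, so all numbers l up to k are
    summed. Since weights are positive, k = d is enough in weight d. *)
Definition symt k (p : {mpoly F[m]}) : T := \sum_(l < k.+1) sym y l p.

Lemma symtP k c p q : symt k (c *: p + q) = c *: symt k p + symt k q.
Proof.
by rewrite /symt scaler_sumr -big_split; apply: eq_bigr => l _; rewrite symP.
Qed.

Lemma symt_whomog k d p : wpoly wt d p -> whomog d (symt k p).
Proof. by move=> hp; apply: whomog_sum => l _; apply: sym_whomog. Qed.

Lemma symspan_symt k d f : symspan y wt k d f ->
  exists p, wpoly wt d p /\ f = symt d p.
Proof.
have sym0 l : sym y l 0 = 0 by rewrite linear0.
elim=> [|l p _ hl hw|c f1 f2 _ [p1 [h1 ->]] _ [p2 [h2 ->]]]; last first.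
  by exists (c *: p1 + p2); rewrite symtP; split=> //; apply: wpolyPl.
(* With positive weights no monomial of weight d has more than d factors, so [sym l p] is 0 for l >
   d. *)
- case: (leqP l d) => ld; last first.
    exists 0; split; first exact: wpoly0.
    rewrite sym_high ?/symt ?big1 // => a al; apply: contraTeq ld => /hw <-.
    by rewrite -leqNgt -al mdeg_le_wdeg.
  exists p; split=> //; rewrite /symt (bigD1 (inord l)) //= inordK // big1 ?addr0 // => i.
  rewrite -val_eqE /= inordK // => il; apply: sym_high => a ai.
  by apply: contraNeq il => /hl <-; rewrite ai.
exists 0; split; first exact: wpoly0.
by rewrite /symt big1.
Qed.

(** Tensors are built by left multiplication with one letter at a time, and [symspan_mul] absorbs
    each letter. Letters are required in the span only for 0 < N: at N = 0 the family of the
    application is empty. *)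
Lemma symt_surj N d f :
  (forall d e z w, (d + e <= N)%N ->
    lspan y wt d z -> lspan y wt e w -> lspan y wt (d + e) (z * w - w * z)) ->
  (forall x, (0 < N)%N -> lspan y wt 1 (wgen (delta_mx 0 x))) ->
  (d <= N)%N -> whomog d f -> exists p, wpoly wt d p /\ f = symt d p.
Proof.
move=> hcomm hgen dN hf; apply: (@symspan_symt d).
elim: d f dN hf => [|d IHd] f dN hf.
  have -> : f = sym y 0 (f [::])%:MP.
    rewrite /= mcoeffC eqxx mulr1; apply: funext => -[|x w].
      by rewrite wordfunZ /= mulr1.
    by rewrite wordfunZ mulr0 hf.
  apply: symspan_sym => //; last exact: wpolyC.
  move=> a; rewrite mcoeffC; have [->|] := eqVneq a 0%MM; first by rewrite mdeg0.
  by rewrite mulr0 eqxx.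
rewrite (whomogS_decomp hf); apply: symspan_sum => x; rewrite -add1n.
apply: (symspan_mul (N := N)) => //.
- by move=> l _; apply: sym_shift.
- by apply: IHd; [apply: ltnW | apply: whomog_tl].
by apply: hgen; apply: leq_trans dN.
Qed.

End SymTotal.

(** * Injectivity of symmetrization by pairing with shuffle products *)

Section SymInjective.
Variables (F : fieldType) (charF0 : [pchar F] =i pred0) (n m : nat).
Local Notation T := (conc F 'I_n).
Local Notation B := (shuf F 'I_n).
Variables (y : 'I_m -> T) (wt : 'I_m -> nat).
Hypothesis hy : forall j, whomog (wt j) (y j).
Local Notation act := (wact (@wtl_shuf_op F n)).
Hypothesis hD : forall j (g h : B),
  act (wt j) (y j) (g * h) = act (wt j) (y j) g * h + g * act (wt j) (y j) h.
Variable xi : 'I_m -> B.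
Hypothesis xi0 : forall j, xi j [::] = 0.
Hypothesis xi_dual : forall i j, act (wt j) (y j) (xi i) [::] = (i == j)%:R.

Definition lact j (g : B) : B := act (wt j) (y j) g.
Local Notation D := lact.
Lemma lactP j c (g h : B) : D j (c *: g + h) = c *: D j g + D j h.
Proof. exact: wact_linear. Qed.
Lemma lact0 j : D j 0 = 0.
Proof. exact: linear_fun0 (lactP j). Qed.
Lemma lactD j (g h : B) : D j (g + h) = D j g + D j h.
Proof. by rewrite -[g]scale1r lactP !scale1r. Qed.
Lemma lactM j (g h : B) : D j (g * h) = D j g * h + g * D j h.
Proof. exact: hD. Qed.

Lemma lact_xi i j : D j (xi i) [::] = (i == j)%:R.
Proof. exact: xi_dual. Qed.

(* The powers of the augmentation ideal of the shuffle algebra. A derivation lowers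
   the exponent by at most one, so k of them send power k+1 into the ideal: this
   makes the pairing between sym k p and products of k of the xi_j triangular. *)
Inductive augpow : nat -> B -> Prop :=
| augpow0 (g : B) : augpow 0 g
| augpow_zero k : augpow k 0
| augpowD k (g h : B) : augpow k g -> augpow k h -> augpow k (g + h)
| augpowM k (g h : B) : g [::] = 0 -> augpow k h -> augpow k.+1 (g * h).

Lemma augpow_sum k I (r : seq I) (E : I -> B) :
  (forall i, augpow k (E i)) -> augpow k (\sum_(i <- r) E i).
Proof.
by move=> hE; elim/big_ind: _ => [|f g|//]; [apply: augpow_zero | apply: augpowD].
Qed.

Lemma augpow_nil k g : augpow k.+1 g -> g [::] = 0.
Proof.
move E: k.+1 => k' h; elim: h E => {k' g} [g|k'|k' g h _ IHg _ IHh E|k' g h g0 _ _ _] //.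
  by rewrite wordfunD IHg // IHh // addr0.
by rewrite -[LHS]/(g [::] * h [::]) g0 mul0r.
Qed.

Lemma augpow_mull k (c : B) g : augpow k g -> augpow k (c * g).
Proof.
elim=> {k g} [g|k|k g h _ IHg _ IHh|k g h g0 hh IHh].
- exact: augpow0.
- by rewrite mulr0; apply: augpow_zero.
- by rewrite mulrDr; apply: augpowD.
by rewrite mulrCA; apply: augpowM.
Qed.

Lemma augpow_pred k g : augpow k.+1 g -> augpow k g.
Proof.
move E: k.+1 => k' h.
elim: h k E => {k' g} [g|k'|k' g h _ IHg _ IHh|k' g h g0 hh _] k E //.
- exact: augpow_zero.
- by apply: augpowD; [apply: IHg | apply: IHh].
by case: E => ->; apply: augpow_mull.
Qed.

Lemma augpow_le k l g : (k <= l)%N -> augpow l g -> augpow k g.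
Proof.
by move/subnK<-; elim: (l - k)%N => // d IHd /augpow_pred.
Qed.

Lemma augpow_D k j g : augpow k.+1 g -> augpow k (D j g).
Proof.
move E: k.+1 => k' h.
elim: h k E => {k' g} [g|k'|k' g h _ IHg _ IHh|k' g h g0 hh IHh] k E //.
- by rewrite lact0; apply: augpow_zero.
- by rewrite lactD; apply: augpowD; [apply: IHg | apply: IHh].
case: E => E; rewrite -E in hh IHh; rewrite lactM; apply: augpowD; first exact: augpow_mull.
case: k hh IHh {E} => [|k] hh IHh; first exact: augpow0.
by apply: augpowM => //; apply: IHh.
Qed.

(** Shuffle monomials in the [xi i]: the test functions on which symmetrized polynomials are
    evaluated. *)
Definition theta : {mpoly F[m]} -> B := mmap (GRing.in_alg B) xi.

Lemma thetaP c p q : theta (c *: p + q) = c *: theta p + theta q.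
Proof. by rewrite /theta mmapD mmapZ /= -scalerAl mul1r. Qed.
Lemma theta1 : theta 1 = 1.
Proof. by rewrite /theta rmorph1. Qed.
Lemma thetaXM i p : theta ('X_i * p) = xi i * theta p.
Proof. by rewrite /theta rmorphM /= mmapX mmap1U. Qed.
Lemma theta0 : theta 0 = 0.
Proof. by have := thetaP (-1) 0 0; rewrite scaler0 addr0 scaleN1r addNr. Qed.
Lemma thetaZ c p : theta (c *: p) = c *: theta p.
Proof. by rewrite -[c *: p]addr0 thetaP theta0 addr0. Qed.

(** The chain rule for the derivation [D j]. Its coefficients D j (xi i) are known only at the empty
    word, that is modulo the augmentation ideal, so the pairing becomes triangular rather than
    diagonal. *)
Lemma D_theta j q : D j (theta q) = \sum_i D j (xi i) * theta (mderiv i q).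
Proof.
elim/mpoly_gen_ind: q => [c p q IHp IHq||i p IHp].
- rewrite thetaP lactP IHp IHq scaler_sumr -big_split; apply: eq_bigr => i _ /=.
  by rewrite mderivD mderivZ thetaP mulrDr scalerAr.
- have : D j (1 : B) = 0.
    have /eqP := lactM j 1 1; rewrite !mulr1 mul1r -{1}[D j 1]addr0 (inj_eq (addrI _)).
    by rewrite eq_sym => /eqP.
  rewrite theta1 => ->; rewrite big1 // => i _.
  by rewrite -[1]/(1%:MP) mderivC theta0 mulr0.
rewrite thetaXM lactM IHp.
rewrite [RHS](eq_bigr (fun k => D j (xi k) * theta ((if i == k then 1 else 0) * p) +
   xi i * (D j (xi k) * theta (mderiv k p)))); last first.
  move=> k _; rewrite mderivM mderivXi -[X in theta X]scale1r scalerDr thetaP !scale1r.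
  by rewrite thetaXM mulrDr mulrCA.
rewrite big_split /=; congr (_ + _); last by rewrite mulr_sumr.
rewrite (bigD1 i) //= eqxx mul1r [X in _ + X]big1 ?addr0 // => k ki.
by rewrite eq_sym (negPf ki) mul0r theta0 mulr0.
Qed.

Lemma theta_augpow a : augpow (mdeg a) (theta 'X_[a]).
Proof.
elim/mnm_gen_ind: a => [|i a IHa]; first by rewrite mdeg0; apply: augpow0.
by rewrite mdegD mdeg1 mpolyXD thetaXM; apply: augpowM.
Qed.

Lemma symS_act l d p g : wpoly wt d p ->
  act d (sym y l.+1 p) g =
  (l.+1%:R^-1 : F) *: \sum_j act (d - wt j) (sym y l (mderiv j p)) (D j g).
Proof.
move=> hp; rewrite [sym _ _ _]/= wactZl wact_suml; congr (_ *: _).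
apply: eq_bigr => j _; case: (leqP (wt j) d) => jd.
  by rewrite -{1}(subnKC jd) wactM.
by rewrite (wpoly_deriv_eq0 hp jd) linear0 mulr0 !wact0l.
Qed.

Lemma sym_act_augpow l d p g : wpoly wt d p -> augpow l.+1 g ->
  act d (sym y l p) g [::] = 0.
Proof.
elim: l d p g => [|l IHl] d p g hp hg.
  have [p0|/hp] := eqVneq p@_0 0; first by rewrite /= p0 scale0r wact0l.
  rewrite wdeg0 => <-; rewrite -[LHS]/((p@_0 * 1) * g [::]).
  by rewrite (augpow_nil hg) mulr0.
rewrite symS_act // wordfunZ wordfun_sum big1 ?mulr0 // => j _.
by apply: IHl; [apply: wpoly_deriv | apply: augpow_D].
Qed.

Definition mfact (a : 'X_{1..m}) : nat := \prod_i (a i)`!.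

Lemma mfact_pred (a : 'X_{1..m}) j : a j != 0%N -> (a j * mfact (a - U_(j)))%N = mfact a.
Proof.
move=> aj; rewrite /mfact (bigD1 j) //= [RHS](bigD1 j) //= mulnA.
rewrite mnmBE mnm1E eqxx subn1; congr (_ * _)%N.
  by case: (a j) aj => // k _; rewrite factS.
by apply: eq_bigr => i ij; rewrite mnmBE mnm1E eq_sym (negPf ij) subn0.
Qed.

Lemma mdeg_pred l (a : 'X_{1..m}) i : a i != 0%N -> mdeg a = l.+1 -> mdeg (a - U_(i)) = l.
Proof.
move=> ai; have {1}<- : (a - U_(i) + U_(i))%MM = a.
  by apply: submK; apply/mnm_lepP => j; rewrite mnm1E; case: eqP => // <-; rewrite lt0n.
by rewrite mdegD mdeg1 addn1 => -[].
Qed.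

(** Modulo a higher augmentation power, [D j] acts on theta as [mderiv j], because D j (xi i) - (i
    == j)%:R vanishes at the empty word. This leaves the pairing of constant-coefficient
    differential operators with monomials, whence the product of factorials. *)
Lemma sym_act_theta l d p a : wpoly wt d p -> mdeg a = l ->
  act d (sym y l p) (theta 'X_[a]) [::] = (mfact a)%:R * p@_a.
Proof.
elim: l d p a => [|l IHl] d p a hp al.
  have {al}-> : a = 0%MM by apply/eqP; rewrite -mdeg_eq0 al.
  rewrite mpolyX0 theta1 /mfact big1 ?mul1r => [|i _]; last by rewrite mnm0E.
  have [p0|/hp] := eqVneq p@_0 0; first by rewrite /= p0 scale0r wact0l.
  by rewrite wdeg0 => <-; rewrite -[LHS]/((p@_0 * 1) * 1) !mulr1.
rewrite symS_act // wordfunZ wordfun_sum.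
have step j : act (d - wt j) (sym y l (mderiv j p)) (D j (theta 'X_[a])) [::] =
    (mfact a)%:R * p@_a * (a j)%:R.
  (* The correction sum lies in augmentation power l.+1, which l derivations cannot bring out of the
     ideal. *)
  have -> : D j (theta 'X_[a]) = theta (mderiv j 'X_[a]) +
      \sum_i (D j (xi i) - (i == j)%:R) * theta (mderiv i 'X_[a]).
    rewrite D_theta (bigD1 j) //= [in RHS](bigD1 j) //= eqxx mulrBl mul1r.
    rewrite addrA [X in _ = X + _]addrC subrK; congr (_ + _).
    by apply: eq_bigr => i /negPf->; rewrite subr0.
  rewrite wactDr wordfunD [X in _ + X]sym_act_augpow ?addr0 //; last first.
    apply: augpow_sum => i; apply: augpowM.
      rewrite wordfunD lact_xi wordfunN; case: (i == j).
        by rewrite -[X in _ - X]/(1 : F) subrr.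
      by rewrite -[X in _ - X]/(0 : F) subrr.
    rewrite mderivX thetaZ; have [->|ai] := eqVneq (a i) 0%N.
      by rewrite scale0r; apply: augpow_zero.
    rewrite -mulr_algl; apply: augpow_mull.
    by rewrite -(mdeg_pred ai al); apply: theta_augpow.
    exact: wpoly_deriv.
  rewrite mderivX thetaZ wactZr wordfunZ.
  have [->|aj] := eqVneq (a j) 0%N; first by rewrite mul0r mulr0.
  rewrite IHl; [|exact: wpoly_deriv|exact: mdeg_pred].
  have aE : (a - U_(j) + U_(j))%MM = a.
    by apply: submK; apply/mnm_lepP => i; rewrite mnm1E; case: eqP => // <-; rewrite lt0n.
  rewrite mcoeff_deriv aE -(mfact_pred aj) natrM mnmBE mnm1E eqxx subn1.
  by rewrite prednK ?lt0n // -mulr_natr; ring.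
(* The exponents a j add up to the degree l.+1, which cancels the denominator of the average. *)
rewrite (eq_bigr _ (fun j _ => step j)) -mulr_sumr -natr_sum -mdegE al mulrCA.
by rewrite mulVf ?mulr1 // pchar0_natr_neq0.
Qed.

(** Downward induction on the degree of a. Components with more factors than mdeg a vanish by
    induction, those with fewer kill theta 'X_[a], and the remaining one pairs to mfact a times the
    coefficient of p at a. *)
Lemma symt_inj k d p : wpoly wt d p -> (forall a, p@_a != 0 -> (mdeg a <= k)%N) ->
  symt y k p = 0 -> p = 0.
Proof.
move=> hp hk p0.
suff H i : forall a, (k.+1 <= mdeg a + i)%N -> p@_a = 0.
  by apply/mpolyP => a; rewrite mcoeff0; apply: (H k.+1); rewrite leq_addl.
elim: i => [|i IHi] a.
  rewrite addn0 => ka; apply: contraTeq ka => /hk; by rewrite -leqNgt.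
rewrite addnS ltnS leq_eqVlt => /orP[/eqP E|]; last exact: IHi.
have hh l : (mdeg a < l)%N -> sym y l p = 0.
  move=> al; apply: sym_high => b bl; apply: IHi; rewrite E bl.
  by rewrite ltn_add2r.
have := congr1 (fun f => act d f (theta 'X_[a]) [::]) p0.
rewrite wact0l /symt wact_suml wordfun_sum.
have ak : (mdeg a < k.+1)%N by rewrite ltnS E leq_addr.
rewrite (bigD1 (Ordinal ak)) //= sym_act_theta // big1 ?addr0 => [|l]; last first.
  rewrite -val_eqE /= neq_ltn => /orP[la|al]; last by rewrite hh // wact0l.
  by apply: sym_act_augpow => //; apply: augpow_le la (theta_augpow a).
move/eqP; rewrite mulf_eq0 => /orP[|/eqP //].
have [k' ->] : exists k', mfact a = k'.+1.
  exists (mfact a).-1; rewrite prednK // prodn_gt0 // => j; exact: fact_gt0.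
by rewrite (negPf (pchar0_natr_neq0 _ charF0)).
Qed.

End SymInjective.

(** * Modules afforded by subspaces *)
Lemma sum_mxtens (M : nmodType) m n (f : 'I_(m * n) -> M) :
  \sum_i f i = \sum_i \sum_j f (mxtens_index (i, j)).
Proof.
rewrite pair_bigA /= (reindex (@mxtens_index m n)) /=; last first.
  by exists (@mxtens_unindex m n) => i _; rewrite ?mxtens_indexK ?mxtens_unindexK.
by apply: eq_bigr => -[].
Qed.

Section LinearCombinations.
Variables (F : fieldType) (M : lmodType F).

Definition linfree k (u : 'I_k -> M) :=
  forall c : 'rV[F]_k, \sum_i c 0 i *: u i = 0 -> c = 0.

Lemma linfree_fun k (u : 'I_k -> M) (c : 'I_k -> F) :
  linfree u -> \sum_i c i *: u i = 0 -> forall i, c i = 0.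
Proof.
move=> fu cu i; have /fu/rowP/(_ i) : \sum_i (\row_i c i) 0 i *: u i = 0.
  by rewrite -[RHS]cu; apply: eq_bigr => j _; rewrite mxE.
by rewrite !mxE.
Qed.

Lemma linfree_inj k (u : 'I_k -> M) (c d : 'I_k -> F) :
  linfree u -> \sum_i c i *: u i = \sum_i d i *: u i -> c =1 d.
Proof.
move=> fu cd i; apply/eqP; rewrite -subr_eq0; apply/eqP.
apply: (linfree_fun (c := fun i => c i - d i) fu).
by under eq_bigr do rewrite scalerBl; rewrite sumrB cd subrr.
Qed.
End LinearCombinations.

Section Affords.
Variables (G : groupType) (F : fieldType).
Implicit Types A B : fgmod G F.

Lemma affords_eq (M : lmodType F) (act : G -> M -> M) (P Q : M -> Prop) A :
  (forall x, P x <-> Q x) -> affords A act P -> affords A act Q.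
Proof. by move=> PQ [u [fu Pu au]]; exists u; split=> // x; rewrite -PQ. Qed.

(** The matrices are those of phi and of its inverse in the two bases. The ambient spaces may be
    infinite-dimensional, and injectivity and equivariance of phi are asked on P only. *)
Lemma affords_iso (M M' : lmodType F) (act : G -> M -> M) (act' : G -> M' -> M')
    (P : M -> Prop) (P' : M' -> Prop) (phi : M -> M') A B :
  affords A act P -> affords B act' P' ->
  linear phi -> (forall g, linear (act' g)) ->
  (forall x, P x -> phi x = 0 -> x = 0) ->
  (forall x, P' x <-> exists2 z, P z & x = phi z) ->
  (forall g x, P x -> phi (act g x) = act' g (phi x)) -> fgiso A B.
Proof.
move=> [u [fu Pu au]] [v [fv Pv av]] phiL actL phi_inj phi_im phi_act.
have Puc (c : 'rV_(fgdim A)) : P (\sum_i c 0 i *: u i) by apply/Pu; exists c.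
have Pui i : P (u i).
  apply/Pu; exists (\row_j (j == i)%:R); rewrite (bigD1 i) //= mxE eqxx scale1r.
  by rewrite big1 ?addr0 // => j /negPf ji; rewrite mxE ji scale0r.
have Pvi i : P' (v i).
  apply/Pv; exists (\row_j (j == i)%:R); rewrite (bigD1 i) //= mxE eqxx scale1r.
  by rewrite big1 ?addr0 // => j /negPf ji; rewrite mxE ji scale0r.
have ex_p i : exists c : 'rV_(fgdim B), phi (u i) = \sum_j c 0 j *: v j.
  by apply/Pv/phi_im; exists (u i).
have ex_q i : exists c : 'rV_(fgdim A), v i = phi (\sum_j c 0 j *: u j).
  by have /phi_im[z /Pu[c ->] ->] := Pvi i; exists c.
pose p := \matrix_(i, j) sval (cid (ex_p i)) 0 j.
pose q := \matrix_(i, j) sval (cid (ex_q i)) 0 j.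
have pE i : phi (u i) = \sum_j p i j *: v j.
  by rewrite [LHS](svalP (cid (ex_p i))); apply: eq_bigr => j _; rewrite mxE.
have qE i : v i = \sum_j q i j *: phi (u j).
  rewrite -linear_fun_sum //.
  by rewrite [LHS](svalP (cid (ex_q i))); congr phi; apply: eq_bigr => j _; rewrite mxE.
exists p, q; split=> [||g]; apply/matrixP => i.
- have phifree (c d : 'I_(fgdim A) -> F) :
      \sum_i c i *: phi (u i) = \sum_i d i *: phi (u i) -> c =1 d.
    move=> cd; apply: (linfree_inj fu); apply/eqP; rewrite -subr_eq0 -sumrB.
    have -> : \sum_i (c i *: u i - d i *: u i) = \sum_i (\row_i (c i - d i)) 0 i *: u i.
      by apply: eq_bigr => k _; rewrite mxE scalerBl.
    apply/eqP/phi_inj; first exact: Puc.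
    rewrite linear_fun_sum //; under eq_bigr do rewrite mxE scalerBl.
    by rewrite sumrB cd subrr.
  apply: phifree; transitivity (phi (u i)).
    rewrite pE; under [RHS]eq_bigr do rewrite qE scaler_sumr.
    rewrite exchange_big; apply: eq_bigr => k _ /=; rewrite mxE scaler_suml.
    by apply: eq_bigr => j _; rewrite scalerA.
  rewrite (bigD1 i) //= mxE eqxx scale1r big1 ?addr0 // => j /negPf ji.
  by rewrite mxE eq_sym ji scale0r.
- apply: (linfree_inj fv); transitivity (v i).
    rewrite qE; under [RHS]eq_bigr do rewrite pE scaler_sumr.
    rewrite exchange_big; apply: eq_bigr => k _ /=; rewrite mxE scaler_suml.
    by apply: eq_bigr => j _; rewrite scalerA.
  rewrite (bigD1 i) //= mxE eqxx scale1r big1 ?addr0 // => j /negPf ji.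
  by rewrite mxE eq_sym ji scale0r.
apply: (linfree_inj fv); transitivity (phi (act g (u i))).
  rewrite au linear_fun_sum //; under [RHS]eq_bigr do rewrite pE scaler_sumr.
  rewrite exchange_big; apply: eq_bigr => k _ /=; rewrite mxE scaler_suml.
  by apply: eq_bigr => j _; rewrite scalerA.
rewrite phi_act // pE linear_fun_sum //.
under eq_bigr do rewrite av scaler_sumr.
rewrite exchange_big; apply: eq_bigr => k _ /=; rewrite mxE scaler_suml.
by apply: eq_bigr => j _; rewrite scalerA.
Qed.

Lemma affords_fg0 (M : lmodType F) (act : G -> M -> M) (P : M -> Prop) :
  (forall x, P x <-> x = 0) -> affords (fg0 G F) act P.
Proof.
move=> P0; exists (fun=> 0); split=> [c _|x|g []//].
  by apply/rowP => -[].
rewrite P0; split=> [->|[c ->]]; last by rewrite big1 // => i _; rewrite scaler0.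
by exists 0; rewrite big1 // => i _; rewrite scaler0.
Qed.

Lemma affords_fg1 (M : lmodType F) (act : G -> M -> M) (P : M -> Prop) (e : M) :
  e != 0 -> (forall g, act g e = e) -> (forall x, P x <-> exists c, x = c *: e) ->
  affords (fg1 G F) act P.
Proof.
move=> e0 ae Pe; exists (fun=> e); split=> [c|x|g i].
- rewrite big_ord1 => /eqP; rewrite scaler_eq0 (negPf e0) orbF => /eqP c0.
  by apply/rowP => i; rewrite (ord1 i) c0 mxE.
- rewrite Pe; split=> -[c ->]; last by exists (c 0 0); rewrite big_ord1.
  by exists c%:M; rewrite big_ord1 mxE mulr1n.
by rewrite big_ord1 /= (ord1 i) mxE eqxx scale1r.
Qed.

Lemma affords_sum (M : lmodType F) (act : G -> M -> M) (P Q R : M -> Prop) A B :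
  affords A act P -> affords B act Q ->
  (forall x y, P x -> Q y -> x + y = 0 -> x = 0 /\ y = 0) ->
  (forall x, R x <-> exists y z, [/\ P y, Q z & x = y + z]) ->
  affords (fgsum A B) act R.
Proof.
move=> [u [fu Pu au]] [v [fv Pv av]] PQ RE.
pose w (i : 'I_(fgdim (fgsum A B))) :=
  match split i with inl i => u i | inr i => v i end.
have wl i : w (lshift _ i) = u i.
  by rewrite /w -[lshift _ i]/(unsplit (inl i)) unsplitK.
have wr i : w (rshift _ i) = v i.
  by rewrite /w -[rshift _ i]/(unsplit (inr i)) unsplitK.
have wE (c : 'I_(fgdim A + fgdim B) -> F) : \sum_i c i *: w i =
    \sum_i c (lshift _ i) *: u i + \sum_i c (rshift _ i) *: v i.
  by rewrite big_split_ord; congr (_ + _); apply: eq_bigr => i _; rewrite ?wl ?wr.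
exists w; split=> [c|x|g i].
- rewrite wE => /PQ[||c1 c2].
  + by apply/Pu; exists (lsubmx c); apply: eq_bigr => i _; rewrite mxE.
  + by apply/Pv; exists (rsubmx c); apply: eq_bigr => i _; rewrite mxE.
  apply/rowP => i; rewrite mxE; case: (split_ordP i) => j ->.
    exact: (linfree_fun fu c1).
  exact: (linfree_fun fv c2).
- rewrite RE; split=> [[y [z [/Pu[c ->] /Pv[d ->] ->]]]|[c ->]].
    exists (row_mx c d); rewrite wE; congr (_ + _); apply: eq_bigr => i _.
      by rewrite row_mxEl.
    by rewrite row_mxEr.
  rewrite wE; exists (\sum_i c 0 (lshift _ i) *: u i), (\sum_i c 0 (rshift _ i) *: v i).
  split=> //.
    by apply/Pu; exists (lsubmx c); apply: eq_bigr => i _; rewrite mxE.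
  by apply/Pv; exists (rsubmx c); apply: eq_bigr => i _; rewrite mxE.
rewrite wE; case: (split_ordP i) => j ->; rewrite /= /fgsum_rho.
  rewrite wl au [X in _ + X]big1 ?addr0 => [|k _].
    by apply: eq_bigr => k _; rewrite block_mxEul.
  by rewrite block_mxEur mxE scale0r.
rewrite wr av [X in X + _]big1 ?add0r => [|k _].
  by apply: eq_bigr => k _; rewrite block_mxEdr.
by rewrite block_mxEdl mxE scale0r.
Qed.

(** Recognizes a tensor product inside M from a bilinear map b: the premise on free families stands
    for injectivity on the tensor product, and the final induction principle says that the values of
    b span R additively. *)
Lemma affords_tens (M1 M2 M : lmodType F) (act1 : G -> M1 -> M1) (act2 : G -> M2 -> M2)
    (act : G -> M -> M) (P1 : M1 -> Prop) (P2 : M2 -> Prop) (R : M -> Prop)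
    (b : M1 -> M2 -> M) A B :
  affords A act1 P1 -> affords B act2 P2 ->
  (forall y, linear (b^~ y)) -> (forall x, linear (b x)) ->
  (forall g x y, P1 x -> P2 y -> act g (b x y) = b (act1 g x) (act2 g y)) ->
  (forall k (x : 'I_k -> M1) (v : 'I_k -> M2), linfree v ->
     \sum_i b (x i) (v i) = 0 -> forall i, x i = 0) ->
  R 0 -> (forall c x y, R x -> R y -> R (c *: x + y)) ->
  (forall x y, P1 x -> P2 y -> R (b x y)) ->
  (forall S : M -> Prop, S 0 -> (forall x y, S x -> S y -> S (x + y)) ->
     (forall x y, P1 x -> P2 y -> S (b x y)) -> forall x, R x -> S x) ->
  affords (fgtens A B) act R.
Proof.
move=> [u [fu Pu au]] [v [fv Pv av]] bl br bact bfree R0 RL Rb Rind.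
have Pui i : P1 (u i).
  apply/Pu; exists (\row_j (j == i)%:R); rewrite (bigD1 i) //= mxE eqxx scale1r.
  by rewrite big1 ?addr0 // => j /negPf ji; rewrite mxE ji scale0r.
have Pvi i : P2 (v i).
  apply/Pv; exists (\row_j (j == i)%:R); rewrite (bigD1 i) //= mxE eqxx scale1r.
  by rewrite big1 ?addr0 // => j /negPf ji; rewrite mxE ji scale0r.
pose w (i : 'I_(fgdim (fgtens A B))) :=
  b (u (mxtens_unindex i).1) (v (mxtens_unindex i).2).
have wE (c : 'I_(fgdim A * fgdim B) -> F) : \sum_i c i *: w i =
    \sum_i \sum_j c (mxtens_index (i, j)) *: b (u i) (v j).
  by rewrite sum_mxtens; apply: eq_bigr => i _; apply: eq_bigr => j _; rewrite /w mxtens_indexK.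
have bsum (c : 'I_(fgdim A) -> F) (d : 'I_(fgdim B) -> F) :
    b (\sum_i c i *: u i) (\sum_j d j *: v j) =
    \sum_i \sum_j (c i * d j) *: b (u i) (v j).
  rewrite (linear_fun_sum _ _ (bl _)); apply: eq_bigr => i _.
  rewrite (linear_fun_sum _ _ (br _)) scaler_sumr; apply: eq_bigr => j _.
  by rewrite scalerA.
exists w; split=> [c|x|g i].
- rewrite wE exchange_big /= => c0.
  have {}c0 : \sum_j b (\sum_i c 0 (mxtens_index (i, j)) *: u i) (v j) = 0.
    rewrite -[RHS]c0; apply: eq_bigr => j _.
    by rewrite (linear_fun_sum _ _ (bl _)).
  have {}c0 := bfree _ _ _ fv c0.
  apply/rowP => i; rewrite mxE; case: (mxtens_indexP i) => i1 i2.
  exact: (linfree_fun fu (c0 i2)).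
- split=> [|[c ->]].
    move: x; apply: Rind => [|x y [c ->] [d ->]|x y /Pu[c ->] /Pv[d ->]].
    + by exists 0; rewrite big1 // => i _; rewrite mxE scale0r.
    + by exists (c + d); rewrite -big_split; apply: eq_bigr => i _; rewrite mxE scalerDl.
    exists (\row_i (c 0 (mxtens_unindex i).1 * d 0 (mxtens_unindex i).2)).
    rewrite bsum wE; apply: eq_bigr => i _; apply: eq_bigr => j _.
    by rewrite mxE mxtens_indexK.
  elim/big_ind: _ => // [y z Ry Rz|i _]; first by rewrite -[y]scale1r; apply: RL.
  by rewrite -[_ *: _]addr0; apply: RL => //; apply: Rb.
rewrite /w; case: (mxtens_indexP i) => i1 i2; rewrite mxtens_indexK /= bact //.
rewrite au av bsum wE; apply: eq_bigr => j1 _; apply: eq_bigr => j2 _.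
by rewrite /fgtens_rho tensmxE.
Qed.

End Affords.

(** S may be infinite-dimensional, so there is no matrix to invert. By induction on k, [r] subtracts
    from x its components along a dual family of the other functionals; if the first functional
    vanished on every r x, it would be a combination of the others on S. *)
Lemma dual_family (F : fieldType) (B : lmodType F) (S : B -> Prop) k
    (phi : 'I_k -> B -> F) :
  S 0 -> (forall c x y, S x -> S y -> S (c *: x + y)) ->
  (forall i c x y, phi i (c *: x + y) = c * phi i x + phi i y) ->
  (forall c : 'I_k -> F, (forall x, S x -> \sum_i c i * phi i x = 0) -> forall i, c i = 0) ->
  exists xi : 'I_k -> B, forall i, S (xi i) /\ forall j, phi j (xi i) = (i == j)%:R.
Proof.
move=> S0 SL; elim: k phi => [|k IHk] phi phiL indep; first by exists (fun=> 0) => -[].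
have phi0 i : phi i 0 = 0.
  by have := phiL i (-1) 0 0; rewrite scaler0 addr0 mulN1r addNr.
have phiZ i c x : phi i (c *: x) = c * phi i x by rewrite -[c *: x]addr0 phiL phi0 addr0.
have phiD i x y : phi i (x + y) = phi i x + phi i y.
  by rewrite -[x]scale1r phiL mul1r scale1r.
have phi_sum i (c : 'I_k -> F) (x : 'I_k -> B) :
    phi i (\sum_j c j *: x j) = \sum_j c j * phi i (x j).
  by elim/big_rec2: _ => [|j a y _ <-]; rewrite ?phi0 // phiL.
have SZ c x : S x -> S (c *: x) by move=> Sx; rewrite -[c *: x]addr0; apply: SL.
have Ssum (c : 'I_k -> F) (x : 'I_k -> B) : (forall j, S (x j)) -> S (\sum_j c j *: x j).
  by move=> Sx; elim/big_rec: _ => // j y _ Sy; apply: SL.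
have [||xi xiP] := IHk (fun i => phi (lift ord0 i)).
- by move=> i c x y; apply: phiL.
- move=> c c0 i; pose c' j := if unlift ord0 j is Some j' then c j' else 0.
  have -> : c i = c' (lift ord0 i) by rewrite /c' liftK.
  apply: indep => x Sx; rewrite big_ord_recl /c' unlift_none mul0r add0r -[RHS](c0 x Sx).
  by apply: eq_bigr => j _; rewrite liftK.
pose r x := x - \sum_i phi (lift ord0 i) x *: xi i.
have Sr x : S x -> S (r x).
  move=> Sx; rewrite /r addrC -scaleN1r; apply: SL => //; apply: Ssum => i.
  by have [] := xiP i.
have rlift x j : phi (lift ord0 j) (r x) = 0.
  rewrite /r phiD -scaleN1r phiZ phi_sum (bigD1 j) //= (xiP j).2 eqxx mulr1 mulN1r.
  by rewrite big1 ?addr0 ?subrr // => i ij; rewrite (xiP i).2 (negPf ij) mulr0.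
have [x [Sx x0]] : exists x, S x /\ phi ord0 (r x) != 0.
  apply: contrapT => nex.
  pose c j := if unlift ord0 j is Some j' then - phi ord0 (xi j') else 1.
  have /(_ ord0) : forall i, c i = 0.
    apply: indep => x Sx; rewrite big_ord_recl {1}/c unlift_none mul1r.
    have : phi ord0 (r x) = 0 by apply/eqP/negPn/negP => x0; apply: nex; exists x.
    rewrite /r phiD -scaleN1r phiZ phi_sum mulN1r -sumrN => rx; rewrite -[RHS]rx.
    by congr (_ + _); apply: eq_bigr => i _; rewrite /c liftK mulNr mulrC.
  by rewrite /c unlift_none => /eqP; rewrite oner_eq0.
pose x' := (phi ord0 (r x))^-1 *: r x.
have Sx' : S x' by apply/SZ/Sr.
pose xi' j := if unlift ord0 j is Some j' then (- phi ord0 (xi j')) *: x' + xi j' else x'.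
have x'0 : phi ord0 x' = 1 by rewrite phiZ mulVf.
have x'l j : phi (lift ord0 j) x' = 0 by rewrite phiZ rlift mulr0.
exists xi' => i; rewrite /xi'; case: (unliftP ord0 i) => [i'|] ->.
  split; first by apply: SL => //; have [] := xiP i'.
  move=> j; case: (unliftP ord0 j) => [j'|] ->; rewrite phiL.
    by rewrite x'l mulr0 add0r (xiP i').2 (inj_eq lift_inj).
  by rewrite x'0 mulr1 addNr eq_sym (negPf (neq_lift _ _)).
split=> // j; case: (unliftP ord0 j) => [j'|] ->; first by rewrite x'l (negPf (neq_lift _ _)).
by rewrite x'0 eqxx.
Qed.

(** * Polynomials in two sets of variables *)

Section SplitVariables.
Variables (F : fieldType) (m1 m2 : nat).
Implicit Types (p : {mpoly F[m1]}) (q : {mpoly F[m2]}) (f : {mpoly F[m1 + m2]}).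

Definition mjoin (a : 'X_{1..m1}) (b : 'X_{1..m2}) : 'X_{1..m1 + m2} :=
  [multinom match split i with inl j => a j | inr j => b j end | i < m1 + m2].
Definition mleft (c : 'X_{1..m1 + m2}) : 'X_{1..m1} := [multinom c (lshift m2 i) | i < m1].
Definition mright (c : 'X_{1..m1 + m2}) : 'X_{1..m2} := [multinom c (rshift m1 i) | i < m2].

Lemma mjoin_lshift a b i : mjoin a b (lshift m2 i) = a i.
Proof. by rewrite mnmE -[lshift m2 i]/(unsplit (inl i)) unsplitK. Qed.
Lemma mjoin_rshift a b i : mjoin a b (rshift m1 i) = b i.
Proof. by rewrite mnmE -[rshift m1 i]/(unsplit (inr i)) unsplitK. Qed.
Lemma mjoinK c : mjoin (mleft c) (mright c) = c.
Proof.
by apply/mnmP => i; case: (split_ordP i) => j ->; rewrite ?mjoin_lshift ?mjoin_rshift mnmE.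
Qed.
Lemma mleft_join a b : mleft (mjoin a b) = a.
Proof. by apply/mnmP => i; rewrite mnmE mjoin_lshift. Qed.
Lemma mright_join a b : mright (mjoin a b) = b.
Proof. by apply/mnmP => i; rewrite mnmE mjoin_rshift. Qed.
Lemma eq_mjoin a b a' b' : (mjoin a b == mjoin a' b') = (a == a') && (b == b').
Proof.
apply/eqP/andP => [E|[/eqP-> /eqP->]//].
have := congr1 mleft E; have := congr1 mright E.
by rewrite !mleft_join !mright_join => -> ->; rewrite !eqxx.
Qed.

Definition evl p : {mpoly F[m1 + m2]} := p \mPo [tuple 'X_(lshift m2 i) | i < m1].
Definition evr q : {mpoly F[m1 + m2]} := q \mPo [tuple 'X_(rshift m1 i) | i < m2].

Lemma evlX a : evl 'X_[a] = 'X_[mjoin a 0].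
Proof.
rewrite /evl comp_mpolyX [RHS]mpolyXE_id big_split_ord /= [X in _ = _ * X]big1 ?mulr1.
  by apply: eq_bigr => i _; rewrite tnth_mktuple mjoin_lshift.
by move=> i _; rewrite mjoin_rshift mnm0E expr0.
Qed.
Lemma evrX b : evr 'X_[b] = 'X_[mjoin 0 b].
Proof.
rewrite /evr comp_mpolyX [RHS]mpolyXE_id big_split_ord /= [X in _ = X * _]big1 ?mul1r.
  by apply: eq_bigr => i _; rewrite tnth_mktuple mjoin_rshift.
by move=> i _; rewrite mjoin_lshift mnm0E expr0.
Qed.
Lemma evX a b : evl 'X_[a] * evr 'X_[b] = 'X_[mjoin a b].
Proof.
rewrite evlX evrX -mpolyXD; congr 'X_[_]; apply/mnmP => i; rewrite mnmDE.
by case: (split_ordP i) => j ->; rewrite ?mjoin_lshift ?mjoin_rshift mnm0E ?addn0.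
Qed.

Lemma evlP c p p' : evl (c *: p + p') = c *: evl p + evl p'.
Proof. by rewrite /evl comp_mpolyD comp_mpolyZ. Qed.
Lemma evrP c q q' : evr (c *: q + q') = c *: evr q + evr q'.
Proof. by rewrite /evr comp_mpolyD comp_mpolyZ. Qed.

Lemma mcoeff_ev p q c : (evl p * evr q)@_c = p@_(mleft c) * q@_(mright c).
Proof.
rewrite [p]mpolyE [q]mpolyE; set s := msupp p; set t := msupp q.
have evl_sum : evl (\sum_(a <- s) p@_a *: 'X_[a]) = \sum_(a <- s) p@_a *: evl 'X_[a].
  elim: s => [|a s IHs]; first by rewrite !big_nil /evl comp_mpoly0.
  by rewrite !big_cons evlP IHs.
have evr_sum : evr (\sum_(a <- t) q@_a *: 'X_[a]) = \sum_(a <- t) q@_a *: evr 'X_[a].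
  elim: t => [|a t IHt]; first by rewrite !big_nil /evr comp_mpoly0.
  by rewrite !big_cons evrP IHt.
rewrite evl_sum evr_sum mulr_suml !linear_sum /= mulr_suml; apply: eq_bigr => a _.
rewrite mulr_sumr linear_sum mulr_sumr; apply: eq_bigr => b _ /=.
rewrite -scalerAl -scalerAr evX !mcoeffZ !mcoeffX -{1}(mjoinK c) eq_mjoin.
by rewrite -mulnb natrM mulrACA mulrA.
Qed.

Variables (wt1 : 'I_m1 -> nat) (wt2 : 'I_m2 -> nat).
Definition wtjoin (i : 'I_(m1 + m2)) : nat :=
  match split i with inl j => wt1 j | inr j => wt2 j end.
Lemma wtjoin_lshift i : wtjoin (lshift m2 i) = wt1 i.
Proof. by rewrite /wtjoin -[lshift m2 i]/(unsplit (inl i)) unsplitK. Qed.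
Lemma wtjoin_rshift i : wtjoin (rshift m1 i) = wt2 i.
Proof. by rewrite /wtjoin -[rshift m1 i]/(unsplit (inr i)) unsplitK. Qed.

Lemma wdeg_join c : wdeg wtjoin c = (wdeg wt1 (mleft c) + wdeg wt2 (mright c))%N.
Proof.
rewrite /wdeg big_split_ord; congr (_ + _)%N; apply: eq_bigr => i _.
  by rewrite wtjoin_lshift mnmE.
by rewrite wtjoin_rshift mnmE.
Qed.

End SplitVariables.

Section SupportConditions.
Variables (F : fieldType) (m : nat).
Implicit Types (p q : {mpoly F[m]}) (S : pred 'X_{1..m}).

Definition psupp S p := forall a, p@_a != 0 -> S a.

Lemma psuppP S c p q : psupp S p -> psupp S q -> psupp S (c *: p + q).
Proof.
move=> hp hq a; rewrite mcoeffD mcoeffZ; have [->|/hp //] := eqVneq p@_a 0.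
by rewrite mulr0 add0r => /hq.
Qed.
Lemma psupp0 S : psupp S 0.
Proof. by move=> a; rewrite mcoeff0 eqxx. Qed.

Lemma psupp_disj S1 S2 p q : (forall a, S1 a -> S2 a -> False) ->
  psupp S1 p -> psupp S2 q -> p + q = 0 -> p = 0 /\ q = 0.
Proof.
move=> S12 hp hq pq; suff p0 : p = 0 by split=> //; move: pq; rewrite p0 add0r.
apply/mpolyP => a; rewrite mcoeff0; apply/eqP/negPn/negP => pa.
have qa : q@_a != 0.
  apply: contraNneq pa => qa; have /(congr1 (mcoeff a)) := pq.
  by rewrite mcoeffD qa addr0 mcoeff0 => ->.
exact: S12 (hp _ pa) (hq _ qa).
Qed.

Lemma psupp_split S S1 S2 p : (forall a, S a = S1 a || S2 a) -> psupp S p ->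
  exists q r, [/\ psupp S1 q, psupp S2 r & p = q + r].
Proof.
move=> SE hp.
have hsum (T : pred 'X_{1..m}) : psupp T (\sum_(a <- msupp p | T a) p@_a *: 'X_[a]).
  elim/big_ind: _ => [|q r hq hr|a Ta]; first exact: psupp0.
    by rewrite -[q]scale1r; apply: psuppP.
  move=> b; rewrite mcoeffZ mcoeffX; have [<-//|] := eqVneq a b.
  by rewrite mulr0 eqxx.
exists (\sum_(a <- msupp p | S1 a) p@_a *: 'X_[a]).
exists (\sum_(a <- msupp p | ~~ S1 a) p@_a *: 'X_[a]); split=> //.
  move=> a pa; have := hsum _ _ pa; rewrite -[S2 a]orFb => /negPf <-; rewrite -SE.
  apply: hp; apply: contraNneq pa; rewrite linear_sum /= => pa0.
  rewrite big1 ?eqxx // => b _; rewrite mcoeffZ mcoeffX.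
  by have [->|] := eqVneq b a; rewrite ?pa0 ?mul0r ?mulr0.
by rewrite {1}[p]mpolyE (bigID S1).
Qed.
End SupportConditions.

(** * Hilbert series with values in the Green ring *)

Section WeightedPowers.
Variables (G : groupType) (F : fieldType).
Implicit Types (V W : fgmod G F).

Lemma poly_act_morph V g p q : poly_act g (p * q : {mpoly F[fgdim V]}) =
  poly_act g p * poly_act g q.
Proof. by rewrite /poly_act rmorphM. Qed.
Lemma poly_act_one V g : poly_act g (1 : {mpoly F[fgdim V]}) = 1.
Proof. by rewrite /poly_act comp_mpoly1. Qed.

(* s is the Hilbert series, with values in the Green ring, of the symmetric algebra
   of W graded by giving the i-th basis vector degree wt i. *)
Definition weighted_powers W (wt : 'I_(fgdim W) -> nat) (s : fps (Gamma G F)) :=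
  forall n, exists2 A : fgmod G F, affords A (@poly_act G F W) (wpoly wt n) & gcl A = s n.

Lemma affords_constants W :
  affords (fg1 G F) (@poly_act G F W) (fun p => exists c, p = c *: 1).
Proof.
by apply: (affords_fg1 (e := 1)) => //; [exact: oner_neq0 | move=> g; apply: poly_act_one].
Qed.

Lemma symm_powP r V :
  affords (symm_pow r V) (@poly_act G F V) (fun p : {mpoly F[fgdim V]} => p \is r.-homog).
Proof. by rewrite /symm_pow; case: cid. Qed.

Lemma weighted_powers_symm V d : (0 < d)%N ->
  weighted_powers (fun _ : 'I_(fgdim V) => d) (fps_subst d (symm_series V)).
Proof.
move=> d0 n.
have wdE (a : 'X_{1..fgdim V}) : wdeg (fun=> d) a = (mdeg a * d)%N.
  by rewrite mdegE big_distrl.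
rewrite /=; case: ifP => [/dvdnP[r ->]|dn]; last first.
  exists (fg0 G F) => //; apply: affords_fg0 => p; split=> [hp|->]; last exact: wpoly0.
  apply/mpolyP => a; rewrite mcoeff0; apply/eqP/negPn/negP => /hp.
  by rewrite wdE => E; rewrite -E dvdn_mull in dn.
rewrite mulnK //; case: r => [|r].
  exists (fg1 G F) => //; apply: affords_eq (affords_constants V) => p.
  split=> [[c ->]|hp]; first by rewrite alg_mpolyC; apply: wpolyC.
  exists p@_0; apply/mpolyP => a; rewrite alg_mpolyC mcoeffC.
  have [->|a0] := eqVneq a 0%MM; first by rewrite mulr1.
  rewrite mulr0; apply/eqP/negPn/negP => /hp/eqP; rewrite wdE mul0n muln_eq0.
  by rewrite mdeg_eq0 (negPf a0) gtn_eqF.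
exists (symm_pow r.+1 V) => //; apply: affords_eq (symm_powP r.+1 V) => p.
split=> [/dhomogP hp a pa|hp].
  by rewrite wdE; congr (_ * _)%N; apply: hp; rewrite mcoeff_msupp.
apply/dhomogP => a; rewrite mcoeff_msupp => /hp/eqP.
by rewrite wdE eqn_pmul2r // => /eqP.
Qed.

Lemma poly_act_evl V W g p :
  @poly_act G F (fgsum V W) g (evl (fgdim W) p) = evl (fgdim W) (@poly_act G F V g p).
Proof.
elim/mpoly_gen_ind: p => [c p q IHp IHq||i p IHp].
- by rewrite evlP !poly_act_linear evlP IHp IHq.
- by rewrite poly_act_one /evl comp_mpoly1 poly_act_one.
have evM (r s : {mpoly F[fgdim V]}) : evl (fgdim W) (r * s) = evl _ r * evl _ s.
  by rewrite /evl rmorphM.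
rewrite poly_act_morph !evM poly_act_morph IHp; congr (_ * _).
have evXi j : evl (fgdim W) ('X_j : {mpoly F[fgdim V]}) = 'X_(lshift _ j).
  by rewrite /evl comp_mpolyXU -tnth_nth tnth_mktuple.
rewrite evXi !poly_actX big_split_ord /= /fgsum_rho.
rewrite [X in _ + X]big1 ?addr0 => [|j _]; last by rewrite block_mxEur mxE scale0r.
rewrite /evl linear_sum; apply: eq_bigr => j _ /=.
by rewrite comp_mpolyZ block_mxEul -evXi.
Qed.

Lemma poly_act_evr V W g p :
  @poly_act G F (fgsum V W) g (evr (fgdim V) p) = evr (fgdim V) (@poly_act G F W g p).
Proof.
elim/mpoly_gen_ind: p => [c p q IHp IHq||i p IHp].
- by rewrite evrP !poly_act_linear evrP IHp IHq.
- by rewrite poly_act_one /evr comp_mpoly1 poly_act_one.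
have evM (r s : {mpoly F[fgdim W]}) : evr (fgdim V) (r * s) = evr _ r * evr _ s.
  by rewrite /evr rmorphM.
rewrite poly_act_morph !evM poly_act_morph IHp; congr (_ * _).
have evXi j : evr (fgdim V) ('X_j : {mpoly F[fgdim W]}) = 'X_(rshift _ j).
  by rewrite /evr comp_mpolyXU -tnth_nth tnth_mktuple.
rewrite evXi !poly_actX big_split_ord /= /fgsum_rho.
rewrite [X in X + _]big1 ?add0r => [|j _]; last by rewrite block_mxEdl mxE scale0r.
rewrite /evr linear_sum; apply: eq_bigr => j _ /=.
by rewrite comp_mpolyZ block_mxEdr -evXi.
Qed.

(** The weight n part is the direct sum over k of weight k in the first variables tensored with
    weight n - k in the second, whose class is the Cauchy product. [S1 k] selects one summand and
    [S k] those of index below k, joined one at a time. *)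
Lemma weighted_powers_sum V W wt1 wt2 s1 s2 :
  weighted_powers (W := V) wt1 s1 -> weighted_powers (W := W) wt2 s2 ->
  weighted_powers (W := fgsum V W) (wtjoin wt1 wt2) (s1 * s2).
Proof.
move=> h1 h2 n.
pose S k (c : 'X_{1..fgdim V + fgdim W}) :=
  (wdeg (wtjoin wt1 wt2) c == n) && (wdeg wt1 (mleft c) < k)%N.
pose S1 k (c : 'X_{1..fgdim V + fgdim W}) :=
  (wdeg wt1 (mleft c) == k) && (wdeg wt2 (mright c) == n - k)%N.
have part k : (k <= n)%N -> exists2 A : fgmod G F,
    affords A (@poly_act G F (fgsum V W)) (psupp (S1 k)) & gcl A = s1 k * s2 (n - k)%N.
  move=> kn; have [A hA <-] := h1 k; have [B hB <-] := h2 (n - k)%N.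
  exists (fgtens A B); last exact: gclM.
  apply: (affords_tens (b := fun p q => evl _ p * evr _ q) hA hB).
  - by move=> q a p p'; rewrite evlP mulrDl scalerAl.
  - by move=> p a q q'; rewrite evrP mulrDr scalerAr.
  - by move=> g p q _ _; rewrite (poly_act_morph (V := fgsum V W)) poly_act_evl poly_act_evr.
  - move=> l x v fv xv0 i; apply/mpolyP => a; rewrite mcoeff0.
    apply: (linfree_fun (c := fun i => (x i)@_a) fv); apply/mpolyP => b.
    rewrite mcoeff0; have /(congr1 (mcoeff (mjoin a b))) := xv0.
    rewrite !linear_sum /= mcoeff0 => E; rewrite -[RHS]E; apply: eq_bigr => j _.
    by rewrite mcoeff_ev mleft_join mright_join mcoeffZ.
  - exact: psupp0.
  - by move=> c p q; apply: psuppP.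
  - move=> p q hp hq c; rewrite mcoeff_ev mulf_eq0 negb_or => /andP[pc qc].
    by rewrite /S1 (hp _ pc) (hq _ qc) !eqxx.
  move=> T T0 TD Tb p hp; rewrite [p]mpolyE big_seq; elim/big_ind: _ => // c.
  rewrite mcoeff_msupp => /hp/andP[/eqP c1 /eqP c2].
  rewrite -{2}(mjoinK c) -evX scalerAl -[_ *: evl _ _]addr0.
  rewrite (_ : _ + 0 = evl (fgdim W) (p@_c *: 'X_[mleft c])); last first.
    by rewrite -[in RHS](addr0 (_ *: _)) evlP /evl comp_mpoly0.
  apply: Tb; last by rewrite -c2; apply: wpolyX.
  rewrite -[_ *: _]addr0; apply: wpolyPl; last exact: wpoly0.
  by rewrite -c1; apply: wpolyX.
have main k : (k <= n.+1)%N -> exists2 A : fgmod G F,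
    affords A (@poly_act G F (fgsum V W)) (psupp (S k)) &
    gcl A = \sum_(i < k) s1 i * s2 (n - i)%N.
  elim: k => [_|k IHk kn].
    exists (fg0 G F); last by rewrite big_ord0.
    apply: affords_fg0 => p; split=> [hp|->]; last exact: psupp0.
    apply/mpolyP => a; rewrite mcoeff0; apply/eqP/negPn/negP => /hp.
    by rewrite /S ltn0 andbF.
  have [A hA AE] := IHk (ltnW kn); have [B hB BE] := part k kn.
  exists (fgsum A B); last by rewrite gclD AE BE big_ord_recr.
  have SE a : S k.+1 a = S k a || S1 k a.
    rewrite /S /S1 ltnS leq_eqVlt andb_orr orbC; congr (_ || _).
    rewrite andbC; have [ak|//] := eqVneq (wdeg wt1 (mleft a)) k.
    by rewrite /= wdeg_join ak -{1}(subnKC (kn : (k <= n)%N)) eqn_add2l.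
  apply: affords_sum hA hB _ _.
    move=> x z hx hz; apply: (psupp_disj _ hx hz) => a; rewrite /S /S1 => /andP[_ ak] /andP[/eqP E _].
    by rewrite E ltnn in ak.
  move=> p; split; first exact: psupp_split.
  move=> [q [r [hq hr ->]]] a; rewrite mcoeffD SE => qr.
  have [/eqP q0|/hq -> //] := boolP (q@_a == 0).
  by rewrite hr ?orbT //; rewrite q0 add0r in qr.
have [A hA AE] := main n.+1 (leqnn _); exists A => //.
apply: affords_eq hA => p; split=> hp a /hp.
  by case/andP => /eqP.
move=> an; rewrite /S an eqxx /= ltnS -an wdeg_join; exact: leq_addr.
Qed.

End WeightedPowers.

(** * The Poincare-Birkhoff-Witt decomposition of tensor powers *)
Section ShufflePairing.
Variables (F : fieldType) (n : nat).
Local Notation T := (conc F 'I_n).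
Local Notation B := (shuf F 'I_n).
Local Notation act := (wact (@wtl_shuf_op F n)).

Lemma act_nil_homog k l (f : T) (g : B) : whomog l g -> k <> l -> act k f g [::] = 0.
Proof.
elim: k l f g => [|k IHk] l f g hg kl /=.
  by rewrite wordfunZ hg ?mulr0.
rewrite wordfun_sum big1 // => x _; case: l hg kl => [|l] hg kl.
  have -> : wtl_shuf_op x g = 0 by apply: funext => w; apply: hg.
  by rewrite (linear_fun0 (@wact_linear F 'I_n _ (@wtl_shuf_op F n) _ _)).
by apply: (IHk l); [apply: whomog_tl | move=> E; apply: kl; rewrite E].
Qed.

Definition wdelta (w : seq 'I_n) : B := fun u => (u == w)%:R.

(** [act k f g [::]] is the sum of f w * g w over the words w of length k, so indicator functions
    read off coefficients. *)
Lemma act_wdelta (w : seq 'I_n) (f : T) : act (size w) f (wdelta w) [::] = f w.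
Proof.
elim: w f => [|x w IHw] f /=; first by rewrite wordfunZ /wdelta eqxx mulr1.
rewrite wordfun_sum (bigD1 x) //= [X in _ + X]big1 ?addr0 => [|z zx].
  have -> : wtl_shuf_op x (wdelta (x :: w)) = wdelta w.
    by apply: funext => u; rewrite /wdelta /wtl_shuf_op /wtl eqseq_cons eqxx.
  exact: IHw.
have -> : wtl_shuf_op z (wdelta (x :: w)) = 0.
  by apply: funext => u; rewrite /wdelta /wtl_shuf_op /wtl eqseq_cons (negPf zx).
by rewrite (linear_fun0 (@wact_linear F 'I_n _ (@wtl_shuf_op F n) _ _)).
Qed.

Lemma shuf_dual k d (y : 'I_k -> T) : (forall j, whomog d (y j)) -> linfree y ->
  exists xi : 'I_k -> B, forall i, whomog d (xi i) /\
    forall j, act d (y j) (xi i) [::] = (i == j)%:R.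
Proof.
move=> hy fy; apply: (@dual_family F B (fun g => whomog d g) k (fun j g => act d (y j) g [::])).
- by [].
- by move=> c f g; apply: whomogP.
- by move=> i c f g; rewrite wact_linear wordfunD wordfunZ.
move=> c c0; apply: (linfree_fun fy); apply: funext => w; rewrite wordfun_sum.
case: (eqVneq (size w) d) => [wd|/eqP wd]; last first.
  by apply: big1 => i _; rewrite wordfunZ hy // mulr0.
rewrite -[RHS](c0 (wdelta w)).
  by apply: eq_bigr => i _; rewrite wordfunZ -wd act_wdelta.
by move=> u ud; rewrite /wdelta; case: eqP => // uw; case: ud; rewrite uw.
Qed.

End ShufflePairing.

Section TensorPowers.
Variables (G : groupType) (F : fieldType) (V : fgmod G F).
Local Notation n := (fgdim V).
Local Notation T := (conc F 'I_n).

Lemma affords_natural :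
  affords V (fun g (v : 'rV[F]_n) => v *m V g) (fun=> True).
Proof.
exists (fun i => delta_mx 0 i); split=> [c||g i].
- by rewrite -row_sum_delta.
- by move=> v; split=> // _; exists v; apply: row_sum_delta.
by rewrite -rowE [LHS]row_sum_delta; apply: eq_bigr => j _; rewrite mxE.
Qed.

Lemma affords_fgpow k :
  affords (fgpow V k) (fun g (f : T) => wsub (V g) f : T) (whomog k).
Proof.
elim: k => [|k IHk].
  apply: (affords_fg1 (e := 1)) => [|g|f].
  - exact: oner_neq0.
  - exact: wsub1.
  split=> [hf|[c ->]]; last by apply: whomogZ; apply: whomog_one.
  exists (f [::]); apply: funext => -[|x w]; rewrite wordfunZ.
    by rewrite -[X in _ * X]/(1 : F) mulr1.
  by rewrite -[X in _ * X]/(0 : F) mulr0 hf.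
apply: (affords_tens (b := fun v f => wgen v * f) affords_natural IHk).
- by move=> f a u v; rewrite wgen_linear mulrDl scalerAl.
- by move=> v a f f'; rewrite mulrDr scalerAr.
- by move=> g v f _ _; rewrite wsubM wsub_wgen.
- move=> l x v fv xv i; apply/rowP => j; rewrite mxE.
  apply: (linfree_fun (c := fun i => x i 0 j) fv); apply: funext => w.
  have /(congr1 (fun f => f (j :: w))) := xv; rewrite !wordfun_sum => E; rewrite -[RHS]E.
  apply: eq_bigr => a _; rewrite -[RHS]/(wtl j (wgen (x a) * v a : T) w) wtl_concM.
  have -> : (wtl j (wgen (x a)) : T) = x a 0 j *: 1.
    by apply: funext => -[|z u]; rewrite wordfunZ /= ?mulr1 ?mulr0.
  by rewrite /= scale0r addr0 -scalerAl mul1r.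
- by [].
- by move=> c f g; apply: whomogP.
- move=> v f _ hf; rewrite -add1n; apply: whomogM => //.
  by rewrite -lie_embed_gen; apply: lie_embed_homog; apply: homog_gen.
move=> S S0 SD Sb f hf; rewrite (whomogS_decomp hf).
by elim/big_ind: _ => // x _; apply: Sb => //; apply: whomog_tl.
Qed.

End TensorPowers.

Section PBW.
Variables (G : groupType) (F : fieldType) (charF0 : [pchar F] =i pred0).
Variable V : fgmod G F.
Local Notation n := (fgdim V).
Local Notation T := (conc F 'I_n).
Local Notation B := (shuf F 'I_n).
Local Notation act := (wact (@wtl_shuf_op F n)).

Lemma lie_powP r : affords (lie_pow r V) (@lie_act G F V) (freeLie_homog r).
Proof. by rewrite /lie_pow; case: cid. Qed.

Definition lie_prod N : fps (Gamma G F) :=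
  \prod_(1 <= d < N.+1) fps_subst d (symm_series (lie_pow d V)).

(* W is the sum of the L^d(V) for 1 <= d <= N, y its basis as tensors, and xi a
   family dual to y for the pairing of tensors with functions on words. *)
Definition pbw_basis N (W : fgmod G F) (wt : 'I_(fgdim W) -> nat)
    (y : 'I_(fgdim W) -> T) (xi : 'I_(fgdim W) -> B) :=
  [/\ forall j, (0 < wt j <= N)%N /\
        exists2 z : freeLie 'rV[F]_n, freeLie_homog (wt j) z & y j = lie_embed z,
      forall g i, wsub (V g) (y i) = \sum_j W g i j *: y j :> T,
      forall i, whomog (wt i) (xi i) /\
        forall j, act (wt j) (y j) (xi i) [::] = (i == j)%:R,
      forall d (z : freeLie 'rV[F]_n), (d <= N)%N -> freeLie_homog d z -> lspan y wt d (lie_embed z)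
    & weighted_powers wt (lie_prod N)].

Lemma lspan_join k l (y1 : 'I_k -> T) (y2 : 'I_l -> T) wt1 wt2 d z :
  let y i := match split i with inl j => y1 j | inr j => y2 j end in
  lspan y1 wt1 d z \/ lspan y2 wt2 d z -> lspan y (wtjoin wt1 wt2) d z.
Proof.
move=> y; have yl i : y (lshift l i) = y1 i.
  by rewrite /y -[lshift l i]/(unsplit (inl i)) unsplitK.
have yr i : y (rshift k i) = y2 i.
  by rewrite /y -[rshift k i]/(unsplit (inr i)) unsplitK.
case=> -[c [hc ->]].
  exists (fun i => match split i with inl j => c j | inr j => 0 end); split=> [i|].
    rewrite /wtjoin; case: (split i) => [j|j]; first exact: hc.
    by rewrite eqxx.
  rewrite big_split_ord [X in _ = _ + X]big1 ?addr0 => [|i _].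
    apply: eq_bigr => i _; rewrite yl -[lshift l i]/(unsplit (inl i)) unsplitK //.
  by rewrite -[rshift k i]/(unsplit (inr i)) unsplitK scale0r.
exists (fun i => match split i with inl j => 0 | inr j => c j end); split=> [i|].
  rewrite /wtjoin; case: (split i) => [j|j]; last exact: hc.
  by rewrite eqxx.
rewrite big_split_ord [X in _ = X + _]big1 ?add0r => [|i _].
  by apply: eq_bigr => i _; rewrite yr -[rshift k i]/(unsplit (inr i)) unsplitK.
by rewrite -[lshift l i]/(unsplit (inl i)) unsplitK scale0r.
Qed.

(** The step adjoins a basis of L^(N+1)(V). It stays free among tensors by [lie_embed_inj], hence
    has a dual family, and old and new members pair to 0 because their degrees differ. *)
Lemma pbw_basis_exists N : exists W wt y xi, @pbw_basis N W wt y xi.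
Proof.
elim: N => [|N [W [wt [y [xi [hy act_y dual_xi span_y pow_s]]]]]].
  exists (fg0 G F), (fun=> 0%N), (fun=> 0), (fun=> 0); split.
  - by move=> [].
  - by move=> g [].
  - by move=> [].
  - move=> d z; rewrite leqn0 => /eqP d0 /freeLie_homog0_eq0 -> //; rewrite linear0.
    by exists (fun=> 0); split=> [[]//|]; rewrite big1 // => -[].
  move=> k; rewrite /lie_prod big_geq //.
  have wd0 (a : 'X_{1..0}) : wdeg (fun _ : 'I_0 => 0%N) a = 0%N.
    by rewrite /wdeg big1 // => i _; rewrite muln0.
  case: k => [|k]; [exists (fg1 G F) => // | exists (fg0 G F) => //].
    apply: affords_eq (affords_constants (fg0 G F)) => p; split=> [[c ->]|_].
      by rewrite alg_mpolyC; apply: wpolyC.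
    exists p@_0; apply/mpolyP => a; rewrite alg_mpolyC mcoeffC.
    have -> : a = 0%MM by apply/mnmP => -[].
    by rewrite eqxx mulr1.
  apply: affords_fg0 => p; split=> [hp|->]; last exact: wpoly0.
  apply/mpolyP => a; rewrite mcoeff0; apply/eqP/negPn/negP => /hp.
  by rewrite wd0.
have [u [fu Pu au]] := lie_powP N.+1.
have Pui i : freeLie_homog N.+1 (u i).
  apply/Pu; exists (\row_j (j == i)%:R); rewrite (bigD1 i) //= mxE eqxx scale1r.
  by rewrite big1 ?addr0 // => j /negPf ji; rewrite mxE ji scale0r.
have fuy : linfree (fun i => lie_embed (u i) : T).
  move=> c; rewrite -(linear_fun_sum _ _ (@lie_embed_linear F n)) => c0; apply: fu.
  by apply: (lie_embed_inj charF0 _ c0); apply/Pu; exists c.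
have hu i : whomog N.+1 (lie_embed (u i) : T) by apply: lie_embed_homog.
have [xi' xi'P] := shuf_dual hu fuy.
pose join X (f : 'I_(fgdim W) -> X) g (i : 'I_(fgdim W + fgdim (lie_pow N.+1 V))) : X :=
  match split i with inl j => f j | inr j => g j end.
have joinl X (f : 'I_(fgdim W) -> X) g i : join X f g (lshift _ i) = f i.
  by rewrite /join -[lshift _ i]/(unsplit (inl i)) unsplitK.
have joinr X (f : 'I_(fgdim W) -> X) g i : join X f g (rshift _ i) = g i.
  by rewrite /join -[rshift _ i]/(unsplit (inr i)) unsplitK.
pose y' := join T y (fun i => lie_embed (u i)).
have wtN j : wt j <> N.+1 by case: (hy j) => /andP[_ jN] _ E; rewrite E ltnn in jN.
exists (fgsum W (lie_pow N.+1 V)), (wtjoin wt (fun=> N.+1)), y', (join B xi xi'); split.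
- move=> j; case: (split_ordP j) => i ->; rewrite /y' ?joinl ?joinr ?wtjoin_lshift ?wtjoin_rshift.
    have [/andP[-> iN] hz] := hy i; split=> //; exact: leqW.
  by rewrite leqnn; split=> //; exists (u i).
- move=> g i; rewrite big_split_ord; case: (split_ordP i) => j ->; rewrite /= /fgsum_rho.
    rewrite /y' joinl act_y [X in _ = _ + X]big1 ?addr0 => [|k _].
      by apply: eq_bigr => k _; rewrite block_mxEul joinl.
    by rewrite block_mxEur mxE scale0r.
  rewrite /y' joinr wsub_lie_embed [X in _ = X + _]big1 ?add0r => [|k _].
    rewrite -[freeLie_map _ _]/(lie_act g (u j)) au.
    rewrite (linear_fun_sum _ _ (@lie_embed_linear F n)).
    by apply: eq_bigr => k _; rewrite block_mxEdr joinr.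
  by rewrite block_mxEdl mxE scale0r.
- move=> i; split.
    by case: (split_ordP i) => j ->; rewrite ?joinl ?joinr ?wtjoin_lshift ?wtjoin_rshift;
      [case: (dual_xi j) | case: (xi'P j)].
  move=> j; case: (split_ordP i) => i' ->; case: (split_ordP j) => j' ->;
    rewrite /y' ?joinl ?joinr ?wtjoin_lshift ?wtjoin_rshift.
  + by rewrite (dual_xi i').2 (inj_eq (@lshift_inj _ _)).
  + rewrite (act_nil_homog _ (dual_xi i').1) ?eq_lrshift //.
    by move=> E; apply: (wtN i').
  + by rewrite (act_nil_homog _ (xi'P i').1) ?eq_rlshift //; apply: wtN.
  by rewrite (xi'P i').2 (inj_eq (@rshift_inj _ _)).
- move=> d z; rewrite leq_eqVlt ltnS => /orP[/eqP-> /Pu[c ->]|dN hz]; apply: lspan_join.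
    right; exists (fun i => c 0 i); split=> //.
    exact: (linear_fun_sum _ _ (@lie_embed_linear F n)).
  by left; apply: span_y.
rewrite /lie_prod big_nat_recr //=; apply: weighted_powers_sum => //.
exact: weighted_powers_symm.
Qed.

(** [symt y k] is an equivariant isomorphism from the polynomials of weight k on the basis of W onto
    the tensors of degree k. *)
Lemma pbw_tensor_power N k : (k <= N)%N -> lie_prod N k = gcl V ^+ k.
Proof.
move=> kN; have [W [wt [y [xi [hy act_y dual_xi span_y pow_s]]]]] := pbw_basis_exists N.
have gcl_pow : gcl (fgpow V k) = gcl V ^+ k.
  by elim: k {kN} => [|k IHk] //=; rewrite gclM IHk exprS.
have [A hA AE] := pow_s k; rewrite -gcl_pow -AE; apply: gcl_iso.
have wt_gt0 j : (0 < wt j)%N by case: (hy j) => /andP[].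
have ywt j : whomog (wt j) (y j) by case: (hy j) => _ [z hz ->]; apply: lie_embed_homog.
(* Members of the spans are images of Lie elements, so their commutator is the image of a bracket,
   which the basis covers in degrees up to N. *)
have hcomm d e z w : (d + e <= N)%N ->
    lspan y wt d z -> lspan y wt e w -> lspan y wt (d + e) (z * w - w * z).
  move=> deN hz hw.
  have lspan_lie_embed b x : lspan y wt b x ->
      exists2 a : freeLie 'rV[F]_n, freeLie_homog b a & x = lie_embed a.
    move=> [c [hc ->]]; elim/big_ind: _ => [|x1 x2 [a1 h1 ->] [a2 h2 ->]|j _].
    - by exists 0; rewrite ?linear0 //; apply: homog_0.
    - exists (a1 + a2); last by rewrite linearD.
      by rewrite -[a1]scale1r; apply: homog_lin.
    have [c0|/hc <-] := eqVneq (c j) 0.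
      by exists 0; rewrite ?c0 ?scale0r ?linear0 //; apply: homog_0.
    have [_ [a ha ->]] := hy j; exists (c j *: a); last by rewrite linearZ.
    by rewrite -[_ *: _]addr0; apply: homog_lin => //; apply: homog_0.
  have [a ha ->] := lspan_lie_embed _ _ hz; have [b hb ->] := lspan_lie_embed _ _ hw.
  by rewrite -lie_embed_br; apply: span_y => //; apply: homog_br.
apply: (affords_iso (phi := symt y k) hA (affords_fgpow V k)).
- by move=> c p q; rewrite symtP.
- by move=> g; apply: wsub_linear.
- move=> p hp; apply: (@symt_inj F charF0 n (fgdim W) y wt ywt _ xi _ _ k k p hp).
  + move=> j g h; have [_ [z hz ->]] := hy j; exact: lie_embed_derivation.
  + by move=> j; apply: (dual_xi j).1 => E; have := wt_gt0 j; rewrite -E.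
  + by move=> i j; apply: (dual_xi i).2.
  by move=> a /hp <-; apply: mdeg_le_wdeg.
- move=> f; split=> [hf|[p hp ->]]; last exact: symt_whomog.
  have [|p [hp ->]] := @symt_surj F charF0 n (fgdim W) y wt wt_gt0 N k f hcomm _ kN hf.
    move=> x N0; rewrite -lie_embed_gen; apply: span_y => //; exact: homog_gen.
  by exists p.
move=> g p hp; rewrite /symt wsub_sum; apply: eq_bigr => l _.
by rewrite (sym_subst _ _ (act_y g)).
Qed.

End PBW.

(** * The map psi *)
Section LinearSubstitution.
Variables (F : fieldType).

Definition lsubst k l (A : 'M[F]_(k, l)) (p : {mpoly F[k]}) : {mpoly F[l]} :=
  p \mPo [tuple \sum_j A i j *: 'X_j | i < k].

Variables (k l : nat) (A : 'M[F]_(k, l)).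
Lemma lsubstP c p q : lsubst A (c *: p + q) = c *: lsubst A p + lsubst A q.
Proof. by rewrite /lsubst comp_mpolyD comp_mpolyZ. Qed.
Lemma lsubst1 : lsubst A 1 = 1.
Proof. exact: comp_mpoly1. Qed.
Lemma lsubstM p q : lsubst A (p * q) = lsubst A p * lsubst A q.
Proof. by rewrite /lsubst rmorphM. Qed.
Lemma lsubstX i : lsubst A 'X_i = \sum_j A i j *: 'X_j.
Proof. by rewrite /lsubst comp_mpolyXU -tnth_nth tnth_mktuple. Qed.

Lemma lsubst_homog d p : p \is d.-homog -> lsubst A p \is d.-homog.
Proof.
move=> /dhomogP hp; rewrite [p]mpolyE.
have lin (s : seq 'X_{1..k}) : lsubst A (\sum_(a <- s) p@_a *: 'X_[a]) =
    \sum_(a <- s) p@_a *: lsubst A 'X_[a].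
  elim: s => [|a s IHs]; first by rewrite !big_nil /lsubst comp_mpoly0.
  by rewrite !big_cons lsubstP IHs.
rewrite lin big_seq; apply: rpred_sum => a /hp <-; apply: dhomogZ => /=.
elim/mnm_gen_ind: a => [|i a IHa].
  by rewrite mpolyX0 lsubst1 mdeg0 dhomog1.
rewrite mpolyXD lsubstM mdegD mdeg1; apply: dhomogM IHa.
rewrite lsubstX; apply: rpred_sum => j _; apply: dhomogZ.
by rewrite dhomogX; apply/eqP; exact: mdeg1.
Qed.
End LinearSubstitution.

Lemma lsubst_comp (F : fieldType) k l m (A : 'M[F]_(k, l)) (B : 'M[F]_(l, m)) p :
  lsubst B (lsubst A p) = lsubst (A *m B) p.
Proof.
elim/mpoly_gen_ind: p => [c p q IHp IHq||i p IHp].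
- by rewrite !lsubstP IHp IHq.
- by rewrite !lsubst1.
rewrite !lsubstM IHp !lsubstX; congr (_ * _).
rewrite (linear_fun_sum _ _ (lsubstP B)).
under eq_bigr do rewrite lsubstX scaler_sumr.
rewrite exchange_big; apply: eq_bigr => j _ /=; rewrite mxE scaler_suml.
by apply: eq_bigr => h _; rewrite scalerA.
Qed.

Lemma lsubst_id (F : fieldType) k (p : {mpoly F[k]}) : lsubst 1%:M p = p.
Proof.
elim/mpoly_gen_ind: p => [c p q IHp IHq||i p IHp].
- by rewrite lsubstP IHp IHq.
- exact: lsubst1.
rewrite lsubstM IHp lsubstX (bigD1 i) //= mxE eqxx scale1r big1 ?addr0 // => j ji.
by rewrite mxE eq_sym (negPf ji) scale0r.
Qed.

Section SymmetricSeries.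
Variables (G : groupType) (F : fieldType).
Implicit Types U V W : fgmod G F.

Lemma affords_unique (M : lmodType F) (act : G -> M -> M) (P : M -> Prop) A B :
  (forall g, linear (act g)) -> affords A act P -> affords B act P -> fgiso A B.
Proof.
move=> actL hA hB; apply: (affords_iso (phi := id) hA hB) => //.
by move=> x; split=> [hx|[z hz ->]]; first by exists x.
Qed.

Lemma symm_pow_iso r U V : fgiso U V -> fgiso (symm_pow r U) (symm_pow r V).
Proof.
move=> [P [Q [PQ QP UV]]].
apply: (affords_iso (phi := lsubst P) (symm_powP r U) (symm_powP r V)).
- by move=> c p q; rewrite lsubstP.
- by move=> g; apply: poly_act_linear.
- move=> p _ p0; rewrite -[p]lsubst_id -PQ -lsubst_comp p0.
  exact: (linear_fun0 (lsubstP Q)).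
- move=> p; split=> [hp|[q hq ->]]; last exact: lsubst_homog.
  exists (lsubst Q p); first exact: lsubst_homog.
  by rewrite lsubst_comp QP lsubst_id.
move=> g p _; rewrite -[poly_act g p]/(lsubst (U g) p).
by rewrite -[poly_act g _]/(lsubst (V g) _) !lsubst_comp UV.
Qed.

Lemma symm_series_iso U V : fgiso U V -> symm_series U = symm_series V.
Proof. by move=> UV; apply/fpsP => -[|r] //=; apply/gcl_iso/symm_pow_iso. Qed.

Lemma weighted_powers_unique W wt s1 s2 :
  weighted_powers (W := W) wt s1 -> weighted_powers wt s2 -> s1 = s2.
Proof.
move=> h1 h2; apply/fpsP => n; have [A hA <-] := h1 n; have [B hB <-] := h2 n.
by apply/gcl_iso/(affords_unique _ hA hB) => g; apply: poly_act_linear.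
Qed.

(** Both sides are Hilbert series of one polynomial algebra, on U + V with all weights 1. *)
Lemma symm_seriesD U V : symm_series (fgsum U V) = symm_series U * symm_series V.
Proof.
have h1 W := @weighted_powers_symm G F W 1 isT.
have s1 W : fps_subst 1 (symm_series W) = symm_series W.
  by apply/fpsP => r; rewrite /= dvd1n divn1.
have := h1 (fgsum U V); have := weighted_powers_sum (h1 U) (h1 V); rewrite !s1.
have -> : wtjoin (fun _ : 'I_(fgdim U) => 1%N) (fun _ : 'I_(fgdim V) => 1%N) = fun=> 1%N.
  by apply: funext => i; rewrite /wtjoin; case: (split i).
by move=> h2 h3; apply: weighted_powers_unique h3 h2.
Qed.

Lemma symm_pow1 V : fgiso V (symm_pow 1 V).
Proof.
apply: (affords_iso (phi := fun v : 'rV[F]_(fgdim V) => \sum_i v 0 i *: 'X_i)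
          (affords_natural V) (symm_powP 1 V)).
- move=> c u v; rewrite scaler_sumr -big_split; apply: eq_bigr => i _ /=.
  by rewrite !mxE scalerDl scalerA.
- by move=> g; apply: poly_act_linear.
- move=> v _ v0; apply/rowP => i; rewrite mxE.
  have /(congr1 (mcoeff U_(i))) := v0; rewrite linear_sum /= mcoeff0 => E.
  rewrite -[RHS]E (bigD1 i) //= mcoeffZ mcoeffXU eqxx mulr1 big1 ?addr0 // => j ji.
  by rewrite mcoeffZ mcoeffXU (negPf ji) mulr0.
- move=> p; split=> [/dhomogP hp|[v _ ->]].
    exists (\row_i p@_U_(i)) => //; apply/mpolyP => a; rewrite linear_sum /=.
    have [/mdeg1P[i /eqP->]|a1] := boolP (mdeg a == 1%N).
      rewrite (bigD1 i) //= mxE mcoeffZ mcoeffXU eqxx mulr1 big1 ?addr0 // => j ji.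
      by rewrite mcoeffZ mcoeffXU (negPf ji) mulr0.
    rewrite big1 => [|i _]; last first.
      rewrite mcoeffZ mcoeffX; case: eqP => [E|]; last by rewrite mulr0.
      by rewrite -E mdeg1 eqxx in a1.
    by apply/eqP/negPn/negP; rewrite -mcoeff_msupp => /hp /= a1'; rewrite a1' eqxx in a1.
  apply: rpred_sum => i _; apply: dhomogZ; rewrite dhomogX; apply/eqP; exact: mdeg1.
move=> g v _; rewrite (linear_fun_sum _ _ (@poly_act_linear G F V g)).
under [RHS]eq_bigr do rewrite poly_actX scaler_sumr.
rewrite exchange_big; apply: eq_bigr => j _ /=; rewrite mxE scaler_suml.
by apply: eq_bigr => i _; rewrite scalerA.
Qed.

End SymmetricSeries.

(** Keeps the proof of linearity in the term, so that functions built inside a proof can be used as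
    bundled linear maps. *)
Definition linear_of (R : nzRingType) (U V : lmodType R) (f : U -> V) of linear f := f.
HB.instance Definition _ (R : nzRingType) (U V : lmodType R) (f : U -> V) (fL : linear f) :=
  GRing.isLinear.Build R U V _ (linear_of fL) fL.

(** * Extension of additive invariants of modules to Gamma *)

Section GammaExtension.
Variables (G : groupType) (F : fieldType) (M : lmodType rat) (theta : fgmod G F -> M).
Hypothesis theta_iso : forall U V, fgiso U V -> theta U = theta V.
Hypothesis thetaD : forall U V, theta (fgsum U V) = theta U + theta V.

Definition isocl_lift (x : isocl G F) : M := theta (repr x).
Lemma isocl_liftE V : isocl_lift (\pi_(isocl G F) V) = theta V.
Proof. by apply: theta_iso; apply/isoclP; rewrite reprK. Qed.
Lemma isocl_liftD x y : isocl_lift (x + y) = isocl_lift x + isocl_lift y.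
Proof. by elim/quotW: x => U; elim/quotW: y => V; rewrite isoclDE !isocl_liftE thetaD. Qed.

Definition green_lift (x : green G F) : M := isocl_lift (repr x).1 - isocl_lift (repr x).2.
Lemma green_liftE a b : green_lift (\pi_(green G F) (a, b)) = isocl_lift a - isocl_lift b.
Proof.
have [c /(congr1 isocl_lift)] := @green_repr G F a b; rewrite !isocl_liftD => /addIr.
by rewrite /green_lift => E; apply/eqP; rewrite subr_eq addrAC -E addrK.
Qed.
Lemma green_liftD x y : green_lift (x + y) = green_lift x + green_lift y.
Proof.
elim/greenW: x => a b; elim/greenW: y => c d; rewrite greenDE !green_liftE !isocl_liftD.
by rewrite opprD addrACA.
Qed.
Lemma green_liftMn x n : green_lift (x *+ n) = green_lift x *+ n.
Proof.
elim: n => [|n IHn]; last by rewrite !mulrS green_liftD IHn.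
by rewrite !mulr0n -[0]/(\pi_(green G F) (0, 0)) green_liftE subrr.
Qed.

Definition gamma_lift (x : Gamma G F) : M :=
  ((repr x).2.+1%:R^-1 : rat) *: green_lift (repr x).1.

Lemma natr_inj_scale n (u v : M) : u *+ n.+1 = v *+ n.+1 -> u = v.
Proof.
move=> uv; apply/eqP; rewrite -subr_eq0; apply/eqP.
by apply: (@rat_mulrSn_eq0 M _ n); rewrite mulrnBl uv subrr.
Qed.

(** Fractions are identified up to a further factor l.+1, which cancels because M is a rational
    vector space. *)
Lemma gamma_liftE x n : gamma_lift (\pi_(Gamma G F) (x, n)) = (n.+1%:R^-1 : rat) *: green_lift x.
Proof.
rewrite /gamma_lift; case: gamma_reprP => y m l /=; rewrite !mulr_natr => E.
have n0 i : (i.+1%:R : rat) != 0 by rewrite pnatr_eq0.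
have {}E : green_lift y *+ n.+1 = green_lift x *+ m.+1.
  by apply: (@natr_inj_scale l); rewrite -!green_liftMn E.
apply: (@natr_inj_scale m); rewrite -!scaler_nat scalerA mulfV // scale1r.
apply: (@natr_inj_scale n); rewrite E -!scaler_nat !scalerA.
by rewrite mulrAC mulfV // mul1r.
Qed.

Lemma gamma_lift_linear : linear gamma_lift.
Proof.
move=> q x y; elim/gammaW: x => x m; elim/gammaW: y => y n.
have [a [l ->]] := rat_frac q.
have -> : (a%:~R / l.+1%:R : rat) *: (\pi_(Gamma G F) (x, m) : Gamma G F) =
    \pi_(Gamma G F) (a%:~R * x, (l * m + l + m)%N) :> Gamma G F.
  by rewrite -gammaME -gamma_ratE.
rewrite gammaDE !gamma_liftE.
have n0 i : (i.+1%:R : rat) != 0 by rewrite pnatr_eq0.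
have green_liftMz (z : green G F) (b : int) : green_lift (z *~ b) = green_lift z *~ b.
  case: b => b; first by rewrite -!pmulrn green_liftMn.
  have green_lift0 : green_lift 0 = 0 by have := green_liftMn 0 0; rewrite !mulr0n.
  by apply/eqP; rewrite NegzE !mulrNz -!pmulrn -addr_eq0 -green_liftMn -green_liftD addNr green_lift0.
rewrite mulrzl !mulr_natr green_liftD !green_liftMn green_liftMz -mulSS -(mulSS l m).
rewrite -!scaler_nat -scaler_int scalerDr !scalerA !natrM.
congr (_ *: _ + _ *: _); field; by rewrite !nat1r !n0.
Qed.

Lemma gamma_lift_gcl V : gamma_lift (gcl V) = theta V.
Proof.
rewrite gamma_liftE invr1 scale1r green_liftE isocl_liftE.
have isocl_lift0 : isocl_lift 0 = 0 by apply: (addrI (isocl_lift 0)); rewrite -isocl_liftD !addr0.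
by rewrite isocl_lift0 subr0.
Qed.

End GammaExtension.

Section PsiMap.
Variables (G : groupType) (F : fieldType).

(** log S(V, t) is an additive invariant and so extends linearly to Gamma. This rules out the
    default branch in the definition of [psi]. *)
Lemma psiE (V : fgmod G F) : psi G F (gcl V) = fps_log (symm_series V).
Proof.
pose theta V : fps (Gamma G F) := fps_log (@symm_series G F V).
have th_iso U W : fgiso U W -> theta U = theta W.
  by move=> UW; rewrite /theta (symm_series_iso UW).
have thD U W : theta (fgsum U W) = theta U + theta W.
  by rewrite /theta symm_seriesD fps_logM.
have psiP : is_psi (linear_of (gamma_lift_linear th_iso thD)).
  by move=> W; apply: gamma_lift_gcl.
by rewrite (psi_unique psiP) psiP.
Qed.

Lemma psi_coef1 (x : Gamma G F) : psi G F x 1%N = x.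
Proof.
have [q [U [V ->]]] := Gamma_span x.
have E W : psi G F (gcl W) 1%N = gcl W.
  rewrite psiE /= big_nat1 expr0 divr1 scale1r expr1 fps_coefB subr0.
  by apply/esym/gcl_iso/symm_pow1.
by rewrite linearZ linearB /= !E.
Qed.

End PsiMap.

Lemma fps_log_agree (A : comAlgType rat) (f g : fps A) n :
  (forall i, (i <= n)%N -> f i = g i) -> fps_log f n = fps_log g n.
Proof.
move=> fg; rewrite /=; apply: eq_bigr => k _; congr (_ *: _).
suff H i : (i <= n)%N -> ((f - 1) ^+ k) i = ((g - 1) ^+ k) i by apply: H.
elim: k i => [|k IHk] i ik //; rewrite !exprS !fps_coefM; apply: eq_bigr => j _.
rewrite IHk; last by apply: leq_trans ik; rewrite leq_subr.
by rewrite !fps_coefB fg //; apply: leq_trans ik; rewrite -ltnS.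
Qed.

Section PBWSeries.
Variables (G : groupType) (F : fieldType) (charF0 : [pchar F] =i pred0).

(** The logarithm of the PBW identity: S+ maps the series of Lie powers to -log(1 - V t). The finite
    product [lie_prod V n] agrees with the geometric series up to degree n, which is all that
    coefficient n of the logarithm sees. *)
Lemma S_plus_lie (V : fgmod G F) n :
  S_plus (FPS (fun d => gcl (lie_pow d V))) n = (n%:R^-1 : rat) *: gcl V ^+ n *+ (0 < n)%N.
Proof.
have := fps_log_geom (gcl V) => /(congr1 (fun f : fps (Gamma G F) => f n)) /= <-.
rewrite -[RHS](_ : fps_log (lie_prod V n) n = _); last first.
  by apply: fps_log_agree => i i_n; apply: pbw_tensor_power.
have [_ ->] := fps_log_prod (index_iota 1 n.+1)
  (fun d => fps_subst0 d (symm_series (lie_pow d V)) : _ = 1).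
rewrite fps_coef_sum [LHS]/=; apply: eq_big_nat => d /andP[d0 _].
by rewrite fps_subst_log // -psiE.
Qed.

End PBWSeries.

(** * Divisor sums and inversion *)
Section DivisorSums.

Lemma moebius_mul_prime p e : prime p -> (0 < e)%N ->
  moebius (p * e) = if (p %| e)%N then 0 else - moebius e.
Proof.
move=> pr_p e0; have p0 := prime_gt0 pr_p.
have pe_mem q : (q \in primes (p * e)) = (q == p) || (q \in primes e).
  by rewrite primesM // primes_prime // inE.
case: ifP => pe.
  rewrite /moebius ifF //; apply/negbTE/allPn; exists p; first by rewrite pe_mem eqxx.
  rewrite lognM // (logn_prime p pr_p) eqxx gtn_eqF // add1n ltnS.
  by rewrite -pfactor_dvdn.
have perm_pe : perm_eq (primes (p * e)) (p :: primes e).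
  apply: uniq_perm; rewrite ?primes_uniq //= ?primes_uniq ?andbT.
    by rewrite mem_primes pe !andbF.
rewrite /moebius (perm_all _ perm_pe) (perm_size perm_pe) /= exprS mulN1r.
have pne : p \notin primes e by rewrite mem_primes pe !andbF.
rewrite lognM // (logn_prime p pr_p) eqxx (_ : logn p e = 0%N) //=; last first.
  by rewrite -[LHS]/(nat_of_bool false + _)%N; apply/eqP; rewrite -leqn0 leqNgt -pfactor_dvdn // expn1 pe.
rewrite (@eq_in_all _ _ (fun q => logn q e == 1%N)) => [|q qe]; first by case: ifP; rewrite ?oppr0.
have /negPf qp : q != p by apply: contraNneq pne => <-.
by rewrite lognM // (logn_prime q pr_p) qp.
Qed.

(** Fix a prime p dividing n. A divisor e prime to p cancels against p e, and the remaining divisors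
    are multiples of p^2, where the Moebius function is 0. *)
Lemma sum_moebius n : (0 < n)%N -> \sum_(d <- divisors n) moebius d = (n == 1%N)%:R.
Proof.
move=> n0; have [->|n1] := eqVneq n 1%N; first by rewrite big_seq1.
have n_gt1 : (1 < n)%N by rewrite ltn_neqAle eq_sym n1.
set p := pdiv n; have pr_p : prime p by apply: pdiv_prime.
have p0 := prime_gt0 pr_p; have pn : (p %| n)%N by apply: pdiv_dvd.
have np0 : (0 < n %/ p)%N by rewrite divn_gt0 // dvdn_leq.
rewrite (bigID (fun d => p %| d)%N) /= -big_filter.
have perm1 : perm_eq [seq d <- divisors n | (p %| d)%N] [seq (p * e)%N | e <- divisors (n %/ p)].
  apply: uniq_perm.
  - by rewrite filter_uniq ?divisors_uniq.
  - by rewrite map_inj_uniq ?divisors_uniq // => i j /eqP; rewrite eqn_pmul2l // => /eqP.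
  move=> d; rewrite mem_filter -dvdn_divisors //; apply/andP/idP.
    case=> /dvdnP[e ->] dn; apply/mapP; exists e; last by rewrite mulnC.
    by rewrite -dvdn_divisors // dvdn_divRL.
  case/mapP => e; rewrite -dvdn_divisors // => en ->; rewrite dvdn_mulr //; split=> //.
  by rewrite mulnC -dvdn_divRL.
rewrite (perm_big _ perm1) big_map big_seq.
rewrite (eq_bigr (fun e => if (p %| e)%N then 0 else - moebius e)); last first.
  move=> e; rewrite -dvdn_divisors // => en; apply: moebius_mul_prime => //.
  exact: dvdn_gt0 en.
rewrite -big_seq (bigID (fun e => p %| e)%N) /= big1 ?add0r => [|e -> //].
rewrite (eq_bigr (fun e => - moebius e)) => [|e /negPf -> //].
rewrite sumrN; apply/eqP; rewrite addrC subr_eq0; apply/eqP.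
rewrite -big_filter -[RHS]big_filter; apply/perm_big/uniq_perm.
- by rewrite filter_uniq ?divisors_uniq.
- by rewrite filter_uniq ?divisors_uniq.
move=> e; rewrite !mem_filter -!dvdn_divisors //; case: (boolP (p %| e)%N) => //= pe.
rewrite -{1}(divnK pn) Gauss_dvdl //.
by rewrite coprime_sym prime_coprime.
Qed.

Variable M : nmodType.

Lemma sum_divisors_rev (f : nat -> M) n : (0 < n)%N ->
  \sum_(d <- divisors n) f (n %/ d)%N = \sum_(d <- divisors n) f d.
Proof.
move=> n0; rewrite -(big_map (fun d => n %/ d)%N xpredT f); apply/perm_big/uniq_perm.
- rewrite map_inj_in_uniq ?divisors_uniq // => i j; rewrite -!dvdn_divisors // => ni nj E.
  by rewrite -(mulKn i n0) -(divnA _ ni) E divnA // mulKn.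
- exact: divisors_uniq.
move=> d; rewrite -dvdn_divisors //; apply/mapP/idP.
  by case=> e; rewrite -dvdn_divisors // => en ->; apply/dvdnP; exists e; rewrite mulnC divnK.
move=> dn; exists (n %/ d)%N; first by rewrite -dvdn_divisors // dvdn_div.
by rewrite divnA // mulKn.
Qed.

(** Both sides run over the pairs (d, e) with d e dividing n; on the right they are grouped by k = d
    e. *)
Lemma exchange_divisors (f : nat -> nat -> M) n : (0 < n)%N ->
  \sum_(d <- divisors n) \sum_(e <- divisors (n %/ d)) f d e =
  \sum_(k <- divisors n) \sum_(d <- divisors k) f d (k %/ d)%N.
Proof.
move=> n0.
transitivity (\sum_(d <- divisors n) \sum_(k <- divisors n | (d %| k)%N) f d (k %/ d)%N).
  rewrite big_seq [RHS]big_seq; apply: eq_bigr => d; rewrite -dvdn_divisors // => dn.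
  have d0 := dvdn_gt0 n0 dn.
  have nd0 : (0 < n %/ d)%N by rewrite divn_gt0 // dvdn_leq.
  have perm1 : perm_eq [seq k <- divisors n | (d %| k)%N] [seq (d * e)%N | e <- divisors (n %/ d)].
    apply: uniq_perm.
    - by rewrite filter_uniq ?divisors_uniq.
    - by rewrite map_inj_uniq ?divisors_uniq // => i j /eqP; rewrite eqn_pmul2l // => /eqP.
    move=> k; rewrite mem_filter -dvdn_divisors //; apply/andP/idP.
      case=> /dvdnP[e ->] en; apply/mapP; exists e; last by rewrite mulnC.
      by rewrite -dvdn_divisors // dvdn_divRL.
    case/mapP => e; rewrite -dvdn_divisors // => en ->; rewrite dvdn_mulr //; split=> //.
    by rewrite mulnC -dvdn_divRL.
  rewrite -[RHS]big_filter (perm_big _ perm1) big_map; apply: eq_bigr => e _.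
  by rewrite mulKn.
rewrite (exchange_big_dep xpredT) //=; rewrite big_seq [RHS]big_seq; apply: eq_bigr => k.
rewrite -dvdn_divisors // => kn; have k0 := dvdn_gt0 n0 kn.
rewrite -[LHS]big_filter; apply/perm_big/uniq_perm.
- by rewrite filter_uniq ?divisors_uniq.
- exact: divisors_uniq.
move=> d; rewrite mem_filter -!dvdn_divisors //; case: (boolP (d %| k)%N) => //= dk.
exact: dvdn_trans dk kn.
Qed.

Lemma sum_dvdn_divisors (f : nat -> M) n : (0 < n)%N ->
  \sum_(1 <= i < n.+1) (if (i %| n)%N then f i else 0) = \sum_(d <- divisors n) f d.
Proof.
move=> n0; rewrite -big_mkcond -big_filter; apply/perm_big/uniq_perm.
- by rewrite filter_uniq ?iota_uniq.
- exact: divisors_uniq.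
move=> d; rewrite mem_filter mem_index_iota -dvdn_divisors //.
case: (boolP (d %| n)%N) => //= dn; have d0 := dvdn_gt0 n0 dn.
by rewrite d0 ltnS dvdn_leq.
Qed.

End DivisorSums.

(** * The Dirichlet inverse of psi and the Lie resolvents *)

Section Inverse.
Variables (G : groupType) (F : fieldType) (charF0 : [pchar F] =i pred0).
Local Notation Gamma := (Gamma G F).
Local Notation psi := (psi G F).

Lemma S_plusE (f : fps Gamma) n : (0 < n)%N ->
  S_plus f n = \sum_(d <- divisors n) psi (f (n %/ d)%N) d.
Proof.
move=> n0; rewrite [LHS]/= (sum_dvdn_divisors (fun i => psi (f i) (n %/ i)%N)) //.
rewrite -[RHS](sum_divisors_rev (fun d => psi (f (n %/ d)%N) d)) // big_seq [RHS]big_seq.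
apply: eq_bigr => d; rewrite -dvdn_divisors // => dn.
by rewrite divnA // mulKn.
Qed.

Lemma psi_coef_linear n : linear (fun x => psi x n).
Proof. by move=> c x y; rewrite linearP. Qed.

(* Up to degree N, since a left Dirichlet inverse is built one degree at a time. *)
Lemma psi_left_inverse N : exists phi : nat -> Gamma -> Gamma,
  (forall d, linear (phi d)) /\
  forall k x, (0 < k <= N)%N ->
    \sum_(d <- divisors k) phi d (psi x (k %/ d)%N) = if k == 1%N then x else 0.
Proof.
elim: N => [|N [phi [phiL phiP]]].
  by exists (fun _ _ => 0); split=> [d c x y|k x]; rewrite ?scaler0 ?addr0 // => /andP[]; case: k.
(* The equation in degree N.+1 solved for its last term, where psi enters through its coefficient 1,
   the identity. The right-hand side of the equation is x only in degree 1, that is for N = 0. *)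
pose new x := (if N == 0%N then x else 0) -
  \sum_(d <- divisors N.+1 | (d < N.+1)%N) phi d (psi x (N.+1 %/ d)%N).
exists (fun d => if d == N.+1 then new else phi d); split=> [d|k x /andP[k0]].
  case: (d == N.+1) => // c x y; rewrite /new.
  rewrite (eq_bigr (fun d => c *: phi d (psi x (N.+1 %/ d)%N) + phi d (psi y (N.+1 %/ d)%N))).
    rewrite big_split /= -scaler_sumr opprD scalerBr addrACA; congr (_ + _).
    by case: (N == 0%N); rewrite ?scaler0 ?addr0.
  by move=> e _; rewrite psi_coef_linear phiL.
rewrite leq_eqVlt => /orP[/eqP->|kN]; last first.
  rewrite -[RHS](phiP k x) ?k0 // big_seq [RHS]big_seq; apply: eq_bigr => d.
  rewrite -dvdn_divisors // => /(dvdn_leq k0) dk; case: eqP => // E.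
  by move: dk; rewrite E leqNgt kN.
have mem_last : N.+1 \in divisors N.+1 by rewrite -dvdn_divisors.
rewrite (bigD1_seq N.+1) ?divisors_uniq //= eqxx divnn psi_coef1 /new eqSS.
rewrite [X in _ + X](_ : _ =
  \sum_(d <- divisors N.+1 | (d < N.+1)%N) phi d (psi x (N.+1 %/ d)%N)) ?subrK //.
rewrite big_seq_cond [RHS]big_seq_cond; apply: eq_big => [d|d].
  rewrite -dvdn_divisors //; case: (boolP (d %| N.+1)%N) => //= dN.
  by rewrite ltn_neqAle (dvdn_leq _ dN) ?andbT.
by case/andP => _ /negPf->.
Qed.

Section Resolvent.
Variables (N : nat) (phi : nat -> Gamma -> Gamma).
Hypothesis phiL : forall d, linear (phi d).
Hypothesis phiP : forall k x, (0 < k <= N)%N ->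
    \sum_(d <- divisors k) phi d (psi x (k %/ d)%N) = if k == 1%N then x else 0.

Lemma phi_sum d I (r : seq I) (E : I -> Gamma) :
  phi d (\sum_(i <- r) E i) = \sum_(i <- r) phi d (E i).
Proof. exact: (linear_sum (linear_of (phiL d))). Qed.
Lemma phiZ d c x : phi d (c *: x) = c *: phi d x.
Proof. exact: (linearZ_LR (linear_of (phiL d))). Qed.

(** Associativity of Dirichlet convolution: grouping the double sum by k = d e exposes the
    convolution of phi with psi, of which only k = 1 survives. *)
Lemma phi_S_plus (f : fps Gamma) n : (0 < n <= N)%N ->
  \sum_(d <- divisors n) phi d (S_plus f (n %/ d)%N) = f n.
Proof.
move=> /andP[n0 nN].
transitivity (\sum_(d <- divisors n) \sum_(e <- divisors (n %/ d))
    phi d (psi (f (n %/ (d * e))%N) e)).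
  rewrite big_seq [RHS]big_seq; apply: eq_bigr => d; rewrite -dvdn_divisors // => dn.
  have nd0 : (0 < n %/ d)%N by rewrite divn_gt0 ?(dvdn_gt0 n0) // dvdn_leq.
  by rewrite S_plusE // phi_sum; apply: eq_bigr => e _; rewrite divnMA.
rewrite (exchange_divisors (fun d e => phi d (psi (f (n %/ (d * e))%N) e))) //.
transitivity (\sum_(k <- divisors n) if k == 1%N then f (n %/ k)%N else 0).
  rewrite big_seq [RHS]big_seq; apply: eq_bigr => k; rewrite -dvdn_divisors // => kn.
  have k0 := dvdn_gt0 n0 kn.
  rewrite -(phiP (f (n %/ k)%N)); last by rewrite k0 (leq_trans (dvdn_leq n0 kn)).
  rewrite big_seq [RHS]big_seq; apply: eq_bigr => d; rewrite -dvdn_divisors // => dk.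
  by rewrite mulnC divnK.
rewrite (bigD1_seq 1%N) ?divisors_uniq //= ?divn1; last by rewrite -dvdn_divisors // dvd1n.
by rewrite big1 ?addr0 // => k /negPf->.
Qed.

Lemma lie_pow_phi V n : (0 < n <= N)%N -> gcl (lie_pow n V) =
  \sum_(d <- divisors n) ((n %/ d)%:R^-1 : rat) *: phi d (gcl V ^+ (n %/ d)).
Proof.
move=> /[dup] nN /andP[n0 _]; rewrite -[LHS]/(FPS (fun d => gcl (lie_pow d V)) n).
rewrite -(phi_S_plus _ nN) big_seq [RHS]big_seq; apply: eq_bigr => d.
rewrite -dvdn_divisors // => dn.
have nd0 : (0 < n %/ d)%N by rewrite divn_gt0 ?(dvdn_gt0 n0) // dvdn_leq.
by rewrite S_plus_lie // nd0 mulr1n phiZ.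
Qed.

Lemma gcl_fgpow (V : fgmod G F) k : gcl (fgpow V k) = gcl V ^+ k.
Proof. by elim: k => [|k IHk] //=; rewrite gclM IHk exprS. Qed.

(** Since r phi_r is linear and has the prescribed values on modules, it is the resolvent by
    uniqueness. This is also where existence of the resolvent comes from. *)
Lemma lie_resolvent_phi r x : (0 < r <= N)%N -> lie_resolvent G F r x = (r%:R : rat) *: phi r x.
Proof.
move=> /[dup] rN /andP[r0 r_le].
have rphiL : linear (fun x => (r%:R : rat) *: phi r x).
  by move=> c y z; rewrite phiL scalerDr !scalerA mulrC.
apply: (@lie_resolvent_unique G F r (linear_of rphiL)) => V; rewrite /linear_of.
(* Summed over e first, the Moebius function leaves only d = r, hence r phi_r(V). Grouped by k = d
   e, the inner sum is [lie_pow_phi] for the module V^(r/k), which gives the defining formula. *)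
pose H d e := ((moebius (r %/ (d * e)))%:~R * d%:R : rat) *: phi d (gcl V ^+ (r %/ d)).
transitivity (\sum_(d <- divisors r) \sum_(e <- divisors (r %/ d)) H d e).
  rewrite (bigD1_seq r) ?divisors_uniq //=; last by rewrite -dvdn_divisors.
  rewrite [X in _ = _ + X]big_seq_cond [X in _ = _ + X]big1 ?addr0.
    rewrite divnn r0 big_seq1 /H muln1 divnn r0 expr1.
    by rewrite [moebius 1]/moebius /= mul1r.
  move=> d /andP[]; rewrite -dvdn_divisors // => dr dr'.
  have d0 := dvdn_gt0 r0 dr.
  have rd0 : (0 < r %/ d)%N by rewrite divn_gt0 // dvdn_leq.
  rewrite /H -scaler_suml -mulr_suml; under eq_bigr do rewrite divnMA.
  rewrite (sum_divisors_rev (fun e => (moebius e)%:~R : rat)) //.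
  have /(congr1 (intr : int -> rat)) := sum_moebius rd0.
  rewrite rmorph_sum /= => ->.
  have -> : (r %/ d == 1)%N = false.
    by apply/negbTE; apply: contraNneq dr' => E; rewrite -(divnK dr) E mul1n.
  by rewrite mul0r scale0r.
rewrite exchange_divisors // big_seq [RHS]big_seq; apply: eq_bigr => k.
rewrite -dvdn_divisors // => kr; have k0 := dvdn_gt0 r0 kr.
rewrite lie_pow_phi ?k0 ?(leq_trans (dvdn_leq r0 kr)) // scaler_sumr.
rewrite big_seq [RHS]big_seq; apply: eq_bigr => d; rewrite -dvdn_divisors // => dk.
have d0 := dvdn_gt0 k0 dk.
have kd0 : (k %/ d)%:R != 0 :> rat by rewrite pnatr_eq0 -lt0n divn_gt0 // dvdn_leq.
rewrite /H mulnC divnK // gcl_fgpow -exprM scalerA; congr (_ *: phi d (_ ^+ _)).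
  have -> : k%:R = (k %/ d)%:R * d%:R :> rat by rewrite -natrM divnK.
  by field; exact: kd0.
by rewrite muln_divA // divnK.
Qed.

Lemma L_plus_phi (f : fps Gamma) n : (0 < n <= N)%N ->
  L_plus f n = \sum_(d <- divisors n) phi d (f (n %/ d)%N).
Proof.
move=> /andP[n0 nN]; rewrite [LHS]/= big_seq [RHS]big_seq; apply: eq_bigr => d.
rewrite -dvdn_divisors // => dn; have d0 := dvdn_gt0 n0 dn.
rewrite lie_resolvent_phi ?d0 ?(leq_trans (dvdn_leq n0 dn)) // scalerA mulVf ?scale1r //.
by rewrite pnatr_eq0 -lt0n.
Qed.

End Resolvent.

(* divisors 0 is [:: 1]. *)
Lemma L_plus0 (f : fps Gamma) : f 0%N = 0 -> L_plus f 0%N = 0.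
Proof.
by move=> f0; rewrite -[LHS]/(\sum_(d <- [:: 1%N]) _) big_seq1 div0n f0 linear0 scaler0.
Qed.
Lemma S_plus0 (f : fps Gamma) : S_plus f 0%N = 0.
Proof. by rewrite /= big_geq. Qed.

Lemma S_plusK (f : fps Gamma) : f 0%N = 0 -> L_plus (S_plus f) = f.
Proof.
move=> f0; apply/fpsP => -[|n]; first by rewrite L_plus0 ?S_plus0.
(* phi depends on the truncation, but coefficient n.+1 involves only divisors of n.+1, so this bound
   is enough. *)
have [phi [phiL phiP]] := psi_left_inverse n.+1.
have nn : (0 < n.+1 <= n.+1)%N by rewrite leqnn.
rewrite (L_plus_phi phiL phiP (S_plus f) nn).
exact: (phi_S_plus phiL phiP f nn).
Qed.

Lemma lie_resolvent1 (x : Gamma) : lie_resolvent G F 1 x = x.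
Proof.
have [phi [phiL phiP]] := psi_left_inverse 1.
rewrite (lie_resolvent_phi phiL phiP) // scale1r.
by have := phiP 1%N x isT; rewrite big_seq1 divnn /= psi_coef1.
Qed.

(** As Phi^1 is the identity, coefficient n.+1 of [L_plus f] is f n.+1 plus terms in lower
    coefficients of f. *)
Lemma L_plus_inj (f g : fps Gamma) : f 0%N = g 0%N -> L_plus f = L_plus g -> f = g.
Proof.
move=> fg0 fg; apply/fpsP; elim/ltn_ind => -[|n] IHn //.
have /(congr1 (fun h : fps Gamma => h n.+1)) := fg.
have mem1 : 1%N \in divisors n.+1 by rewrite -dvdn_divisors.
rewrite /= !(bigD1_seq 1%N mem1) ?divisors_uniq //= invr1 !scale1r !lie_resolvent1 divn1.
rewrite (_ : \sum_(d <- divisors n.+1 | d != 1%N) _ = \sum_(d <- divisors n.+1 | d != 1%N)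
  (d%:R^-1 : rat) *: lie_resolvent G F d (g (n.+1 %/ d)%N)); first exact: addIr.
rewrite big_seq_cond [RHS]big_seq_cond; apply: eq_bigr => d.
rewrite -dvdn_divisors // => /andP[dn d1]; rewrite IHn // ltn_Pdiv //.
by rewrite ltn_neqAle eq_sym d1 (dvdn_gt0 _ dn).
Qed.

(** [L_plus] takes both sides to [L_plus f], by the left inverse property, and it is injective. *)
Lemma L_plusK (f : fps Gamma) : f 0%N = 0 -> S_plus (L_plus f) = f.
Proof.
move=> f0; apply: L_plus_inj; first by rewrite S_plus0 f0.
by rewrite S_plusK // L_plus0.
Qed.

End Inverse.

Theorem theorem5p4 (G : groupType) (F : fieldType)
    (charF0 : [pchar F] =i pred0) :
  (forall f : fps (Gamma G F), f 0%N = 0 -> L_star (S_star f) = f) /\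
  (forall f : fps (Gamma G F), f 0%N = 1 -> S_star (L_star f) = f).
Proof.
split=> f f0.
  by rewrite /L_star /S_star fps_expK ?S_plusK // S_plus0.
by rewrite /L_star /S_star L_plusK ?fps_logK // fps_log0.
Qed.
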